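(* Let $X_0\in W^{1,1}(\mathbb S,\mathbb R^2)$ with $\mathcal L(X_0)>0$, and let $\lambda>0$, $a\in\mathbb R$. Then there is a unique positive-length solution $X\in C^1([0,T_a),W^{1,1}(\mathbb S,\mathbb R^2))$ of $\partial_t X=F_{\lambda,a}(X)$ with $X(\cdot,0)=X_0$, where $T_a=\infty$ if $a\ge 2$, while for $a<2$ $$0<T_a\le \frac{1+8\lambda^2}{4(2-a)}\,\mathcal L(X_0)^{2-a}<\infty .$$ As $t\uparrow T_a$, $X(\cdot,t)$ converges in $W^{1,1}(\mathbb S,\mathbb R^2)$ to a constant map $u\mapsto \mathsf x_\infty\in\mathbb R^2$ with $|\mathsf x_\infty|\le \|X_0\|_{L^\infty}$.
   Context: $\mathbb S=[0,1]/\{0\sim 1\}$ is the circle. $W^{1,1}(\mathbb S,\mathbb R^2)$ is the usual Sobolev space, with elements identified with their absolutely continuous representatives. $|\cdot|$ is the Euclidean norm and $\|\gamma\|_{L^\infty}=\sup_u|\gamma(u)|$. Length: $\mathcal L(\gamma)=\int_0^1|\gamma'(u)|\,du$. For $\lambda>0$, $\mathcal G^\lambda:\mathbb S\to\mathbb R$ is the 1-periodic extension of $$\mathcal G^\lambda(x)=-\frac{\cosh\left(\frac{|x|-1/2}{\lambda}\right)}{2\lambda\sinh\left(\frac1{2\lambda}\right)},\qquad x\in[0,1].$$ For $\mathcal L(\gamma)>0$ set $\rho_\gamma(u)=\frac1{\mathcal L(\gamma)}\int_0^u|\gamma'(\tau)|\,d\tau$ and $$(\gamma*_\gamma\mathcal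 G^\lambda)(u)=\int_0^1\gamma(v)\,\mathcal G^\lambda(\rho_\gamma(v)-\rho_\gamma(u))\,\frac{|\gamma'(v)|}{\mathcal L(\gamma)}\,dv .$$ Define $F_{\lambda,a}(\gamma)=-\frac{\mathcal L(\gamma)^{a-2}}{\lambda^2}\left(\gamma+\gamma*_\gamma\mathcal G^\lambda\right)$ if $\mathcal L(\gamma)\ne0$ and $F_{\lambda,a}(\gamma)=0$ if $\mathcal L(\gamma)=0$. A solution of $\partial_tX=F_{\lambda,a}(X)$ on an interval $I$ is a curve $X\in C^1(I,W^{1,1}(\mathbb S,\mathbb R^2))$, written $X(u,t)=X(t)(u)$, satisfying the equation as an ODE in $W^{1,1}(\mathbb S,\mathbb R^2)$ for all $t\in I$; it is positive-length if $\mathcal L(X(\cdot,t))>0$ for all $t\in I$. *)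

(* Defs.v *)
From HB Require Import structures.
From mathcomp Require Import all_boot all_order all_algebra.
From mathcomp Require Import all_classical all_reals all_analysis.

Set Implicit Arguments.
Unset Strict Implicit.
Unset Printing Implicit Defensive.

Import Order.TTheory GRing.Theory Num.Theory.
Import numFieldNormedType.Exports.

Local Open Scope classical_set_scope.
Local Open Scope ring_scope.

(* A function on the circle [0,1]/{0~1} is a 1-periodic function on R, and all
   integrals are taken over the period [0,1]. *)

Section euclidean_plane.
Context {R : realType}.

(* The library norm on 'rV[R]_2 is the sup norm, hence this definition. *)
Definition enorm (x : 'rV[R]_2) : R := Num.sqrt (\sum_(i < 2) x 0 i ^+ 2).

End euclidean_plane.

Section sobolev_space.
Context {R : realType}.
Local Notation mu := (@lebesgue_measure R).
Implicit Types (gamma g : R -> 'rV[R]_2) (phi : R -> R).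

Definition test_function phi : Prop :=
  [/\ periodic phi 1, forall u, derivable phi u 1 & continuous (derive1 phi)].

Definition is_weak_derivative gamma g : Prop :=
  forall i : 'I_2,
    mu.-integrable `[0, 1] (EFin \o (fun u => g u 0 i)) /\
    forall phi, test_function phi ->
      \int[mu]_(u in `[0, 1]) (gamma u 0 i * derive1 phi u) =
      - \int[mu]_(u in `[0, 1]) (g u 0 i * phi u).

Definition absolutely_continuous gamma : Prop :=
  forall e : R, 0 < e -> exists2 d : R, 0 < d &
    forall (n : nat) (a b : 'I_n -> R),
      (forall i, [&& 0 <= a i, a i <= b i & b i <= 1]) ->
      trivIset [set: 'I_n] (fun i => `]a i, b i[%classic) ->
      \sum_(i < n) (b i - a i) < d ->
      \sum_(i < n) enorm (gamma (b i) - gamma (a i)) < e.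

(* W^{1,1}(S, R^2): an element is its absolutely continuous representative, so
   that equality in W^{1,1} is equality of functions. *)
Definition W11 gamma : Prop :=
  [/\ periodic gamma 1,
      absolutely_continuous gamma &
      exists g, is_weak_derivative gamma g].

(* A representative of gamma'; it is determined almost everywhere on [0,1],
   and is only used under integrals over subsets of [0,1]. *)
Definition wderiv gamma : R -> 'rV[R]_2 :=
  xget (fun=> 0) [set g | is_weak_derivative gamma g].

Definition W11_norm gamma : R :=
  \int[mu]_(u in `[0, 1]) enorm (gamma u) +
  \int[mu]_(u in `[0, 1]) enorm (wderiv gamma u).

Definition Linfty_norm gamma : R := sup (range (fun u => enorm (gamma u))).

End sobolev_space.

Section flow_field.
Context {R : realType}.
Local Notation mu := (@lebesgue_measure R).
Implicit Types (gamma : R -> 'rV[R]_2) (lambda a u x : R).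

Definition cosh x : R := (expR x + expR (- x)) / 2.
Definition sinh x : R := (expR x - expR (- x)) / 2.

Definition frac_part x : R := x - (Num.floor x)%:~R.

Definition G lambda x : R :=
  - (cosh ((`|frac_part x| - 2^-1) / lambda) /
     (2 * lambda * sinh (1 / (2 * lambda)))).

Definition len gamma : R := \int[mu]_(u in `[0, 1]) enorm (wderiv gamma u).

(* Using the representative frac_part u in [0,1) makes rho a function on the
   circle; it only enters through the 1-periodic function G, which does not
   see the jump from 1 to 0 at integers. *)
Definition rho gamma u : R :=
  (len gamma)^-1 * \int[mu]_(t in `[0, frac_part u]) enorm (wderiv gamma t).

Definition curve_conv lambda gamma u : 'rV[R]_2 :=
  \row_(i < 2) \int[mu]_(v in `[0, 1])
    (gamma v 0 i * G lambda (rho gamma v - rho gamma u) *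
     (enorm (wderiv gamma v) / len gamma)).

Definition F lambda a gamma : R -> 'rV[R]_2 :=
  if len gamma == 0 then fun=> 0
  else fun u => - (len gamma `^ (a - 2) / lambda ^+ 2) *:
                  (gamma u + curve_conv lambda gamma u).

End flow_field.

Section solutions.
Context {R : realType}.
Implicit Types (X dX : R -> R -> 'rV[R]_2) (I : set R) (T : \bar R).

(* Curves are written X t u, time first. *)

(* X in C^1(I, W^{1,1}) with derivative dX, one-sided at endpoints of I. *)
Definition is_C1_derivative I X dX : Prop :=
  [/\ forall t, I t -> W11 (X t),
      forall t, I t -> W11 (dX t),
      forall t, I t ->
        W11_norm ((s - t)^-1 *: (X s - X t) - dX t)
          @[s --> within I t^'] --> (0 : R) &
      forall t, I t ->
        W11_norm (dX s - dX t) @[s --> within I (nbhs t)] --> (0 : R)].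

Definition solution (lambda a : R) I X : Prop :=
  exists2 dX, is_C1_derivative I X dX &
    forall t, I t -> dX t = F lambda a (X t).

Definition positive_length I X : Prop := forall t, I t -> 0 < len (X t).

Definition time_interval T : set R := [set t | 0 <= t /\ (t%:E < T)%E].

(* The filter of t increasing to T; it is only used for T > 0. *)
Definition up_to T : set_system R :=
  match T with r%:E%E => r^'- | _ => pinfty_nbhs R end.

End solutions.

(* Main.v *)
Require Import Defs.
From mathcomp Require Import all_boot all_order all_algebra.
From mathcomp Require Import all_classical all_reals all_analysis.
From mathcomp Require Import measurable_realfun ring lra.
Import Order.TTheory GRing.Theory Num.Theory.
Import numFieldNormedType.Exports.
Local Open Scope classical_set_scope.
Local Open Scope ring_scope.

(** The proof works with the derivative [w] of the curve.  An element of
    [W^{1,1}] is the indefinite integral of an integrable [w] of mean zero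
    ([W11_represents], [represents_W11]).  The kernel [G] is the opposite of the
    positive periodic Green function [green] of [1 - lambda^2 d^2/dx^2], and an
    integration by parts expresses the field through [w] alone: up to the factor
    [L^{a-2} / lambda^2], with [L] the length, it is the curve [velocity w]
    ([F_velocity]), whose derivative is [- w + |w| P].  Here [P] is the
    convolution of the unit tangent with [green] in the normalized arclength.
    The factor only changes the speed at which time passes, so the flow
    [d/dt X = velocity w] is treated first.

    Existence.  The convolution is Lipschitz in [L^1] with respect to [w] as
    long as the length is bounded from below ([smear_speed_lipschitz],
    [velocity_lipschitz]).  Since [P] is an average of unit vectors, [|w|] grows
    or shrinks pointwise by at most exponential factors, and a Picard iteration
    for the quotient of [w] by its initial size gives a solution for all times
    ([picard], [density_flow], [rescaled_flow]).

    Decay.  The length satisfies [L' = - int (|w| - w . P)].  In the normalized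
    arclength parameter [P - lambda^2 P''] is the unit tangent [w / |w|], and the
    energy identity for this equation together with the Poincare inequality
    [4 int |P|^2 <= int |P'|^2] bounds [int w . P] by [L / (1 + 4 lambda^2)]
    ([smear_energy], [smear_poincare], [smear_correlation], [dissipation]).
    So [L] decays at least like [exp (- kappa t)] with
    [kappa = 4 lambda^2 / (1 + 4 lambda^2)] ([flow_len_decay]).  The velocity of
    the base point is bounded by a multiple of [L], hence the curve converges to
    a point; the sup norm does not increase, because each point moves towards an
    average of the curve ([flow_Linfty_norm], [flow_limit]).

    Change of time.  The original time is [t = lambda^2 int L^{2-a}] ([clock]).
    Its supremum is the maximal time: it is infinite for [2 <= a] because [L]
    decreases, and for [a < 2] the decay of [L] bounds it by
    [(1 + 4 lambda^2) / (4 (2 - a)) L(X_0)^{2-a}].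

    Uniqueness.  On compact time intervals the lengths of two solutions stay
    away from zero, where the field is Lipschitz, and a Gronwall inequality for
    the norm of the difference applies ([F_lipschitz], [solution_unique]).

    Two devices replace differentiation almost everywhere and under integrals.
    Functions of the curve parameter are compared through their increments: a
    function whose increments are quadratically small with respect to a
    continuous function is constant ([quadratic_increment_cst]).
    Functions of time are compared through Euler steps: derivatives are stated
    with a quadratic remainder ([quad_deriv]), and inequalities follow from a
    Gronwall lemma for one-sided increments ([dini_gronwall]). *)

Set Implicit Arguments.
Unset Strict Implicit.
Unset Printing Implicit Defensive.

(** * Continuity, a Gronwall inequality, and quadratic increments *)

Section real_line.
Context {R : realType}.
Implicit Types f g : R -> R.

Lemma within_continuous_eps f a b : {within `[a, b], continuous f} ->
  forall t, a <= t <= b -> forall e, 0 < e ->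
  exists2 d, 0 < d & forall s, a <= s <= b -> `|s - t| < d -> `|f s - f t| < e.
Proof.
move=> /subspace_continuousP cf t tab e e0.
have tin : [set` `[a, b]] t by rewrite /= in_itv.
have /cvgrPdist_lt /(_ e e0) [d /= d0 H] := cf t tin.
exists d => // s sab std.
rewrite distrC; apply: H; first by rewrite /ball /= distrC.
by rewrite /= in_itv.
Qed.

Lemma eps_within_continuous f a b :
  (forall t, a <= t <= b -> forall e, 0 < e ->
  exists2 d, 0 < d & forall s, a <= s <= b -> `|s - t| < d -> `|f s - f t| < e) ->
  {within `[a, b], continuous f}.
Proof.
move=> H; apply/subspace_continuousP => t; rewrite /= in_itv /= => tab.
apply/cvgrPdist_lt => e e0; have [d d0 Hd] := H t tab e e0.
exists d => //= s; rewrite /ball /= => std; rewrite in_itv /= => sab.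
by rewrite distrC; apply: Hd => //; rewrite distrC.
Qed.

Lemma lipschitz_within_continuous f a b K :
  (forall s t, a <= s <= b -> a <= t <= b -> `|f s - f t| <= K * `|s - t|) ->
  {within `[a, b], continuous f}.
Proof.
move=> H; apply: eps_within_continuous => t tab e e0.
have K0 : 0 < `|K| + 1 by rewrite ltr_wpDl.
exists (e / (`|K| + 1)); first exact: divr_gt0.
move=> s sab; rewrite ltr_pdivlMr // => h; apply: le_lt_trans (H _ _ sab tab) _.
apply: le_lt_trans h; rewrite mulrC ler_wpM2l //.
by rewrite (le_trans (ler_norm K)) // lerDl.
Qed.

Lemma expR_ge1 (x : R) : 0 <= x -> 1 <= expR x.
Proof. by move=> x0; apply: le_trans (expR_ge1Dx x); rewrite lerDl. Qed.

(** A Gronwall inequality whose hypothesis is a one-sided difference inequality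
    rather than a differential one, so that it applies to norms and to suprema.
    It is tested only where [phi] is positive, which makes it a barrier lemma
    as well.  The comparison function is [e * expR ((K + 1) * t)]: at the last
    time where [phi] lies below it, the inequality keeps [phi] strictly below. *)
Lemma dini_gronwall (phi : R -> R) (K T : R) : 0 <= K ->
  {within `[0, T], continuous phi} -> phi 0 <= 0 ->
  (forall t, 0 <= t < T -> 0 < phi t -> forall e, 0 < e ->
     exists2 d, 0 < d & forall s, t < s < t + d -> s <= T ->
       phi s <= phi t + (s - t) * (K * phi t + e)) ->
  forall t, 0 <= t <= T -> phi t <= 0.
Proof.
move=> K0 /within_continuous_eps cphi phi0 dini t1 /andP[t10 t1T].
apply/ler_addgt0Pl => e0 e00; rewrite addr0.
pose e := e0 / expR ((K + 1) * t1).
have e_gt0 : 0 < e by rewrite divr_gt0 // expR_gt0.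
pose psi t := e * expR ((K + 1) * t).
suff : phi t1 <= psi t1 by rewrite /psi /e mulfVK // gt_eqF // expR_gt0.
rewrite leNgt; apply/negP => lt1.
have psi_gt0 t : 0 < psi t by rewrite mulr_gt0 // expR_gt0.
have psi_step s t : 0 <= t -> t <= s -> psi t + (s - t) * (K * psi t + e) <= psi s.
  move=> t0 ts; have epsi : e <= psi t.
    by rewrite /psi ler_peMr ?(ltW e_gt0) // expR_ge1 // mulr_ge0 // addr_ge0.
  have -> : psi s = psi t * expR ((K + 1) * (s - t)).
    by rewrite /psi -mulrA -expRD; congr (_ * expR _); ring.
  apply: (@le_trans _ _ (psi t * (1 + (K + 1) * (s - t)))); last first.
    by rewrite ler_pM2l // expR_ge1Dx.
  have : 0 <= (s - t) * (psi t - e) by rewrite mulr_ge0 // subr_ge0.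
  lra.
have cpsi t : 0 <= t <= T -> forall r, 0 < r -> exists2 d, 0 < d &
    forall s, 0 <= s <= T -> `|s - t| < d -> `|phi s - psi s - (phi t - psi t)| < r.
  apply: within_continuous_eps; apply: eps_within_continuous => {}t tT r r0.
  have /within_continuous_eps cp : {within `[0, T], continuous psi}.
    apply: continuous_subspaceT => x; rewrite /psi.
    apply: cvgM; first exact: cvg_cst.
    apply: continuous_comp; last exact: continuous_expR.
    by apply: cvgM; [exact: cvg_cst|exact: cvg_id].
  have r20 : 0 < r / 2 by rewrite divr_gt0.
  have [d1 d10 H1] := cphi t tT _ r20.
  have [d2 d20 H2] := cp t tT _ r20.
  exists (Num.min d1 d2); first by rewrite lt_min d10.
  move=> s sT; rewrite lt_min => /andP[/(H1 _ sT) + /(H2 _ sT)].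
  move: (phi s) (psi s) (phi t) (psi t) => c1 c2 c3 c4; clear.
  by rewrite !ltr_norml => /andP[? ?] /andP[? ?]; apply/andP; split; lra.
pose A := [set s | 0 <= s <= t1 /\ phi s <= psi s].
have A0 : A 0.
  split; first by rewrite lexx.
  exact: le_trans phi0 (ltW (psi_gt0 _)).
have supA : has_sup A by split; [exists 0|exists t1 => s -[/andP[]]].
(* The last time up to [t1] at which [phi] lies below the comparison function. *)
pose s0 := sup A.
have s00 : 0 <= s0 by apply: ub_le_sup => //; case: supA.
have s01 : s0 <= t1 by apply: ge_sup; [exists 0|move=> s -[/andP[]]].
have s0T : 0 <= s0 <= T by rewrite s00 (le_trans s01).
have le0 : phi s0 <= psi s0.
  rewrite leNgt; apply/negP => lt0.
  have r0 : 0 < phi s0 - psi s0 by rewrite subr_gt0.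
  have [d d0 Hd] := cpsi s0 s0T _ r0.
  have [s As ds] := sup_adherent d0 supA.
  case: (As) => /andP[se0 st1] le; have ss0 : s <= s0 by apply: ub_le_sup => //; case: supA.
  have : `|s - s0| < d.
    by rewrite ler0_norm ?subr_le0 // opprB ltrBlDr addrC -ltrBlDr.
  have sT : 0 <= s <= T by rewrite se0 (le_trans st1).
  move=> /(Hd s sT); rewrite ltr_norml => /andP[+ _]; move: le; clear; lra.
have s0t1 : s0 < t1.
  by rewrite lt_neqAle s01 andbT; apply: contraTneq le0 => ->; rewrite -ltNge.
have after s : s0 < s -> s <= t1 -> psi s < phi s.
  move=> s0s st1; rewrite ltNge; apply/negP => h.
  suff : s <= s0 by rewrite leNgt s0s.
  by apply: ub_le_sup; [case: supA|split=> //; rewrite st1 (le_trans s00 (ltW s0s))].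
have [pos|npos] := ltP 0 (phi s0).
  have e20 : 0 < e / 2 by rewrite divr_gt0.
  have s0T' : 0 <= s0 < T by rewrite s00 (lt_le_trans s0t1).
  have [d d0 Hd] := dini s0 s0T' pos _ e20.
  pose s := Num.min (s0 + d / 2) t1.
  have s0s : s0 < s by rewrite lt_min s0t1 ltrDl divr_gt0.
  have ss : s < s0 + d by rewrite gt_min ltrD2l ltr_pdivrMr // ltr_pMr // ltr1n.
  have st1 : s <= t1 by rewrite ge_min lexx orbT.
  have /(Hd s) : s0 < s < s0 + d by rewrite s0s.
  move=> /(_ (le_trans st1 t1T)) hs.
  have := psi_step s s0 s00 (ltW s0s); have := after s s0s st1.
  have : (s - s0) * (K * phi s0 + e / 2) <= (s - s0) * (K * psi s0 + e / 2).
    by apply: ler_wpM2l; [rewrite subr_ge0 ltW|rewrite lerD2r; exact: ler_wpM2l].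
  have : 0 < (s - s0) * (e / 2) by rewrite mulr_gt0 // subr_gt0.
  move: hs le0; clear; lra.
(* Here [phi s0 <= 0 < e <= psi], and continuity alone keeps [phi] below [psi]. *)
have [d d0 Hd] := cphi s0 s0T e e_gt0.
pose s := Num.min (s0 + d / 2) t1.
have s0s : s0 < s by rewrite lt_min s0t1 ltrDl divr_gt0.
have st1 : s <= t1 by rewrite ge_min lexx orbT.
have ss : s < s0 + d by rewrite gt_min ltrD2l ltr_pdivrMr // ltr_pMr // ltr1n.
have := after s s0s st1.
have epsi : e <= psi s.
  by rewrite /psi ler_peMr ?(ltW e_gt0) // expR_ge1 // mulr_ge0 // ?addr_ge0 // (le_trans s00 (ltW s0s)).
have : `|phi s - phi s0| < e.
  apply: Hd; first by rewrite (le_trans s00 (ltW s0s)) (le_trans st1 t1T).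
  by rewrite ger0_norm ?subr_ge0 ?(ltW s0s) // ltrBlDl.
by rewrite ltr_norml => /andP[_]; move: npos epsi; clear; lra.
Qed.

(** If the increments of [E] are quadratically small with respect to those of a
    continuous [r], then [E] is constant: halving the increment of [r]
    by the intermediate value theorem halves the total bound.  This replaces
    the a.e. differentiation of absolutely continuous functions: chain and
    product rules follow by bounding one increment. *)
Lemma quadratic_increment_cst (E r : R -> R) (a b C : R) :
  {within `[a, b], continuous r} ->
  (forall x y, a <= x -> x <= y -> y <= b -> `|E y - E x| <= C * (r y - r x) ^+ 2) ->
  forall x y, a <= x -> x <= y -> y <= b -> E y = E x.
Proof.
move=> cr.
have halve n : forall C,
  (forall x y, a <= x -> x <= y -> y <= b -> `|E y - E x| <= C * (r y - r x) ^+ 2) ->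
  forall x y, a <= x -> x <= y -> y <= b ->
    `|E y - E x| <= C / 2 ^+ n * (r y - r x) ^+ 2.
  elim: n => [|n IH] {}C H; first by move=> x y; rewrite expr0 divr1; exact: H.
  move=> x y ax xy yb; have -> : C / 2 ^+ n.+1 = (C / 2) / 2 ^+ n.
    by rewrite exprS -mulrA -invfM.
  apply: IH => // {ax xy yb}x {}y ax xy yb.
  have crxy : {within `[x, y], continuous r}.
    apply: continuous_subspaceW cr => z /=; rewrite !in_itv /= => /andP[? ?].
    by apply/andP; split; lra.
  have [|z] := @IVT _ r x y ((r x + r y) / 2) xy crxy.
    by rewrite ge_min le_max; have [h|h] := leP (r x) (r y); apply/andP; split;
      apply/orP; [left|right|right|left]; lra.
  rewrite in_itv /= => /andP[xz zy] rz.
  have := H _ _ ax xz (le_trans zy yb); have := H _ _ (le_trans ax xz) zy yb.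
  rewrite rz => h1 h2.
  apply: le_trans (ler_distD (E z) _ _) _; apply: le_trans (lerD h1 h2) _.
  suff -> : C / 2 * (r y - r x) ^+ 2 = C * (r y - (r x + r y) / 2) ^+ 2 +
    C * ((r x + r y) / 2 - r x) ^+ 2 by [].
  by field.
move=> H x y ax xy yb.
suff /eqP : `|E y - E x| == 0 by move/normr0_eq0/subr0_eq.
rewrite eq_le normr_ge0 andbT; apply/ler_addgt0Pl => e e0; rewrite addr0.
have D0 : 0 <= `|C| * (r y - r x) ^+ 2 by rewrite mulr_ge0 // sqr_ge0.
have [n hn] : exists n : nat, `|C| * (r y - r x) ^+ 2 / e < 2 ^+ n.
  exists (Num.truncn (`|C| * (r y - r x) ^+ 2 / e)).+1.
  have h := truncnS_gt (`|C| * (r y - r x) ^+ 2 / e).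
  apply: lt_le_trans h _; rewrite -natrX ler_nat.
  exact/ltnW/ltn_expl.
apply: le_trans (halve n _ H _ _ ax xy yb) _.
rewrite mulrAC ler_pdivrMr ?exprn_gt0 //.
apply: (@le_trans _ _ (`|C| * (r y - r x) ^+ 2)).
  by rewrite ler_wpM2r ?sqr_ge0 // ler_norm.
by rewrite -ler_pdivrMl // mulrC; exact: ltW.
Qed.

End real_line.

(** * Integrals over segments *)

Section segment_integral.
Context {R : realType}.
Local Notation mu := (@lebesgue_measure R).
Implicit Types (f g h : R -> R) (a b c : R).

Definition summable_on a b f := mu.-integrable `[a, b] (EFin \o f).
Local Notation "\I_( a , b ) f" := (\int[mu]_(t in `[a, b]) f t)
  (at level 10, a, b at level 99, f at level 9).

Let meas a b : measurable (`[a, b] : set R).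
Proof. by []. Qed.

Lemma summable_measurable a b f : summable_on a b f -> measurable_fun `[a, b] f.
Proof. by move=> /measurable_int /measurable_EFinP. Qed.

Lemma summable_sub a b c d f : a <= c -> d <= b -> summable_on a b f -> summable_on c d f.
Proof.
move=> ac db; apply: integrableS => //= x /=; rewrite !in_itv /= => /andP[? ?].
by apply/andP; split; lra.
Qed.

Lemma summableD a b f g : summable_on a b f -> summable_on a b g ->
  summable_on a b (fun t => f t + g t).
Proof. by move=> hf hg; apply: (integrableD _ hf hg). Qed.

Lemma summableZ a b c f : summable_on a b f -> summable_on a b (fun t => c * f t).
Proof. by move=> hf; exact: (integrableZl _ c hf). Qed.

Lemma summableN a b f : summable_on a b f -> summable_on a b (fun t => - f t).
Proof. by move=> hf; exact: (integrableN hf). Qed.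

Lemma summableB a b f g : summable_on a b f -> summable_on a b g ->
  summable_on a b (fun t => f t - g t).
Proof. by move=> hf hg; apply: summableD => //; exact: summableN. Qed.

Lemma summable_norm a b f : summable_on a b f -> summable_on a b (fun t => `|f t|).
Proof. by move=> hf; exact: (integrable_norm hf). Qed.

Lemma summable_le a b f g : measurable_fun `[a, b] f ->
  (forall t, a <= t <= b -> `|f t| <= g t) -> summable_on a b g -> summable_on a b f.
Proof.
move=> mf fg; apply: le_integrable => //; first exact/measurable_EFinP.
move=> t; rewrite /= in_itv /= => tab; rewrite lee_fin.
by apply: le_trans (fg _ tab) (ler_norm _).
Qed.

Lemma summable_cst a b c : summable_on a b (fun=> c).
Proof.
apply: measurable_bounded_integrable => //.
  rewrite /= lebesgue_measure_itv /=; case: ifP => // _; exact: ltry.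
by exists `|c|; split; [exact: num_real|move=> x xc t _ /=; exact: ltW].
Qed.

Lemma summable_mul_bounded a b f h C : summable_on a b f ->
  measurable_fun `[a, b] h -> (forall t, a <= t <= b -> `|h t| <= C) ->
  summable_on a b (fun t => f t * h t).
Proof.
move=> hf mh hC; apply: (summable_le _ _ (summableZ C (summable_norm hf))).
  by apply: measurable_funM => //; exact: summable_measurable.
by move=> t tab; rewrite normrM mulrC ler_wpM2r // hC.
Qed.

Lemma continuous_measurable a b f : {within `[a, b], continuous f} ->
  measurable_fun `[a, b] f.
Proof. exact: subspace_continuous_measurable_fun. Qed.

Lemma continuous_summable a b f : {within `[a, b], continuous f} -> summable_on a b f.
Proof.
by move=> cf; apply: continuous_compact_integrable => //; exact: segment_compact.
Qed.

Lemma integral_addition a b c f : a <= b -> b <= c -> summable_on a c f ->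
  \I_(a, c) f = \I_(a, b) f + \I_(b, c) f.
Proof.
move=> ab bc hf; have := @Rintegral_itvB _ f (BLeft a) (BRight c) b hf.
rewrite !bnd_simp => /(_ ab bc) /eqP; rewrite subr_eq => /eqP ->.
rewrite addrC Rintegral_itv_obnd_cbnd //.
by apply: integrableS hf => // x /=; rewrite !in_itv /= => /andP[? ?]; apply/andP; split; lra.
Qed.

Lemma integralD' a b f g : summable_on a b f -> summable_on a b g ->
  \I_(a, b) (fun t => f t + g t) = \I_(a, b) f + \I_(a, b) g.
Proof. by move=> hf hg; exact: RintegralD. Qed.

Lemma integralB' a b f g : summable_on a b f -> summable_on a b g ->
  \I_(a, b) (fun t => f t - g t) = \I_(a, b) f - \I_(a, b) g.
Proof. by move=> hf hg; exact: RintegralB. Qed.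

Lemma integralZ' a b c f : summable_on a b f ->
  \I_(a, b) (fun t => c * f t) = c * \I_(a, b) f.
Proof. by move=> hf; exact: RintegralZl. Qed.

Lemma integralN' a b f : summable_on a b f ->
  \I_(a, b) (fun t => - f t) = - \I_(a, b) f.
Proof.
move=> hf; rewrite -mulN1r -integralZ' //.
by apply: eq_Rintegral => t _; rewrite mulN1r.
Qed.

Lemma eq_integral_on a b f g : (forall t, a <= t <= b -> f t = g t) ->
  \I_(a, b) f = \I_(a, b) g.
Proof. by move=> fg; apply: eq_Rintegral => t; rewrite inE /= in_itv /=; exact: fg. Qed.

Lemma integral_le a b f g : summable_on a b f -> summable_on a b g ->
  (forall t, a <= t <= b -> f t <= g t) -> \I_(a, b) f <= \I_(a, b) g.
Proof.
by move=> hf hg fg; apply: le_Rintegral => // t; rewrite /= in_itv /=; exact: fg.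
Qed.

Lemma integral_ge0' a b f : (forall t, a <= t <= b -> 0 <= f t) -> 0 <= \I_(a, b) f.
Proof.
by move=> h; apply: Rintegral_ge0 => t; rewrite /= in_itv /=; exact: h.
Qed.

Lemma integral_norm_le a b f g : summable_on a b f -> summable_on a b g ->
  (forall t, a <= t <= b -> `|f t| <= g t) -> `|\I_(a, b) f| <= \I_(a, b) g.
Proof.
move=> hf hg fg; apply: (@le_trans _ _ (\I_(a, b) (fun t => `|f t|))).
  exact: le_normr_Rintegral.
by apply: integral_le => //; exact: summable_norm.
Qed.

Lemma integral_cst' a b c : a <= b -> \I_(a, b) (fun=> c) = c * (b - a).
Proof.
move=> ab; rewrite Rintegral_cst //; congr (_ * _).
rewrite /= lebesgue_measure_itv /= lte_fin; case: ifP => //= /negbT.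
by rewrite -leNgt => ba; apply/esym/eqP; rewrite subr_eq0 eq_le ba.
Qed.

Lemma integral_mono a b c d f : a <= c -> c <= d -> d <= b -> summable_on a b f ->
  (forall t, a <= t <= b -> 0 <= f t) -> \I_(c, d) f <= \I_(a, b) f.
Proof.
move=> ac cd db hf f0.
rewrite (integral_addition ac (le_trans cd db)) //.
rewrite (integral_addition cd db); last exact: summable_sub hf.
have : 0 <= \I_(a, c) f by apply: integral_ge0' => t /andP[? ?]; apply: f0; apply/andP; split; lra.
have : 0 <= \I_(d, b) f by apply: integral_ge0' => t /andP[? ?]; apply: f0; apply/andP; split; lra.
lra.
Qed.

Lemma integral_point a f : \I_(a, a) f = 0.
Proof. by rewrite set_itv1 Rintegral_set1. Qed.

Lemma continuous_primitive a b f : a <= b -> summable_on a b f ->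
  {within `[a, b], continuous (fun x => \I_(a, x) f)}.
Proof. by move=> ab hf; exact: parameterized_integral_continuous. Qed.

End segment_integral.
Notation "\I_( a , b ) f" := (\int[@lebesgue_measure _]_(t in `[a, b]) f t)
  (at level 10, a, b at level 99, f at level 9) : ring_scope.

(** * Derivatives in time with quadratic remainder *)

Section time_calculus.
Context {R : realType}.
Implicit Types (f q : R -> R) (s t T C : R).

(** A quantitative form of being C^{1,1} on [0, +oo[, uniform in a parameter:
    it passes to norms and integrals over the parameter without any
    interchange of limits, and it determines and controls the derivative. *)
Definition quad_deriv {U : Type} (f f' : R -> U -> R) : Prop :=
  forall T, 0 <= T -> exists2 C, 0 <= C &
    forall s t u, 0 <= s <= T -> 0 <= t <= T ->
      `|f s u - f t u - (s - t) * f' t u| <= C * (s - t) ^+ 2.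

Definition loc_lipschitz {U : Type} (f : R -> U -> R) : Prop :=
  forall T, 0 <= T -> exists2 C, 0 <= C &
    forall s t u, 0 <= s <= T -> 0 <= t <= T -> `|f s u - f t u| <= C * `|s - t|.

Lemma primitive_increment q T C :
  (forall s t, 0 <= s <= T -> 0 <= t <= T -> `|q s - q t| <= C * `|s - t|) ->
  forall s t, 0 <= s <= T -> 0 <= t <= T ->
   `|\I_(0, s) q - \I_(0, t) q - (s - t) * q t| <= C * (s - t) ^+ 2.
Proof.
move=> lip.
have hq : summable_on 0 T q.
  exact/continuous_summable/(lipschitz_within_continuous lip).
have main a b x : 0 <= a -> a <= b -> b <= T -> a <= x <= b ->
    `|\I_(0, b) q - \I_(0, a) q - (b - a) * q x| <= C * (b - a) ^+ 2.
  move=> a0 ab bT /andP[ax xb].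
  have hab : summable_on a b q by exact: summable_sub hq.
  rewrite (integral_addition a0 ab); last by apply: summable_sub hq; lra.
  have -> : \I_(0, a) q + \I_(a, b) q - \I_(0, a) q - (b - a) * q x =
      \I_(a, b) q - q x * (b - a) by ring.
  rewrite -integral_cst' // -integralB' //; last exact: summable_cst.
  have -> : C * (b - a) ^+ 2 = C * (b - a) * (b - a) by ring.
  have C0 y : a <= y <= b -> `|q y - q x| <= C * (b - a).
    move=> /andP[ay yb]; have [ba|ba] := eqVneq a b.
      have -> : y = x by apply/eqP; rewrite eq_le; apply/andP; split; lra.
      by rewrite !subrr normr0 ba subrr mulr0.
    have {}ba : 0 < b - a by rewrite subr_gt0 lt_neqAle ba.
    apply: le_trans (lip _ _ _ _) _; try (apply/andP; split; lra).
    have : 0 <= C.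
      rewrite -(pmulr_lge0 _ ba) -[X in C * X](gtr0_norm ba).
      by apply: le_trans (lip b a _ _); rewrite ?normr_ge0 //; apply/andP; split; lra.
    move=> C0; apply: ler_wpM2l => //; rewrite ler_norml; apply/andP; split; lra.
  rewrite -(integral_cst' (C * (b - a)) ab).
  apply: integral_norm_le => //; [|exact: summable_cst].
  by apply: summableB => //; exact: summable_cst.
move=> s t /andP[s0 sT] /andP[t0 tT]; have [st|/ltW ts] := leP s t.
  rewrite -normrN !opprB -sqrrN opprB.
  have -> : (s - t) * q t + (\I_(0, t) q - \I_(0, s) q) =
     \I_(0, t) q - \I_(0, s) q - (t - s) * q t by ring.
  by apply: main => //; rewrite st lexx.
by apply: main => //; rewrite ts lexx.
Qed.

Lemma quad_deriv_primitive {U : Type} (q : R -> U -> R) : loc_lipschitz q ->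
  quad_deriv (fun t u => \I_(0, t) (q^~ u)) q.
Proof.
move=> lip T /lip[C C0 HC]; exists C => // s t u; apply: primitive_increment.
by move=> {}s {}t; exact: HC.
Qed.

(** Adding the estimate at [t] seen from [s] to that at [s] seen from [t]
    eliminates [f]. *)
Lemma quad_deriv_lipschitz_deriv {U : Type} (f f' : R -> U -> R) :
  quad_deriv f f' -> loc_lipschitz f'.
Proof.
move=> qf T /qf[C C0 HC]; exists (2 * C); first by rewrite mulr_ge0.
move=> s t u sT tT; have [->|st] := eqVneq s t; first by rewrite !subrr normr0 mulr0.
have st0 : 0 < `|s - t| by rewrite normr_gt0 subr_eq0.
rewrite -(ler_pM2r st0) -normrM.
have -> : 2 * C * `|s - t| * `|s - t| = C * (s - t) ^+ 2 + C * (t - s) ^+ 2.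
  by rewrite -mulrA -expr2 -normrX ger0_norm ?sqr_ge0 //; ring.
apply: le_trans (lerD (HC s t u sT tT) (HC t s u tT sT)).
apply: le_trans (ler_normD _ _).
suff -> : (f' s u - f' t u) * (s - t) =
  f s u - f t u - (s - t) * f' t u + (f t u - f s u - (t - s) * f' s u) by [].
ring.
Qed.

Lemma quad_deriv_loc_lipschitz {U : Type} (f f' : R -> U -> R) (B : R) :
  quad_deriv f f' -> (forall u, `|f' 0 u| <= B) -> loc_lipschitz f.
Proof.
move=> qf bf T T0; have [C C0 HC] := qf T T0.
have [D D0 HD] := quad_deriv_lipschitz_deriv qf T0.
have B0 : 0 <= `|B| by [].
exists (`|B| + D * T + C * T) => [|s t u sT tT]; first by rewrite !addr_ge0 // mulr_ge0.
have f't : `|f' t u| <= `|B| + D * T.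
  rewrite -[f' t u](subrK (f' 0 u)) addrC; apply: le_trans (ler_normD _ _) _.
  apply: lerD; first exact: le_trans (bf u) (ler_norm _).
  apply: le_trans (HD t 0 u tT _) _; first by rewrite lexx.
  by case/andP : tT => t0 tT; rewrite subr0 ger0_norm // ler_wpM2l.
have -> : f s u - f t u = (f s u - f t u - (s - t) * f' t u) + (s - t) * f' t u by ring.
apply: le_trans (ler_normD _ _) _; rewrite normrM.
have stT : `|s - t| <= T.
  by case/andP: sT => ? ?; case/andP: tT => ? ?; rewrite ler_norml; apply/andP; split; lra.
have : `|f s u - f t u - (s - t) * f' t u| <= C * T * `|s - t|.
  apply: le_trans (HC _ _ _ sT tT) _; rewrite -mulrA; apply: ler_wpM2l => //.
  have -> : (s - t) ^+ 2 = `|s - t| * `|s - t| by rewrite -expr2 -normrX ger0_norm ?sqr_ge0.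
  exact: ler_wpM2r.
have : `|s - t| * `|f' t u| <= `|s - t| * (`|B| + D * T) by exact: ler_wpM2l.
lra.
Qed.

(** The Gronwall inequality with [K = 0]: the quadratic remainder is absorbed in
    the arbitrarily small slope [e]. *)
Lemma quad_deriv_nonincreasing f f' :
  quad_deriv (fun t (_ : unit) => f t) (fun t _ => f' t) ->
  (forall t, 0 <= t -> f' t <= 0) ->
  forall s t, 0 <= s -> s <= t -> f t <= f s.
Proof.
move=> qf f'0 s t s0 st.
have [C C0 HC] := qf t (le_trans s0 st).
have [L L0 HL] := quad_deriv_loc_lipschitz (B := `|f' 0|) qf (fun=> lexx _) (le_trans s0 st).
suff : f (s + (t - s)) - f s <= 0.
  by rewrite subr_le0 (_ : s + (t - s) = t) //; ring.
apply: (@dini_gronwall _ (fun x => f (s + x) - f s) 0 (t - s)) => //; last first.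
- by rewrite lexx subr_ge0 st.
- move=> x /andP[x0 xt] _ e e0; exists (e / (C + 1)).
    by rewrite divr_gt0 // ltr_wpDl.
  move=> y /andP[xy yx] yt; rewrite mul0r add0r.
  have /(_ _ _) := HC (s + y) (s + x) tt.
  have -> : s + y - (s + x) = y - x by ring.
  move=> /(_ _ _)/ler_normlP; case; try (apply/andP; split; lra).
  move=> _ h; have := f'0 (s + x) (addr_ge0 s0 x0).
  rewrite -(ler_pM2l (_ : 0 < y - x)) ?subr_gt0 // mulr0 => h2.
  have : C * (y - x) ^+ 2 <= (y - x) * e.
    rewrite expr2 mulrCA; apply: ler_wpM2l; first lra.
    have : y - x < e / (C + 1) by lra.
    rewrite ltr_pdivlMr ?ltr_wpDl // => h3.
    have : 0 < y - x by lra.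
    lra.
  lra.
- by rewrite addr0 subrr.
- apply: (@lipschitz_within_continuous _ _ _ _ L) => x y /andP[x0 xt] /andP[y0 yt].
  have -> : f (s + x) - f s - (f (s + y) - f s) = f (s + x) - f (s + y) by ring.
  have -> : x - y = (s + x) - (s + y) by ring.
  by apply: (HL _ _ tt); apply/andP; split; lra.
Qed.

Lemma quad_derivB {U : Type} (f f' g g' : R -> U -> R) :
  quad_deriv f f' -> quad_deriv g g' ->
  quad_deriv (fun t u => f t u - g t u) (fun t u => f' t u - g' t u).
Proof.
move=> qf qg T T0; have [C C0 HC] := qf T T0; have [D D0 HD] := qg T T0.
exists (C + D) => [|s t u sT tT]; first exact: addr_ge0.
rewrite [leRHS]mulrDl; apply: le_trans (lerD (HC _ _ u sT tT) (HD _ _ u sT tT)).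
apply: le_trans (ler_normB _ _).
by rewrite le_eqVlt; apply/orP; left; apply/eqP; congr `|_|; ring.
Qed.

Lemma quad_deriv_le f f' g g' :
  quad_deriv (fun t (_ : unit) => f t) (fun t _ => f' t) ->
  quad_deriv (fun t (_ : unit) => g t) (fun t _ => g' t) ->
  (forall t, 0 <= t -> f' t <= g' t) ->
  forall s t, 0 <= s -> s <= t -> f t - f s <= g t - g s.
Proof.
move=> qf qg fg s t s0 st.
have := @quad_deriv_nonincreasing _ _ (quad_derivB qf qg).
move=> /(_ _ s t s0 st) h; have : f t - g t <= f s - g s; last by lra.
by apply: h => x /fg; rewrite subr_le0.
Qed.

Lemma derive_lipschitz (f f1 : R -> R) (a b C : R) :
  (forall x : R, is_derive x 1 f (f1 x)) ->
  (forall x, a <= x <= b -> `|f1 x| <= C) ->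
  forall x y, a <= x <= b -> a <= y <= b -> `|f x - f y| <= C * `|x - y|.
Proof.
move=> df bf.
have main x y : a <= x -> x <= y -> y <= b -> `|f y - f x| <= C * `|y - x|.
  move=> ax xy yb; have [|c] := @MVT_segment _ f f1 x y xy.
    apply: continuous_subspaceT => z; apply: differentiable_continuous.
    by apply/derivable1_diffP; case: (df z).
  rewrite in_itv /= => /andP[xc cy] ->; rewrite normrM ler_wpM2r //.
  by apply: bf; apply/andP; split; lra.
move=> x y /andP[ax xb] /andP[ay yb]; have [xy|/ltW yx] := leP x y; last exact: main.
by rewrite distrC (distrC x); exact: main.
Qed.

Lemma taylor_quadratic (f f1 f2 : R -> R) (a b C : R) :
  (forall x : R, is_derive x 1 f (f1 x)) -> (forall x : R, is_derive x 1 f1 (f2 x)) ->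
  (forall x, a <= x <= b -> `|f2 x| <= C) ->
  forall x y, a <= x <= b -> a <= y <= b -> `|f x - f y - (x - y) * f1 y| <= C * (x - y) ^+ 2.
Proof.
move=> df df1 bf x y xab yab.
pose h z := f z - z * f1 y.
have dh (z : R) : is_derive z 1 h (f1 z - f1 y).
  have := df z => ?; rewrite /h.
  have -> : (fun z => f z - z * f1 y) = f - (fun z => z * f1 y) by [].
  apply: is_deriveB.
  have -> : (fun z : R => z * f1 y) = (f1 y *: id).
    by apply/funext => v; rewrite /= mulrC.
  rewrite -[X in is_derive _ _ _ X]mulr1.
  exact: is_deriveZ.
have -> : f x - f y - (x - y) * f1 y = h x - h y by rewrite /h; ring.
have C0 : 0 <= C by apply: le_trans (bf _ xab).
pose lo := Num.min x y; pose hi := Num.max x y.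
have bh z : lo <= z <= hi -> `|f1 z - f1 y| <= C * `|x - y|.
  move=> /andP[zl zh]; apply: le_trans (derive_lipschitz df1 bf _ yab) _.
    case/andP: xab => ? ?; case/andP: yab => ? ?; apply/andP; split.
      by apply: le_trans zl; rewrite le_min; apply/andP; split.
    by apply: (le_trans zh); rewrite ge_max; apply/andP; split.
  apply: ler_wpM2l => //; move: zl zh; rewrite /lo /hi ge_min le_max.
  have [xy|/ltW xy] := leP x y => /orP zl /orP zh.
    have zy : z - y <= 0 by case: zh; lra.
    have xz : x <= z by case: zl; lra.
    by rewrite !ler0_norm; lra.
  have zy : 0 <= z - y by case: zl; lra.
  have xz : z <= x by case: zh; lra.
  by rewrite !ger0_norm; lra.
have := derive_lipschitz dh bh (x := x) (y := y).
have -> : C * `|x - y| * `|x - y| = C * (x - y) ^+ 2.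
  by rewrite -mulrA -expr2 -normrX ger0_norm ?sqr_ge0.
by apply; rewrite /lo /hi !ge_min !le_max !lexx ?orbT.
Qed.

Lemma is_derive_expR_scaled (c x : R) :
  is_derive x 1 (fun x => expR (c * x)) (c * expR (c * x)).
Proof.
rewrite mulrC; apply: (is_derive1_comp (f := expR) (g := fun x => c * x)).
have := is_deriveZ c (is_derive_id x 1); rewrite /GRing.scale /= mulr1; exact.
Qed.

Lemma quad_deriv_expR c :
  quad_deriv (fun t (_ : unit) => expR (c * t)) (fun t _ => c * expR (c * t)).
Proof.
move=> T T0; exists (c ^+ 2 * expR (`|c| * T)); first by rewrite mulr_ge0 ?sqr_ge0 ?expR_ge0.
move=> s t _; apply: (@taylor_quadratic (fun x => expR (c * x)) (fun x => c * expR (c * x))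
  (fun x => c ^+ 2 * expR (c * x))).
- by move=> x; exact: is_derive_expR_scaled.
- move=> x; have := is_derive_expR_scaled c x => ?.
  rewrite expr2 -mulrA; exact: (is_deriveZ c).
- move=> x /andP[x0 xT]; rewrite normrM (ger0_norm (sqr_ge0 _)) ger0_norm ?expR_ge0 //.
  apply: ler_wpM2l; rewrite ?sqr_ge0 // ler_expR.
  apply: le_trans (ler_norm _) _; rewrite normrM (ger0_norm x0).
  exact: ler_wpM2l.
Qed.
End time_calculus.

(** * The Green function of the circle *)

Section green_kernel.
Context {R : realType} (lambda : R) (lambda0 : 0 < lambda).
Implicit Types x y : R.
Let s0 := sinh (1 / (2 * lambda)).

(** The restriction to [[-1, 1]] of the positive periodic Green function of
    [1 - lambda^2 d^2/dx^2], and the odd function vanishing at 0 whose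
    derivative on [[-1, 1]] is its opposite. *)
Definition green x : R := cosh ((`|x| - 2^-1) / lambda) / (2 * lambda * s0).
Definition half_green_primitive x : R := - ((sinh ((x - 2^-1) / lambda) + s0) / (2 * s0)).
Definition green_primitive x : R :=
  if 0 <= x then half_green_primitive x else - half_green_primitive (- x).

Let bound := expR (1 / (2 * lambda)).
Let g1 x := cosh ((x - 2^-1) / lambda) / (2 * lambda * s0).
Let g2 x := sinh ((x - 2^-1) / lambda) / (2 * lambda ^+ 2 * s0).

Lemma sinh_le x y : x <= y -> sinh x <= sinh y.
Proof.
move=> xy; rewrite /sinh ler_pM2r ?invr_gt0 // lerB // ler_expR //.
by rewrite lerN2.
Qed.

Lemma sinhN x : sinh (- x) = - sinh x.
Proof. by rewrite /sinh opprK; field. Qed.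

Lemma s0_gt0 : 0 < s0.
Proof.
rewrite /s0 /sinh divr_gt0 // subr_gt0 ltr_expR.
have : 0 < 1 / (2 * lambda) by rewrite divr_gt0 // mulr_gt0.
lra.
Qed.

Let lambda_neq0 : lambda != 0. Proof. by rewrite gt_eqF. Qed.
Let D1 : 0 < 2 * lambda * s0. Proof. exact: (mulr_gt0 (mulr_gt0 (ltr0Sn _ 1) lambda0) s0_gt0). Qed.
Let D2 : 0 < 2 * lambda ^+ 2 * s0.
Proof.
exact: (mulr_gt0 (mulr_gt0 (ltr0Sn _ 1) (exprn_gt0 2 lambda0)) s0_gt0).
Qed.
Let s0_neq0 : s0 != 0. Proof. by rewrite gt_eqF // s0_gt0. Qed.

Lemma cosh_ge0 x : 0 <= cosh x.
Proof. by rewrite /cosh divr_ge0 // addr_ge0 // expR_ge0. Qed.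

Lemma cosh_sinh_shift_bound x : 0 <= x <= 1 ->
  `|cosh ((x - 2^-1) / lambda)| <= bound /\ `|sinh ((x - 2^-1) / lambda)| <= bound.
Proof.
move=> /andP[x0 x1]; set y := _ / lambda.
have yb : - (1 / (2 * lambda)) <= y <= 1 / (2 * lambda).
  have -> : 1 / (2 * lambda) = 2^-1 / lambda by field.
  rewrite /y -mulNr !ler_pM2r ?invr_gt0 //; apply/andP; split; lra.
case/andP: yb => y1 y2.
have e1 : expR y <= bound by rewrite ler_expR.
have e2 : expR (- y) <= bound by rewrite ler_expR; lra.
have := expR_ge0 y; have := expR_ge0 (- y) => p1 p2.
by rewrite /cosh /sinh !ler_norml; split; apply/andP; split; lra.
Qed.

Lemma is_derive_affine_exp (c x : R) :
  is_derive x 1 (fun x => expR (c * ((x - 2^-1) / lambda)))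
    (c / lambda * expR (c * ((x - 2^-1) / lambda))).
Proof.
have := is_derive_expR_scaled (c / lambda) (x) => /(is_deriveZ (expR (- c / (2 * lambda)))).
set f := (f in is_derive _ _ f _) ; set d := (d in is_derive _ _ _ d).
have -> : f = (fun x => expR (c * ((x - 2^-1) / lambda))).
  by apply/funext => y; rewrite /f /= /GRing.scale /= -expRD; congr expR; field.
have -> // : d = (c / lambda * expR (c * ((x - 2^-1) / lambda))).
rewrite /d /GRing.scale /= mulrCA -expRD; congr (_ * expR _); field.
by [].
Qed.

Lemma is_derive_cosh_shift x : is_derive x 1 (fun x => cosh ((x - 2^-1) / lambda))
  (sinh ((x - 2^-1) / lambda) / lambda).
Proof.
have h1 := is_derive_affine_exp 1 x; have h2 := is_derive_affine_exp (-1) x.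
have := is_deriveZ (2^-1) (is_deriveD h1 h2).
set f := (f in is_derive _ _ f _) ; set d := (d in is_derive _ _ _ d).
have -> : f = (fun x => cosh ((x - 2^-1) / lambda)).
  by apply/funext => y; rewrite /f /= /GRing.scale /= !fctE /cosh !mul1r !mulN1r; field.
have -> // : d = (sinh ((x - 2^-1) / lambda) / lambda).
by rewrite /d /GRing.scale /= /sinh !mul1r !mulN1r; field.
Qed.

Lemma is_derive_sinh_shift x : is_derive x 1 (fun x => sinh ((x - 2^-1) / lambda))
  (cosh ((x - 2^-1) / lambda) / lambda).
Proof.
have h1 := is_derive_affine_exp 1 x; have h2 := is_derive_affine_exp (-1) x.
have := is_deriveZ (2^-1) (is_deriveB h1 h2).
set f := (f in is_derive _ _ f _) ; set d := (d in is_derive _ _ _ d).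
have -> : f = (fun x => sinh ((x - 2^-1) / lambda)).
  by apply/funext => y; rewrite /f /= /GRing.scale /= !fctE /sinh !mul1r !mulN1r; field.
have -> // : d = (cosh ((x - 2^-1) / lambda) / lambda).
by rewrite /d /GRing.scale /= /cosh !mul1r !mulN1r; field.
Qed.

Let dg1 x : is_derive x 1 g1 (g2 x).
Proof.
have := is_deriveZ ((2 * lambda * s0)^-1) (is_derive_cosh_shift x).
set f := (f in is_derive _ _ f _) ; set d := (d in is_derive _ _ _ d).
have -> : f = g1 by apply/funext => y; rewrite /f /= /GRing.scale /= mulrC.
have -> // : d = g2 x.
by rewrite /d /GRing.scale /= /g2; field; apply/andP; split.
Qed.

Let dg2 x : is_derive x 1 g2 (g1 x / lambda ^+ 2).
Proof.
have := is_deriveZ ((2 * lambda ^+ 2 * s0)^-1) (is_derive_sinh_shift x).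
set f := (f in is_derive _ _ f _) ; set d := (d in is_derive _ _ _ d).
have -> : f = g2 by apply/funext => y; rewrite /f /= /GRing.scale /= mulrC.
have -> // : d = g1 x / lambda ^+ 2.
by rewrite /d /GRing.scale /= /g1; field; apply/andP; split.
Qed.

Let dgg x : is_derive x 1 half_green_primitive (- g1 x).
Proof.
have := is_deriveZ (- (2 * s0)^-1) (is_deriveD (is_derive_sinh_shift x) (is_derive_cst s0 x 1)).
set f := (f in is_derive _ _ f _) ; set d := (d in is_derive _ _ _ d).
have -> : f = half_green_primitive.
  by apply/funext => y; rewrite /f /= /GRing.scale /= !fctE /half_green_primitive mulrC mulrN.
have -> // : d = - g1 x.
by rewrite /d /GRing.scale /= /g1 addr0; field; apply/andP; split.
Qed.

Let dNg1 x : is_derive x 1 (- g1) (- g2 x).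
Proof. by have := dg1 x => ?; exact: is_deriveN. Qed.

Let B : R := bound / (2 * lambda * s0) + bound / (2 * lambda ^+ 2 * s0)
   + bound / (2 * lambda * s0) / lambda ^+ 2.

Let bound_ge0 : 0 <= bound. Proof. exact: expR_ge0. Qed.
Let pos1 : 0 <= bound / (2 * lambda * s0).
Proof. by apply: divr_ge0; [|exact: ltW]. Qed.
Let pos2 : 0 <= bound / (2 * lambda ^+ 2 * s0).
Proof. by apply: divr_ge0; [|exact: ltW]. Qed.
Let pos3 : 0 <= bound / (2 * lambda * s0) / lambda ^+ 2.
Proof. by apply: divr_ge0; [|exact: sqr_ge0]. Qed.
Let B_ge0 : 0 <= B. Proof. by rewrite !addr_ge0. Qed.
Let B_ge1 : bound / (2 * lambda * s0) <= B.
Proof. by rewrite /B -addrA lerDl addr_ge0. Qed.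
Let B_ge2 : bound / (2 * lambda ^+ 2 * s0) <= B.
Proof. by rewrite /B addrAC lerDr addr_ge0. Qed.
Let B_ge3 : bound / (2 * lambda * s0) / lambda ^+ 2 <= B.
Proof. by rewrite /B lerDr addr_ge0. Qed.

Let g1_ge0 x : 0 <= g1 x.
Proof. by apply: divr_ge0; [exact: cosh_ge0|exact: ltW]. Qed.

Let g1_bound x : 0 <= x <= 1 -> `|g1 x| <= bound / (2 * lambda * s0).
Proof.
move=> /cosh_sinh_shift_bound[h _]; rewrite normrM normfV (gtr0_norm D1).
by rewrite ler_pM2r ?invr_gt0.
Qed.

Let g2_bound x : 0 <= x <= 1 -> `|g2 x| <= bound / (2 * lambda ^+ 2 * s0).
Proof.
move=> /cosh_sinh_shift_bound[_ h]; rewrite normrM normfV (gtr0_norm D2).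
by rewrite ler_pM2r ?invr_gt0.
Qed.

Lemma green_ge0 x : 0 <= green x.
Proof. exact: g1_ge0. Qed.

Lemma greenN x : green (- x) = green x.
Proof. by rewrite /green normrN. Qed.

Let greenE x : 0 <= x -> green x = g1 x.
Proof. by move=> x0; rewrite /green ger0_norm. Qed.

Lemma green_shift x : 0 <= x <= 1 -> green (x - 1) = green x.
Proof.
move=> /andP[x0 x1]; rewrite -greenN !greenE //; last by lra.
rewrite /g1; congr (_ / _).
have -> : (- (x - 1) - 2^-1) / lambda = - ((x - 2^-1) / lambda) by field.
by rewrite /cosh opprK addrC.
Qed.

(** On negative arguments the shift by a period agrees with the reflection,
    because [cosh] is even. *)
Lemma G_green x : -1 <= x <= 1 -> G lambda x = - green x.
Proof.
move=> /andP[x0 x1]; rewrite /G; congr (- _).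
have fr y (n : int) : n%:~R <= y < (n + 1)%:~R -> frac_part y = y - n%:~R.
  by move=> yn; rewrite /frac_part; congr (_ - _%:~R); exact: floor_def.
have [x_lt1|] := ltP x 1; last first.
  move=> x1'; have -> : x = 1 by apply/eqP; rewrite eq_le x1.
  rewrite (fr 1 1); last by rewrite intrD; apply/andP; split; lra.
  rewrite -[RHS](@green_shift 1) ?ler01 ?lexx //.
have [x_ge0|x_lt0] := leP 0 x.
  by rewrite (fr x 0) ?x_ge0 //= subr0.
rewrite (fr x (-1)); last by rewrite x0 /= addNr.
have -> : x - (-1)%:~R = x + 1 by rewrite rmorphN opprK.
rewrite -[RHS]/(green x) -[X in _ = green X](addrK 1) green_shift //.
by apply/andP; split; lra.
Qed.

Lemma green_primitive0 : green_primitive 0 = 0.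
Proof.
rewrite /green_primitive lexx /half_green_primitive.
have -> : (0 - 2^-1) / lambda = - (1 / (2 * lambda)) by field.
by rewrite sinhN addNr mul0r oppr0.
Qed.

Let half_shift x : half_green_primitive (1 - x) = - 1 - half_green_primitive x.
Proof.
rewrite /half_green_primitive.
have -> : (1 - x - 2^-1) / lambda = - ((x - 2^-1) / lambda) by field.
by rewrite sinhN; field.
Qed.

Lemma green_primitiveN x : green_primitive (- x) = - green_primitive x.
Proof.
rewrite /green_primitive oppr_ge0; case: ltgtP => // [x0|x0|->].
- by rewrite opprK.
- by rewrite (opprK x).
- by have := green_primitive0; rewrite /green_primitive lexx oppr0 => ->; rewrite oppr0.
Qed.

Lemma green_primitive_shift x : 0 <= x <= 1 -> green_primitive (x - 1) = green_primitive x + 1.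
Proof.
move=> /andP[x0 x1]; have -> : x - 1 = - (1 - x) by ring.
rewrite green_primitiveN /green_primitive subr_ge0 x1 x0 half_shift; ring.
Qed.

Lemma green_primitive_norm x : -1 <= x <= 1 -> `|green_primitive x| <= 1.
Proof.
have H y : 0 <= y <= 1 -> -1 <= half_green_primitive y <= 0.
  move=> /andP[y0 y1].
  have h1 : sinh ((y - 2^-1) / lambda) <= s0.
    rewrite /s0 sinh_le //; have -> : 1 / (2 * lambda) = 2^-1 / lambda by field.
    by rewrite ler_pM2r ?invr_gt0 //; lra.
  have h2 : - s0 <= sinh ((y - 2^-1) / lambda).
    rewrite /s0 -sinhN sinh_le //; have -> : - (1 / (2 * lambda)) = - 2^-1 / lambda by field.
    by rewrite ler_pM2r ?invr_gt0 //; lra.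
  have d0 : 0 < 2 * s0 by exact: (mulr_gt0 (ltr0Sn _ 1) s0_gt0).
  have q0 : 0 <= (sinh ((y - 2^-1) / lambda) + s0) / (2 * s0).
    by apply: divr_ge0; [lra|exact: ltW].
  have q1 : (sinh ((y - 2^-1) / lambda) + s0) / (2 * s0) <= 1.
    by rewrite ler_pdivrMr //; lra.
  by rewrite /half_green_primitive; apply/andP; split; lra.
move=> /andP[x0 x1]; rewrite /green_primitive; have [xge0|xlt0] := leP 0 x.
  by have /andP[? ?] := H x (introT andP (conj xge0 x1)); rewrite ler_norml; apply/andP; split; lra.
have /andP[? ?] : -1 <= half_green_primitive (- x) <= 0 by apply: H; apply/andP; split; lra.
by rewrite ler_norml; apply/andP; split; lra.
Qed.

(** The quantitative facts about the kernel that are used below; [B] is a common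
    constant.  The last two express that [green] solves
    [g'' = g / lambda^2] on each side of 0, with a jump [- 1 / lambda^2] of its
    derivative there. *)
Lemma green_bounds : exists B : R, [/\ 0 <= B,
  (forall x, -1 <= x <= 1 -> green x <= B),
  (forall x y, -1 <= x <= 1 -> -1 <= y <= 1 -> `|green y - green x| <= B * `|y - x|) &
  [/\ forall x y, -1 <= x <= 1 -> -1 <= y <= 1 ->
    `|green_primitive y - green_primitive x + (y - x) * green x| <= B * (y - x) ^+ 2,
   forall x y, 0 <= x <= 1 -> 0 <= y <= 1 ->
    `|green y - green x + (y - x) * ((green_primitive x + 2^-1) / lambda ^+ 2)|
      <= B * (y - x) ^+ 2 &
   forall x y, -1 <= x <= 0 -> -1 <= y <= 0 ->
    `|green y - green x + (y - x) * ((green_primitive x - 2^-1) / lambda ^+ 2)|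
      <= B * (y - x) ^+ 2]].
Proof.
have lip1 x y : 0 <= x <= 1 -> 0 <= y <= 1 -> `|g1 y - g1 x| <= B * `|y - x|.
  move=> x01 y01; apply: (derive_lipschitz dg1 _ y01 x01) => z /g2_bound h.
  exact: le_trans h B_ge2.
have lip x y : -1 <= x <= 1 -> -1 <= y <= 1 -> `|green y - green x| <= B * `|y - x|.
  move=> /andP[? ?] /andP[? ?].
  have greenA z : green z = g1 `|z| by rewrite -greenE // /green normr_id.
  rewrite !greenA; apply: le_trans (lip1 _ _ _ _) _; rewrite ?normr_ge0 ?ler_norml //=.
  - by apply/andP; split.
  - by apply/andP; split.
  - by apply: ler_wpM2l => //; exact: ler_dist_dist.
have tay1 x y : 0 <= x <= 1 -> 0 <= y <= 1 ->
    `|half_green_primitive y - half_green_primitive x + (y - x) * g1 x| <= B * (y - x) ^+ 2.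
  move=> x01 y01; have := taylor_quadratic dgg dNg1 _ y01 x01 (C := B).
  have -> : half_green_primitive y - half_green_primitive x - (y - x) * - g1 x =
    half_green_primitive y - half_green_primitive x + (y - x) * g1 x by ring.
  apply => z /g2_bound; rewrite normrN => h.
  exact: le_trans h B_ge2.
have tay2 x y : 0 <= x <= 1 -> 0 <= y <= 1 ->
    `|g1 y - g1 x - (y - x) * g2 x| <= B * (y - x) ^+ 2.
  move=> x01 y01; apply: (taylor_quadratic dg1 dg2 _ y01 x01) => z /g1_bound h.
  rewrite normrM [X in _ * X]ger0_norm ?invr_ge0 ?sqr_ge0 //.
  apply: le_trans B_ge3.
  by rewrite ler_pM2r // invr_gt0 exprn_gt0.
have g2E x : g2 x = - ((half_green_primitive x + 2^-1) / lambda ^+ 2).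
  by rewrite /g2 /half_green_primitive; field; apply/andP; split.
have gp x : 0 <= x -> green_primitive x = half_green_primitive x.
  by rewrite /green_primitive => ->.
have tay3 x y : -1 <= x <= 1 -> -1 <= y <= 1 ->
    `|green_primitive y - green_primitive x + (y - x) * green x| <= B * (y - x) ^+ 2.
  have pos x' y' : 0 <= x' <= 1 -> 0 <= y' <= 1 ->
      `|green_primitive y' - green_primitive x' + (y' - x') * green x'| <= B * (y' - x') ^+ 2.
    move=> /[dup] /andP[? ?] ? /[dup] /andP[? ?] ?; rewrite !gp // greenE //; exact: tay1.
  have neg x' y' : -1 <= x' <= 0 -> -1 <= y' <= 0 ->
      `|green_primitive y' - green_primitive x' + (y' - x') * green x'| <= B * (y' - x') ^+ 2.
    move=> /andP[? ?] /andP[? ?].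
    have := pos (- x') (- y'); rewrite !green_primitiveN greenN.
    have -> : - green_primitive y' - - green_primitive x' + (- y' - - x') * green x' =
      - (green_primitive y' - green_primitive x' + (y' - x') * green x') by ring.
    rewrite normrN; have -> : (- y' - - x') ^+ 2 = (y' - x') ^+ 2 by ring.
    by apply; apply/andP; split; rewrite ?oppr_ge0 // lerNl.
  have mix x' y' (a b : R) : `|green_primitive y' - green_primitive 0 + (y' - 0) * green 0| <= B * (y' - 0) ^+ 2 ->
      `|green_primitive 0 - green_primitive x' + (0 - x') * green x'| <= B * (0 - x') ^+ 2 ->
      `|green 0 - green x'| <= B * `|x'| -> `|x'| = a -> `|y'| = b -> `|y' - x'| = a + b ->
      `|green_primitive y' - green_primitive x' + (y' - x') * green x'| <= B * (y' - x') ^+ 2.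
    move=> h1 h2 h3 ea eb eab.
    have -> : green_primitive y' - green_primitive x' + (y' - x') * green x' =
      (green_primitive y' - green_primitive 0 + (y' - 0) * green 0) +
      (green_primitive 0 - green_primitive x' + (0 - x') * green x') -
      y' * (green 0 - green x') by ring.
    have sq (z : R) : z ^+ 2 = `|z| ^+ 2 by rewrite real_normK ?num_real.
    rewrite (sq (y' - x')) eab.
    rewrite (sq (0 - x')) [X in B * `|X| ^+ 2]sub0r normrN ea in h2.
    rewrite (sq (y' - 0)) [X in B * `|X| ^+ 2]subr0 eb in h1.
    apply: le_trans (ler_normB _ _) _.
    apply: le_trans (lerD (ler_normD _ _) (lexx _)) _.
    rewrite normrM eb; rewrite ea in h3.
    have b0 : 0 <= b by rewrite -eb.
    have a0 : 0 <= a by rewrite -ea.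
    have h4 : b * `|green 0 - green x'| <= b * (B * a) by exact: ler_wpM2l.
    have : 0 <= B * (a * b) by rewrite !mulr_ge0.
    have -> : B * (a + b) ^+ 2 = B * b ^+ 2 + B * a ^+ 2 + b * (B * a) + B * (a * b) by ring.
    lra.
  move=> /[dup] x11 /andP[x_0 x_1] /[dup] y11 /andP[y_0 y_1].
  have z11 : -1 <= (0 : R) <= 1 by rewrite lerN10 ler01.
  have [x0|x0] := leP 0 x; have [y0|y0] := leP 0 y.
  - by apply: pos; apply/andP; split.
  - apply: (mix _ _ `|x| `|y|) => //.
    + by apply: neg; rewrite ?y_0 ?(ltW y0) ?lexx ?lerN10.
    + by apply: pos; rewrite ?x0 ?x_1 ?lexx ?ler01.
    + by apply: le_trans (lip _ _ x11 z11) _; rewrite sub0r normrN.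
    + by rewrite (ltr0_norm y0) (ger0_norm x0) ltr0_norm ?opprB // subr_lt0 (lt_le_trans y0 x0).
  - apply: (mix _ _ `|x| `|y|) => //.
    + by apply: pos; rewrite ?y0 ?y_1 ?lexx ?ler01.
    + by apply: neg; rewrite ?x_0 ?(ltW x0) ?lexx ?lerN10.
    + by apply: le_trans (lip _ _ x11 z11) _; rewrite sub0r normrN.
    + by rewrite (ltr0_norm x0) (ger0_norm y0) ger0_norm 1?addrC // addrC subr_ge0 ltW // (lt_le_trans x0 y0).
  - by apply: neg; apply/andP; split=> //; exact: ltW.
exists B; split => //; last split => //.
- move=> x /andP[? ?]; rewrite /green; have := @g1_bound `|x|.
  rewrite /g1 => h; apply: le_trans (ler_norm _) _; apply: le_trans (h _) _.
    by rewrite normr_ge0 /= ler_norml; apply/andP; split.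
  exact: B_ge1.
- move=> x y /[dup] ? /andP[? ?] /[dup] ? /andP[? ?].
  rewrite !greenE // gp //; have := tay2 x y; rewrite g2E mulrN opprK; exact.
- move=> x y /andP[? ?] /andP[? ?].
  have := tay2 (- x) (- y); rewrite g2E -gp ?oppr_ge0 // -!greenE ?oppr_ge0 // !greenN green_primitiveN.
  have -> : green y - green x - (- y - - x) * - ((- green_primitive x + 2^-1) / lambda ^+ 2) =
   green y - green x + (y - x) * ((green_primitive x - 2^-1) / lambda ^+ 2).
    by field.
  have -> : (- y - - x) ^+ 2 = (y - x) ^+ 2 by ring.
  by apply; apply/andP; split; rewrite ?oppr_ge0 // lerNl.
Qed.

End green_kernel.

(** * Calculus of indefinite integrals *)

Section absolutely_continuous_calculus.
Context {R : realType}.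
Implicit Types (A H D S a h s r : R -> R).

Definition prim_of A a := summable_on 0 1 a /\
  forall x y, 0 <= x -> x <= y -> y <= 1 -> A y - A x = \I_(x, y) a.

Lemma prim_of_integral (A0 : R) a : summable_on 0 1 a -> prim_of (fun x => A0 + \I_(0, x) a) a.
Proof.
move=> ha; split=> // x y x0 xy y1.
rewrite (integral_addition x0 xy); last by apply: summable_sub ha.
ring.
Qed.

Lemma prim_of_continuous A a : prim_of A a -> {within `[0, 1], continuous A}.
Proof.
move=> [ha HA]; have c := continuous_primitive ler01 ha.
apply: eps_within_continuous => t /andP[t0 t1] e e0.
have [d d0 Hd] := within_continuous_eps c (introT andP (conj t0 t1)) e0.
exists d => // s /[dup] s01 /andP[s0 s1] /(Hd s s01).
have E x : 0 <= x -> x <= 1 -> \I_(0, x) a = A x - A 0 by move=> x0 x1; rewrite HA.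
by rewrite !E //; congr (`|_| < _); ring.
Qed.

Lemma prim_of_bounded A a : prim_of A a ->
  exists2 C, 0 <= C & forall x, 0 <= x <= 1 -> `|A x| <= C.
Proof.
move=> [ha HA]; exists (`|A 0| + \I_(0, 1) (fun t => `|a t|)).
  by rewrite addr_ge0 //; apply: integral_ge0'.
move=> x /andP[x0 x1]; rewrite -(subrK (A 0) (A x)) addrC.
apply: le_trans (ler_normD _ _) _; rewrite lerD2l HA //.
have nx : summable_on 0 1 (fun t => `|a t|) by exact: summable_norm.
have sx : 0 <= x <= 1 by rewrite x0.
apply: (@le_trans _ _ (\I_(0, x) (fun t => `|a t|))).
  by apply: integral_norm_le => //; apply: summable_sub nx || apply: summable_sub ha.
by apply: integral_mono.
Qed.

Lemma prim_ofB A a H h : prim_of A a -> prim_of H h ->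
  prim_of (fun x => A x - H x) (fun x => a x - h x).
Proof.
move=> [ha HA] [hh HH]; split; first exact: summableB.
move=> x y x0 xy y1; rewrite integralB'; [|exact: summable_sub ha|exact: summable_sub hh].
by rewrite -HA // -HH //; ring.
Qed.

Lemma prim_ofZ c A a : prim_of A a -> prim_of (fun x => c * A x) (fun x => c * a x).
Proof.
move=> [ha HA]; split; first exact: summableZ.
move=> x y x0 xy y1; rewrite integralZ'; last exact: summable_sub ha.
by rewrite -HA // mulrBr.
Qed.

Lemma prim_of_ext A a A' a' : (forall x, 0 <= x <= 1 -> A x = A' x) ->
  (forall x, 0 <= x <= 1 -> a x = a' x) -> prim_of A a -> prim_of A' a'.
Proof.
move=> AA aa [ha HA]; split.
  apply: eq_integrable ha => // x; rewrite inE /= in_itv /= => x01.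
  by rewrite aa.
move=> x y x0 xy y1; rewrite -!AA ?HA ?x0 ?y1 ?(le_trans x0 xy) ?(le_trans xy y1) //.
by apply: eq_integral_on => t /andP[xt ty]; apply: aa; apply/andP; split; lra.
Qed.

(** The chain rule in the form used for kernels composed with arclength: the
    difference between [D] and the indefinite integral of [S * s] has quadratic
    increments, hence is constant by [quadratic_increment_cst]. *)
Lemma prim_of_quadratic D S s r C : 0 <= C -> summable_on 0 1 s ->
  {within `[0, 1], continuous r} ->
  (forall x y, 0 <= x -> x <= y -> y <= 1 -> \I_(x, y) (fun t => `|s t|) <= r y - r x) ->
  (forall x y, 0 <= x -> x <= y -> y <= 1 -> `|S y - S x| <= C * (r y - r x)) ->
  (forall x y, 0 <= x -> x <= y -> y <= 1 ->
     `|D y - D x - S x * \I_(x, y) s| <= C * (r y - r x) ^+ 2) ->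
  prim_of D (fun u => S u * s u).
Proof.
move=> C0 hs cr sr Sr Dr.
have rmono x y : 0 <= x -> x <= y -> y <= 1 -> 0 <= r y - r x.
  by move=> x0 xy y1; apply: le_trans (sr _ _ x0 xy y1); apply: integral_ge0'.
have cS : {within `[0, 1], continuous S}.
  apply: eps_within_continuous => t /andP[t0 t1] e e0.
  have e1 : 0 < e / (C + 1) by rewrite divr_gt0 // ltr_wpDl.
  have [d d0 Hd] := within_continuous_eps cr (introT andP (conj t0 t1)) e1.
  exists d => // u /[dup] u01 /andP[u0 u1] /(Hd u u01).
  rewrite ltr_pdivlMr ?ltr_wpDl // => h; apply: le_lt_trans h.
  have [ut|/ltW tu] := leP u t.
    rewrite distrC (distrC (r u)) (ger0_norm (rmono _ _ u0 ut t1)) mulrC.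
    apply: le_trans (Sr _ _ u0 ut t1) _; apply: ler_wpM2r; first exact: rmono.
    by rewrite lerDl.
  rewrite (ger0_norm (rmono _ _ t0 tu u1)) mulrC.
  apply: le_trans (Sr _ _ t0 tu u1) _; apply: ler_wpM2r; first exact: rmono.
  by rewrite lerDl.
have [b b0 Sb] : exists2 b, 0 <= b & forall x, 0 <= x <= 1 -> `|S x| <= b.
  exists (`|S 0| + C * (r 1 - r 0)); first by rewrite addr_ge0 // mulr_ge0 // rmono.
  move=> x /andP[x0 x1]; rewrite -(subrK (S 0) (S x)) addrC.
  apply: le_trans (ler_normD _ _) _; rewrite lerD2l.
  apply: le_trans (Sr _ _ _ x0 x1) _ => //; apply: ler_wpM2l => //.
  by have := rmono _ _ x0 x1 (lexx 1); lra.
have hSs : summable_on 0 1 (fun u => S u * s u).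
  have := summable_mul_bounded hs (continuous_measurable cS) Sb.
  by apply: eq_integrable => // x _ /=; rewrite mulrC.
split=> // x y x0 xy y1.
pose E z := D z - \I_(0, z) (fun u => S u * s u).
suff : E y = E x.
  rewrite /E (integral_addition x0 xy); last exact: summable_sub hSs.
  lra.
apply: (@quadratic_increment_cst _ E r 0 1 (2 * C)) => // {x0 xy y1}x {}y x0 xy y1.
rewrite /E (integral_addition x0 xy); last exact: summable_sub hSs.
have -> : D y - (\I_(0, x) (fun u => S u * s u) + \I_(x, y) (fun u => S u * s u)) -
   (D x - \I_(0, x) (fun u => S u * s u)) =
   (D y - D x - S x * \I_(x, y) s) - (\I_(x, y) (fun u => S u * s u) - S x * \I_(x, y) s).
  ring.
apply: le_trans (ler_normB _ _) _.
have -> : 2 * C * (r y - r x) ^+ 2 = C * (r y - r x) ^+ 2 + C * (r y - r x) * (r y - r x) by ring.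
apply: lerD; first exact: Dr.
have hs' : summable_on x y s by exact: summable_sub hs.
rewrite -integralZ' // -integralB'; [|exact: summable_sub hSs|exact: summableZ].
have nn : 0 <= C * (r y - r x) by rewrite mulr_ge0 // rmono.
apply: le_trans (ler_wpM2l nn (sr _ _ x0 xy y1)).
rewrite -integralZ'; last exact: summable_norm.
apply: integral_norm_le.
- by apply: summableB; [exact: summable_sub hSs|exact: summableZ].
- by apply: summableZ; exact: summable_norm.
move=> t /andP[xt ty]; rewrite -mulrBl normrM; apply: ler_wpM2r => //.
apply: le_trans (Sr _ _ x0 xt (le_trans ty y1)) _; apply: ler_wpM2l => //.
by have := rmono _ _ (le_trans x0 xt) ty y1; lra.
Qed.

(** The product rule: the errors in the increment of the product are products of
    two increments, and [r] is the sum of the variations of the factors. *)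
Lemma prim_of_mul A a H h : prim_of A a -> prim_of H h ->
  prim_of (fun x => A x * H x) (fun x => a x * H x + A x * h x).
Proof.
move=> pA pH; have [ha HA] := pA; have [hh HH] := pH.
have cA := prim_of_continuous pA; have cH := prim_of_continuous pH.
have [CA CA0 bA] := prim_of_bounded pA; have [CH CH0 bH] := prim_of_bounded pH.
have h1 : summable_on 0 1 (fun x => a x * H x).
  exact: (summable_mul_bounded ha (continuous_measurable cH) bH).
have h2 : summable_on 0 1 (fun x => A x * h x).
  have := summable_mul_bounded hh (continuous_measurable cA) bA.
  by apply: eq_integrable => // x _ /=; rewrite mulrC.
have h12 : summable_on 0 1 (fun x => a x * H x + A x * h x) by exact: summableD.
split=> // x y x0 xy y1.
pose q t := `|a t| + `|h t|; pose r x := \I_(0, x) q.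
have hq : summable_on 0 1 q by apply: summableD; exact: summable_norm.
pose E z := A z * H z - \I_(0, z) (fun x => a x * H x + A x * h x).
suff : E y = E x.
  rewrite /E (integral_addition x0 xy); last exact: summable_sub h12.
  lra.
apply: (@quadratic_increment_cst _ E r 0 1 3) => // {x0 xy y1}.
  exact: continuous_primitive.
move=> {}x {}y x0 xy y1; rewrite /E /r !(integral_addition x0 xy); last first.
- exact: summable_sub h12.
- exact: summable_sub hq.
have hq' : summable_on x y q by exact: summable_sub hq.
have ha' : summable_on x y a by exact: summable_sub ha.
have hh' : summable_on x y h by exact: summable_sub hh.
have h1' : summable_on x y (fun x => a x * H x) by exact: summable_sub h1.
have h2' : summable_on x y (fun x => A x * h x) by exact: summable_sub h2.
set q1 := \I_(0, x) q; set q2 := \I_(x, y) q.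
have -> : q1 + q2 - q1 = q2 by ring.
have sub f : summable_on 0 1 f -> (forall t, `|f t| <= q t) ->
    forall t, x <= t <= y -> `|\I_(x, t) f| <= q2.
  move=> hf fq t /andP[xt ty]; have t1 := le_trans ty y1; apply: (@le_trans _ _ (\I_(x, t) q)).
    apply: integral_norm_le => //; [exact: summable_sub hf|exact: summable_sub hq].
  by apply: integral_mono => // z _; rewrite addr_ge0.
have aq t : `|a t| <= q t by rewrite lerDl.
have hq2 t : `|h t| <= q t by rewrite lerDr.
have q20 : 0 <= q2 by apply: integral_ge0' => t _; rewrite addr_ge0.
have dA t : x <= t <= y -> `|A t - A x| <= q2.
  by move=> /andP[xt ty]; rewrite HA ?(le_trans ty) //; apply: (sub a) => //; rewrite xt.
have dH t : x <= t <= y -> `|H t - H x| <= q2.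
  by move=> /andP[xt ty]; rewrite HH ?(le_trans ty) //; apply: (sub h) => //; rewrite xt.
rewrite (integralD' h1' h2').
have -> : A y * H y - (\I_(0, x) (fun x0 => a x0 * H x0 + A x0 * h x0) +
   (\I_(x, y) (fun x0 => a x0 * H x0) + \I_(x, y) (fun x0 => A x0 * h x0))) -
   (A x * H x - \I_(0, x) (fun x0 => a x0 * H x0 + A x0 * h x0)) =
  (A y - A x) * (H y - H x) -
  (\I_(x, y) (fun x0 => a x0 * H x0) - (A y - A x) * H x) -
  (\I_(x, y) (fun x0 => A x0 * h x0) - A x * (H y - H x)) by ring.
have i1 : `|\I_(x, y) (fun x0 => a x0 * H x0) - (A y - A x) * H x| <= q2 * q2.
  rewrite HA // mulrC -integralZ' // -integralB' //; last exact: summableZ.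
  rewrite {2}/q2 -integralZ' //; apply: integral_norm_le.
  - by apply: summableB => //; exact: summableZ.
  - exact: summableZ.
  move=> t /dH Ht; have -> : a t * H t - H x * a t = (H t - H x) * a t by ring.
  by rewrite normrM; apply: ler_pM.
have i2 : `|\I_(x, y) (fun x0 => A x0 * h x0) - A x * (H y - H x)| <= q2 * q2.
  rewrite HH // -integralZ' // -integralB' //; last exact: summableZ.
  rewrite {2}/q2 -integralZ' //; apply: integral_norm_le.
  - by apply: summableB => //; exact: summableZ.
  - exact: summableZ.
  move=> t /dA At; have -> : A t * h t - A x * h t = (A t - A x) * h t by ring.
  by rewrite normrM; apply: ler_pM.
have i3 : `|(A y - A x) * (H y - H x)| <= q2 * q2.
  by rewrite normrM; apply: ler_pM => //; [apply: dA|apply: dH]; rewrite xy lexx.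
apply: le_trans (ler_normB _ _) _; apply: le_trans (lerD (ler_normB _ _) i2) _.
by rewrite expr2; lra.
Qed.

End absolutely_continuous_calculus.

(** * Convolution in the arclength parameter *)

Section arclength_convolution.
Context {R : realType}.
Implicit Types (k m w : R -> R) (u x y B : R).

Definition total m : R := \I_(0, 1) m.

(** [arc m] is the normalized arclength of a curve of speed [m]; [smear k m w]
    integrates [w] against the kernel [k] in that parameter. *)
Definition arc m u : R := \I_(0, u) m / total m.
Definition smear k m w u : R := \I_(0, 1) (fun v => w v * k (arc m v - arc m u)).

Definition is_speed m : Prop :=
  [/\ summable_on 0 1 m, forall u, 0 <= u <= 1 -> 0 <= m u & 0 < total m].

(** Differences of normalized arclengths lie in [[-1, 1]], outside which the
    kernels of interest grow exponentially. *)
Definition kernel_bound k B : Prop :=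
  (forall x, -1 <= x <= 1 -> `|k x| <= B) /\
  (forall x y, -1 <= x <= 1 -> -1 <= y <= 1 -> `|k y - k x| <= B * `|y - x|).

Lemma arc0 m : arc m 0 = 0.
Proof. by rewrite /arc integral_point mul0r. Qed.

Lemma arc1 m : is_speed m -> arc m 1 = 1.
Proof. by move=> [_ _ M0]; rewrite /arc divff // gt_eqF. Qed.

Lemma arc_increment m x y : is_speed m -> 0 <= x -> x <= y -> y <= 1 ->
  arc m y - arc m x = \I_(x, y) m / total m.
Proof.
move=> [hm _ _] x0 xy y1; rewrite /arc (integral_addition x0 xy); last exact: summable_sub hm.
ring.
Qed.

Lemma arc_increment_ge0 m x y : is_speed m -> 0 <= x -> x <= y -> y <= 1 ->
  0 <= arc m y - arc m x.
Proof.
move=> hm x0 xy y1; rewrite (arc_increment hm) //; case: hm => _ m0 M0.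
apply: divr_ge0; last exact: ltW.
by apply: integral_ge0' => t /andP[xt ty]; apply: m0; apply/andP; split; lra.
Qed.

Lemma arc_itv m u : is_speed m -> 0 <= u <= 1 -> 0 <= arc m u <= 1.
Proof.
move=> hm /andP[u0 u1]; have := arc_increment_ge0 hm (lexx 0) u0 u1.
have := arc_increment_ge0 hm u0 u1 (lexx 1); rewrite arc0 arc1 //.
by move=> ? ?; apply/andP; split; lra.
Qed.

Lemma arcB_itv m u v : is_speed m -> 0 <= u <= 1 -> 0 <= v <= 1 ->
  -1 <= arc m u - arc m v <= 1.
Proof.
move=> hm /(arc_itv hm)/andP[? ?] /(arc_itv hm)/andP[? ?].
by apply/andP; split; lra.
Qed.

Lemma arc_prim m : is_speed m -> prim_of (arc m) (fun u => m u / total m).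
Proof.
move=> hm; have [sm _ _] := hm; split.
  have := summableZ (total m)^-1 sm.
  by apply: eq_integrable => // x _ /=; rewrite mulrC.
move=> x y x0 xy y1; rewrite (arc_increment hm) //.
have sm' : summable_on x y m by exact: summable_sub sm.
by rewrite mulrC -integralZ' //; apply: eq_integral_on => t _; rewrite mulrC.
Qed.

Lemma arc_continuous m : is_speed m -> {within `[0, 1], continuous (arc m)}.
Proof. by move=> /arc_prim/prim_of_continuous. Qed.

Lemma kernel_bound_ge0 k B : kernel_bound k B -> 0 <= B.
Proof.
by move=> [h _]; apply: le_trans (h 0 _) => //; rewrite lerN10 ler01.
Qed.

Lemma kernel_arc_continuous k B m u : kernel_bound k B -> is_speed m ->
  0 <= u <= 1 -> {within `[0, 1], continuous (fun v => k (arc m v - arc m u))}.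
Proof.
move=> kB hm u01; have B0 := kernel_bound_ge0 kB.
apply: eps_within_continuous => t t01 e e0.
have e1 : 0 < e / (B + 1) by rewrite divr_gt0 // ltr_wpDl.
have [d d0 Hd] := within_continuous_eps (arc_continuous hm) t01 e1.
exists d => // s s01 /(Hd s s01); rewrite ltr_pdivlMr ?ltr_wpDl // => h.
apply: le_lt_trans h; have [_ kl] := kB.
apply: le_trans (kl _ _ _ _) _; try exact: arcB_itv.
have -> : arc m s - arc m u - (arc m t - arc m u) = arc m s - arc m t by ring.
by rewrite mulrC; apply: ler_wpM2l => //; rewrite lerDl.
Qed.

Lemma smear_summable k B m w u : kernel_bound k B -> is_speed m ->
  summable_on 0 1 w -> 0 <= u <= 1 ->
  summable_on 0 1 (fun v => w v * k (arc m v - arc m u)).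
Proof.
move=> kB hm hw u01; apply: (summable_mul_bounded (C := B) hw).
  exact: continuous_measurable (kernel_arc_continuous kB hm u01).
by move=> t t01; apply: kB.1; exact: arcB_itv.
Qed.

Lemma smear_norm k B m w u : kernel_bound k B -> is_speed m ->
  summable_on 0 1 w -> 0 <= u <= 1 ->
  `|smear k m w u| <= B * \I_(0, 1) (fun v => `|w v|).
Proof.
move=> kB hm hw u01; rewrite /smear -integralZ'; last exact: summable_norm.
apply: integral_norm_le; first exact: smear_summable kB hm hw u01.
  by apply: summableZ; exact: summable_norm.
move=> t t01; rewrite normrM mulrC; apply: ler_wpM2r => //.
by apply: kB.1; exact: arcB_itv.
Qed.

Lemma smear_lipschitz k B m w u u' : kernel_bound k B -> is_speed m ->
  summable_on 0 1 w -> 0 <= u <= 1 -> 0 <= u' <= 1 ->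
  `|smear k m w u - smear k m w u'| <=
    B * `|arc m u - arc m u'| * \I_(0, 1) (fun v => `|w v|).
Proof.
move=> kB hm hw u01 u'01.
have h := smear_summable kB hm hw u01; have h' := smear_summable kB hm hw u'01.
rewrite /smear -integralB' // -integralZ'; last exact: summable_norm.
apply: integral_norm_le; first exact: summableB.
  by apply: summableZ; exact: summable_norm.
move=> t t01; rewrite -mulrBr normrM mulrC; apply: ler_wpM2r => //.
apply: le_trans (kB.2 _ _ _ _) _; try exact: arcB_itv.
rewrite le_eqVlt; apply/orP; left; apply/eqP.
by rewrite -normrN; congr (_ * `|_|); ring.
Qed.

Lemma smear_continuous k B m w : kernel_bound k B -> is_speed m ->
  summable_on 0 1 w -> {within `[0, 1], continuous (smear k m w)}.
Proof.
move=> kB hm hw; have B0 := kernel_bound_ge0 kB.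
set W := \I_(0, 1) (fun v => `|w v|).
have W0 : 0 <= W by apply: integral_ge0'.
apply: eps_within_continuous => t t01 e e0.
have D0 : 0 < B * W + 1 by rewrite ltr_wpDl // mulr_ge0.
have e1 : 0 < e / (B * W + 1) by rewrite divr_gt0.
have [d d0 Hd] := within_continuous_eps (arc_continuous hm) t01 e1.
exists d => // s s01 /(Hd s s01); rewrite ltr_pdivlMr // => h.
apply: le_lt_trans (smear_lipschitz kB hm hw s01 t01) _; apply: le_lt_trans h.
by rewrite mulrAC mulrC; apply: ler_wpM2l => //; rewrite lerDl.
Qed.

Lemma arc_lipschitz m m' u : is_speed m -> is_speed m' -> 0 <= u <= 1 ->
  `|arc m u - arc m' u| <= 2 / total m * \I_(0, 1) (fun v => `|m v - m' v|).
Proof.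
move=> hm hm' u01; have [sm m0 M0] := hm; have [sm' m'0 M'0] := hm'.
have /andP[u0 u1] := u01; have /andP[a0 a1] := arc_itv hm' u01.
set N := \I_(0, 1) (fun v => `|m v - m' v|).
have sN : summable_on 0 1 (fun v => `|m v - m' v|) by exact/summable_norm/summableB.
have h1 : `|\I_(0, u) m - \I_(0, u) m'| <= N.
  have su : summable_on 0 u m by exact: summable_sub sm.
  have su' : summable_on 0 u m' by exact: summable_sub sm'.
  rewrite -integralB' //; apply: (@le_trans _ _ (\I_(0, u) (fun v => `|m v - m' v|))).
    by apply: integral_norm_le => //; [exact: summableB|exact: summable_sub sN].
  exact: integral_mono.
have h2 : `|total m - total m'| <= N.
  by rewrite /total -integralB' //; apply: integral_norm_le => //; exact: summableB.
have -> : arc m u - arc m' u =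
   (total m)^-1 * (\I_(0, u) m - \I_(0, u) m' - arc m' u * (total m - total m')).
  by rewrite /arc; field; rewrite !gt_eqF.
have -> : 2 / total m * N = (total m)^-1 * (2 * N) by ring.
rewrite normrM ger0_norm ?invr_ge0 ?(ltW M0) //.
apply: ler_wpM2l; first by rewrite invr_ge0 ltW.
apply: le_trans (ler_normB _ _) _; rewrite normrM (ger0_norm a0).
have : arc m' u * `|total m - total m'| <= 1 * N by apply: ler_pM.
lra.
Qed.

(** Lipschitz dependence of the convolution on the speed and on the density,
    in [L^1]: the heart of both existence and uniqueness. *)
Lemma smear_speed_lipschitz k B m m' w w' u : kernel_bound k B ->
  is_speed m -> is_speed m' -> summable_on 0 1 w -> summable_on 0 1 w' ->
  (forall v, 0 <= v <= 1 -> `|w' v| <= m' v) -> 0 <= u <= 1 ->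
  `|smear k m w u - smear k m' w' u| <=
    B * \I_(0, 1) (fun v => `|w v - w' v|) +
    4 * B * (total m' / total m) * \I_(0, 1) (fun v => `|m v - m' v|).
Proof.
move=> kB hm hm' hw hw' wm' u01; have [sm m0 M0] := hm; have [sm' m'0 M'0] := hm'.
have B0 := kernel_bound_ge0 kB.
set N := \I_(0, 1) (fun v => `|m v - m' v|).
have h := smear_summable kB hm hw u01; have h' := smear_summable kB hm' hw' u01.
rewrite /smear -integralB' //.
have sw : summable_on 0 1 (fun v => `|w v - w' v|) by exact/summable_norm/summableB.
have -> : 4 * B * (total m' / total m) * N = (4 * B / total m * N) * total m'.
  by field; rewrite gt_eqF.
rewrite -(integralZ' B sw) -(integralZ' (4 * B / total m * N) sm').
rewrite -integralD'; [|exact: summableZ|exact: summableZ].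
apply: integral_norm_le; first exact: summableB.
  by apply: summableD; exact: summableZ.
move=> v v01.
set a := k (arc m v - arc m u); set b := k (arc m' v - arc m' u).
have -> : w v * a - w' v * b = a * (w v - w' v) + (a - b) * w' v by ring.
apply: le_trans (ler_normD _ _) _; rewrite !normrM; apply: lerD.
  by apply: ler_wpM2r => //; apply: kB.1; exact: arcB_itv.
apply: ler_pM => //; last exact: wm'.
apply: le_trans (kB.2 _ _ _ _) _; try exact: arcB_itv.
rewrite -!mulrA mulrCA; apply: ler_wpM2l => //.
have -> : arc m v - arc m u - (arc m' v - arc m' u) =
   (arc m v - arc m' v) - (arc m u - arc m' u) by ring.
apply: le_trans (ler_normB _ _) _.
have := arc_lipschitz hm hm' u01; have := arc_lipschitz hm hm' v01; rewrite -/N /total; lra.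
Qed.

End arclength_convolution.

(** * Convolution with the Green function and its spectral gap *)

Section green_convolution.
Context {R : realType} (lambda : R) (lambda0 : 0 < lambda).
Implicit Types (m w gamma : R -> R) (u x y B : R).
Local Notation g := (green lambda).
Local Notation gg := (green_primitive lambda).

Lemma green_kernel_bounds : exists B : R, [/\ kernel_bound g B, kernel_bound gg B &
  [/\ forall x y, -1 <= x <= 1 -> -1 <= y <= 1 ->
    `|gg y - gg x + (y - x) * g x| <= B * (y - x) ^+ 2,
   forall x y, 0 <= x <= 1 -> 0 <= y <= 1 ->
    `|g y - g x + (y - x) * ((gg x + 2^-1) / lambda ^+ 2)| <= B * (y - x) ^+ 2 &
   forall x y, -1 <= x <= 0 -> -1 <= y <= 0 ->
    `|g y - g x + (y - x) * ((gg x - 2^-1) / lambda ^+ 2)| <= B * (y - x) ^+ 2]].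
Proof.
have [B [B0 gB glip [ggt gt1 gt2]]] := green_bounds lambda0.
have mono z : 0 <= z -> B * z <= (3 * B + 1) * z by move=> z0; apply: ler_wpM2r => //; lra.
have gn x : -1 <= x <= 1 -> `|g x| <= B by move=> x1; rewrite ger0_norm ?gB ?green_ge0.
exists (3 * B + 1); split.
- split=> [x /gn h|x y x1 y1]; first by lra.
  by apply: le_trans (glip _ _ x1 y1) _; exact: mono.
- split=> [x /(green_primitive_norm lambda0) h|x y x1 y1]; first by lra.
  have -> : gg y - gg x = (gg y - gg x + (y - x) * g x) - (y - x) * g x by ring.
  apply: le_trans (ler_normB _ _) _.
  apply: le_trans (lerD (ggt _ _ x1 y1) (lexx _)) _; rewrite normrM.
  have d2 : `|y - x| <= 2.
    by case/andP: x1 => ? ?; case/andP: y1 => ? ?; rewrite ler_norml; apply/andP; split; lra.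
  have -> : B * (y - x) ^+ 2 = B * `|y - x| * `|y - x|.
    by rewrite -mulrA -expr2 real_normK ?num_real.
  have h1 : B * `|y - x| * `|y - x| <= B * `|y - x| * 2.
    by apply: ler_wpM2l => //; rewrite mulr_ge0.
  have h2 : `|y - x| * `|g x| <= `|y - x| * B by apply: ler_wpM2l => //; exact: gn.
  have : 0 <= `|y - x| by [].
  lra.
- split=> x y x1 y1.
  + by apply: le_trans (ggt _ _ x1 y1) _; apply: mono; exact: sqr_ge0.
  + by apply: le_trans (gt1 _ _ x1 y1) _; apply: mono; exact: sqr_ge0.
  + by apply: le_trans (gt2 _ _ x1 y1) _; apply: mono; exact: sqr_ge0.
Qed.

Lemma speed_arc_variation m x y : is_speed m -> 0 <= x -> x <= y -> y <= 1 ->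
  \I_(x, y) (fun t => `|m t / total m|) <= arc m y - arc m x.
Proof.
move=> hm x0 xy y1; have [sm m0 M0] := hm; rewrite (arc_prim hm).2 //.
have sm' : summable_on x y (fun t => m t / total m).
  by case: (arc_prim hm) => h _; exact: summable_sub h.
apply: integral_le => //; first exact: summable_norm.
move=> t /andP[xt ty]; rewrite ger0_norm // divr_ge0 ?(ltW M0) // m0 //.
by apply/andP; split; lra.
Qed.

(** Differentiation under the convolution: [green_primitive] has derivative
    [- green], and the sign disappears because the moving point is subtracted. *)
Lemma smear_primitive_prim m w : is_speed m -> summable_on 0 1 w ->
  prim_of (smear gg m w) (fun u => smear g m w u * (m u / total m)).
Proof.
move=> hm hw; have [B [gB ggB [ggt _ _]]] := green_kernel_bounds.
have B0 := kernel_bound_ge0 gB.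
set W := \I_(0, 1) (fun v => `|w v|).
have W0 : 0 <= W by apply: integral_ge0'.
have [sm _] := arc_prim hm.
apply: (@prim_of_quadratic _ _ _ _ (arc m) (B * W)) => //.
- by rewrite mulr_ge0.
- exact: arc_continuous.
- by move=> x y x0 xy y1; exact: speed_arc_variation.
- move=> x y x0 xy y1; have x01 : 0 <= x <= 1 by rewrite x0 (le_trans xy).
  have y01 : 0 <= y <= 1 by rewrite y1 (le_trans x0).
  apply: le_trans (smear_lipschitz gB hm hw y01 x01) _.
  by rewrite ger0_norm ?arc_increment_ge0 // mulrAC.
move=> x y x0 xy y1; have x01 : 0 <= x <= 1 by rewrite x0 (le_trans xy).
have y01 : 0 <= y <= 1 by rewrite y1 (le_trans x0).
rewrite -((arc_prim hm).2 x y) // /smear.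
have h1 := smear_summable ggB hm hw y01; have h2 := smear_summable ggB hm hw x01.
have h3 := smear_summable gB hm hw x01.
set d := arc m y - arc m x.
rewrite (mulrC _ d) -(integralZ' d h3) -(integralB' h1 h2).
rewrite -(integralB' (summableB h1 h2) (summableZ d h3)).
have -> : B * W * d ^+ 2 = (B * d ^+ 2) * W by ring.
rewrite -integralZ'; last exact: summable_norm.
apply: integral_norm_le.
- by apply: summableB; [exact: summableB|exact: summableZ].
- by apply: summableZ; exact: summable_norm.
move=> v v01.
have -> : w v * gg (arc m v - arc m y) - w v * gg (arc m v - arc m x) -
    d * (w v * g (arc m v - arc m x)) =
   w v * (gg (arc m v - arc m y) - gg (arc m v - arc m x) +
     ((arc m v - arc m y) - (arc m v - arc m x)) * g (arc m v - arc m x)).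
  rewrite /d; move: (gg _) (gg (arc m v - arc m x)) (g _) => c1 c2 c3; ring.
rewrite normrM mulrC; apply: ler_wpM2r => //.
apply: le_trans (ggt _ _ _ _) _; try exact: arcB_itv.
by rewrite le_eqVlt; apply/orP; left; apply/eqP; rewrite /d; ring.
Qed.

Lemma smear_green_periodic m w : is_speed m -> summable_on 0 1 w ->
  smear g m w 1 = smear g m w 0.
Proof.
move=> hm hw; rewrite /smear; apply: eq_integral_on => v v01.
by rewrite arc1 // arc0 subr0 green_shift //; exact: arc_itv.
Qed.

Lemma smear_primitive_period m w : is_speed m -> summable_on 0 1 w ->
  smear gg m w 1 = smear gg m w 0 + \I_(0, 1) w.
Proof.
move=> hm hw; have [B [_ ggB _]] := green_kernel_bounds.
have h0 : 0 <= (0 : R) <= 1 by rewrite lexx ler01.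
rewrite /smear -integralD' //; last exact: smear_summable ggB hm hw h0.
apply: eq_integral_on => v v01; rewrite arc1 // arc0 subr0.
by rewrite green_primitive_shift // ?mulrDr ?mulr1 //; exact: arc_itv.
Qed.

Lemma smear_green_total m w : is_speed m -> summable_on 0 1 w ->
  \I_(0, 1) (fun u => smear g m w u * (m u / total m)) = \I_(0, 1) w.
Proof.
move=> hm hw; rewrite -(smear_primitive_prim hm hw).2 // smear_primitive_period //.
by rewrite addrC addKr.
Qed.

(** Integration by parts in the definition of the convolution with a closed
    curve: only the derivative of the curve is then convolved. *)
Lemma green_conv_by_parts m w gamma u : is_speed m -> prim_of gamma w ->
  \I_(0, 1) w = 0 -> 0 <= u <= 1 ->
  \I_(0, 1) (fun v => gamma v * g (arc m v - arc m u) * (m v / total m)) =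
    gamma 0 + smear gg m w u.
Proof.
move=> hm hg w0 u01; have [B [gB ggB [ggt _ _]]] := green_kernel_bounds.
have B0 := kernel_bound_ge0 gB.
have pk : prim_of (fun v => gg (arc m v - arc m u))
    (fun v => - g (arc m v - arc m u) * (m v / total m)).
  have [sm _] := arc_prim hm.
  apply: (@prim_of_quadratic _ _ _ _ (arc m) B) => //.
  - exact: arc_continuous.
  - by move=> x y x0 xy y1; exact: speed_arc_variation.
  - move=> x y x0 xy y1; have x01 : 0 <= x <= 1 by rewrite x0 (le_trans xy).
    have y01 : 0 <= y <= 1 by rewrite y1 (le_trans x0).
    rewrite -opprD normrN; apply: le_trans (gB.2 _ _ _ _) _; try exact: arcB_itv.
    have -> : arc m y - arc m u - (arc m x - arc m u) = arc m y - arc m x by ring.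
    by rewrite ger0_norm // arc_increment_ge0.
  move=> x y x0 xy y1; have x01 : 0 <= x <= 1 by rewrite x0 (le_trans xy).
  have y01 : 0 <= y <= 1 by rewrite y1 (le_trans x0).
  rewrite -((arc_prim hm).2 x y) //.
  have := ggt (arc m x - arc m u) (arc m y - arc m u) (arcB_itv hm x01 u01) (arcB_itv hm y01 u01).
  have -> : arc m y - arc m u - (arc m x - arc m u) = arc m y - arc m x by ring.
  by rewrite mulNr opprK (mulrC (g _)).
have [hs hgw] := prim_of_mul hg pk.
have g1 : gamma 1 = gamma 0 by apply/eqP; rewrite -subr_eq0 hg.2 // w0.
have := hgw 0 1 (lexx 0) ler01 (lexx 1); rewrite g1 arc1 // arc0 sub0r.
have /andP[a0 a1] := arc_itv hm u01.
have -> : gg (1 - arc m u) = gg (- arc m u) - 1.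
  have -> : 1 - arc m u = - (arc m u - 1) by ring.
  rewrite !green_primitiveN // green_primitive_shift ?a0 //; ring.
have s1 := smear_summable ggB hm hg.1 u01.
have s2 : summable_on 0 1 (fun v => gamma v * g (arc m v - arc m u) * (m v / total m)).
  have := summableB s1 hs; apply: eq_integrable => // v _ /=; congr (_%:E); ring.
have -> : \I_(0, 1) (fun x => w x * gg (arc m x - arc m u) +
    gamma x * (- g (arc m x - arc m u) * (m x / total m))) =
  smear gg m w u - \I_(0, 1) (fun v => gamma v * g (arc m v - arc m u) * (m v / total m)).
  by rewrite /smear -integralB' //; apply: eq_integral_on => v _; ring.
lra.
Qed.


(** The profile of the convolved density solves [p' = S], [S' = (p - w) / lambda^2]
    in the arclength parameter.  The first equation is delicate at the diagonal,
    where [green] has a kink: the [O(h)] error there is paid for by the mass of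
    [w] on the increment. *)
Definition smear_slope m w u := (smear gg m w u - \I_(0, u) w) / lambda ^+ 2.

Lemma smear_slope_prim m w : is_speed m -> summable_on 0 1 w ->
  prim_of (smear_slope m w)
    (fun u => (lambda ^+ 2)^-1 * (smear g m w u * (m u / total m) - w u)).
Proof.
move=> hm hw; have h0 := prim_of_integral 0 hw.
have := prim_ofZ (lambda ^+ 2)^-1 (prim_ofB (smear_primitive_prim hm hw) h0).
by apply: prim_of_ext => // x _; rewrite add0r mulrC.
Qed.

Let nonpos_half (b c : R) : -1 <= c - b <= 1 -> 0 <= b - c -> -1 <= c - b <= 0.
Proof. by move=> /andP[h1 _] h2; rewrite h1 -oppr_ge0 opprB. Qed.

Let nonneg_half (b c : R) : -1 <= c - b <= 1 -> 0 <= c - b -> 0 <= c - b <= 1.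
Proof. by move=> /andP[_ h1] ->. Qed.

Let increment_algebra (B W q h V : R) : 0 <= B -> 0 <= B * W -> 0 <= q -> 0 <= h -> 0 <= V ->
  B * h ^+ 2 * W + (B * h + 2 * q * h) * V + B * h ^+ 2 * W <=
    ((B * W + 1) * q + (2 * (B * W) + B + 2 * q)) * (h + V) ^+ 2.
Proof.
move=> B0 BW0 q0 h0 V0; have bq : 0 <= B * W * q by exact: mulr_ge0.
set C := (B * W + 1) * q + (2 * (B * W) + B + 2 * q).
have h2 : 0 <= h ^+ 2 by exact: sqr_ge0.
have hV : 0 <= h * V by exact: mulr_ge0.
have -> : B * h ^+ 2 * W + (B * h + 2 * q * h) * V + B * h ^+ 2 * W =
  (2 * (B * W)) * h ^+ 2 + (B + 2 * q) * (h * V) by ring.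
have -> : C * (h + V) ^+ 2 = C * h ^+ 2 + (2 * C) * (h * V) + C * V ^+ 2 by ring.
have C0 : 0 <= C by rewrite /C; lra.
rewrite -[leLHS]addr0; apply: lerD; last by rewrite mulr_ge0 // sqr_ge0.
by apply: lerD; apply: ler_wpM2r => //; rewrite /C; lra.
Qed.

Lemma smear_green_prim m w : is_speed m -> summable_on 0 1 w -> \I_(0, 1) w = 0 ->
  prim_of (smear g m w) (fun u => smear_slope m w u * (m u / total m)).
Proof.
move=> hm hw w0; have [B [gB ggB [_ gt1 gt2]]] := green_kernel_bounds.
have B0 := kernel_bound_ge0 gB.
set W := \I_(0, 1) (fun v => `|w v|).
have W0 : 0 <= W by apply: integral_ge0'.
have [sm _] := arc_prim hm.
pose q := (lambda ^+ 2)^-1.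
have q0 : 0 <= q by rewrite invr_ge0 sqr_ge0.
pose r u := arc m u + \I_(0, u) (fun v => `|w v|).
have sw := summable_norm hw.
have dr x y : 0 <= x -> x <= y -> y <= 1 ->
    r y - r x = (arc m y - arc m x) + \I_(x, y) (fun v => `|w v|).
  move=> x0 xy y1; rewrite /r (integral_addition x0 xy); first by ring.
  exact: summable_sub sw.
have V0 x y : 0 <= \I_(x, y) (fun v => `|w v|) by apply: integral_ge0'.
pose C := (B * W + 1) * q + (2 * (B * W) + B + 2 * q).
have BW0 : 0 <= B * W by rewrite mulr_ge0.
have Cq : 0 <= (B * W + 1) * q by rewrite mulr_ge0 // addr_ge0.
have C'0 : 0 <= 2 * (B * W) + B + 2 * q.
  by apply: addr_ge0; [apply: addr_ge0 => //|]; exact: mulr_ge0.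
apply: (@prim_of_quadratic _ _ _ _ r C) => //.
- exact: addr_ge0.
- have cI := continuous_primitive ler01 sw.
  have /prim_of_continuous cP : prim_of r (fun u => m u / total m + `|w u|).
    split; first exact: summableD.
    move=> x y x0 xy y1; rewrite dr // (arc_prim hm).2 // -integralD' //.
      exact: summable_sub sm.
    exact: summable_sub sw.
  exact: cP.
- move=> x y x0 xy y1; rewrite dr //.
  apply: le_trans (speed_arc_variation hm x0 xy y1) _; by rewrite lerDl.
- move=> x y x0 xy y1; rewrite dr //.
  have [x01 y01] : 0 <= x <= 1 /\ 0 <= y <= 1.
    by rewrite x0 y1 (le_trans x0 xy) (le_trans xy y1).
  have -> : smear_slope m w y - smear_slope m w x =
      q * ((smear gg m w y - smear gg m w x) - \I_(x, y) w).
    rewrite /smear_slope (integral_addition x0 xy); last exact: summable_sub hw.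
    by rewrite /q; move: (smear _ _ _ _) (smear gg m w x) => c1 c2; ring.
  rewrite normrM (ger0_norm q0).
  have h1 := smear_lipschitz ggB hm hw y01 x01; rewrite -/W in h1.
  have h2 : `|\I_(x, y) w| <= \I_(x, y) (fun v => `|w v|).
    by apply: integral_norm_le => //; [exact: summable_sub hw|exact: summable_sub sw].
  have d0 := arc_increment_ge0 hm x0 xy y1; rewrite (ger0_norm d0) in h1.
  have h3 : `|smear gg m w y - smear gg m w x - \I_(x, y) w| <=
      (B * W + 1) * (arc m y - arc m x + \I_(x, y) (fun v => `|w v|)).
    apply: le_trans (ler_normB _ _) _; apply: le_trans (lerD h1 h2) _.
    move: (V0 x y) d0; move: (\I_(x, y) (fun v => `|w v|)) (arc m y - arc m x) => V h V_ge0 h_ge0.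
    have -> : (B * W + 1) * (h + V) = B * h * W + V + (h + B * W * V) by ring.
    by rewrite lerDl addr_ge0 // mulr_ge0.
  apply: le_trans (ler_wpM2l q0 h3) _; rewrite mulrA (mulrC q).
  by apply: ler_wpM2r; [rewrite addr_ge0|rewrite /C lerDl].
move=> x y x0 xy y1; rewrite dr //.
have [x01 y01] : 0 <= x <= 1 /\ 0 <= y <= 1.
  by rewrite x0 y1 (le_trans x0 xy) (le_trans xy y1).
rewrite -((arc_prim hm).2 x y) //.
set h := arc m y - arc m x; set V := \I_(x, y) (fun v => `|w v|).
have hge0 : 0 <= h := arc_increment_ge0 hm x0 xy y1.
pose inc v := g (arc m v - arc m y) - g (arc m v - arc m x).
(* The slope of [green] is [- (gg + c) / lambda ^+ 2] with [c = 1/2] on the right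
   and [c = - 1/2] on the left of 0, and [phi c] is the error of the corresponding
   linearization.  On the increment itself it is only of first order. *)
pose phi c v := w v * (inc v - h * ((gg (arc m v - arc m x) + c) * q)).
have s1 := smear_summable gB hm hw y01; have s2 := smear_summable gB hm hw x01.
have s3 := smear_summable ggB hm hw x01.
have phiE c v : phi c v = (w v * g (arc m v - arc m y) - w v * g (arc m v - arc m x)) -
   ((h * q) * (w v * gg (arc m v - arc m x)) + (h * q * c) * w v).
  by rewrite /phi /inc; move: (gg _) (g _) (g (arc m v - arc m x)) => c1 c2 c3; ring.
have sphi c : summable_on 0 1 (phi c).
  have s12 := summableB s1 s2.
  have s4 := summableD (summableZ (h * q) s3) (summableZ (h * q * c) hw).
  by apply: eq_integrable (summableB s12 s4) => // v _ /=; rewrite phiE.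
have Iphi a b c : 0 <= a -> b <= 1 -> \I_(a, b) (phi c) =
    \I_(a, b) (phi 0) - h * q * c * \I_(a, b) w.
  move=> a0 b1; rewrite -integralZ'; last exact: summable_sub hw.
  rewrite -integralB'; [|exact: summable_sub (sphi 0)|].
    apply: eq_integral_on => v _; rewrite !phiE.
    by move: (gg _) (g _) (g (arc m v - arc m x)) => c1 c2 c3; ring.
  by apply: summableZ; exact: summable_sub hw.
have -> : smear g m w y - smear g m w x - smear_slope m w x * h =
    \I_(0, x) (phi (- 2^-1)) + \I_(x, y) (phi 2^-1) + \I_(y, 1) (phi 2^-1).
  have x1 := le_trans xy y1; have y0 := le_trans x0 xy.
  rewrite (Iphi 0 x (- 2^-1)) // (Iphi x y 2^-1) // (Iphi y 1 2^-1) //.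
  have e1 : \I_(0, 1) (phi 0) = \I_(0, x) (phi 0) + \I_(x, y) (phi 0) + \I_(y, 1) (phi 0).
    rewrite (integral_addition y0 y1) // (integral_addition x0 xy) //.
    exact: summable_sub (sphi 0).
  have e2 : \I_(0, x) w + \I_(x, y) w + \I_(y, 1) w = 0.
    rewrite -[RHS]w0 (integral_addition y0 y1 hw) [in RHS](integral_addition x0 xy) //.
    exact: summable_sub hw.
  have e3 : \I_(0, 1) (phi 0) = smear g m w y - smear g m w x - h * q * smear gg m w x.
    rewrite /smear -(integralZ' (h * q) s3) -(integralB' s1 s2).
    rewrite -(integralB' (summableB s1 s2) (summableZ _ s3)).
    apply: eq_integral_on => v _; rewrite phiE.
    by move: (gg _) (g _) (g (arc m v - arc m x)) => c1 c2 c3; ring.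
  have -> : smear_slope m w x = (smear gg m w x - \I_(0, x) w) * q by [].
  move: e1 e2; rewrite e3.
  set i1 := \I_(0, x) w; set i2 := \I_(x, y) w; set i3 := \I_(y, 1) w.
  set j1 := \I_(0, x) (phi 0); set j2 := \I_(x, y) (phi 0); set j3 := \I_(y, 1) (phi 0).
  move=> e1 e2; clearbody i1 i2 i3 j1 j2 j3.
  have e4 : h * q * i1 = 2^-1 * (h * q) * i1 - 2^-1 * (h * q) * i2 - 2^-1 * (h * q) * i3.
    have -> : i3 = - i1 - i2 by rewrite -[LHS]subr0 -e2; ring.
    by field.
  move: e1; move: (smear g m w y) (smear g m w x) (smear gg m w x) => c1 c2 c3 e1.
  have -> : c1 - c2 - (c3 - i1) * q * h = (c1 - c2 - h * q * c3) + h * q * i1 by ring.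
  rewrite e1 e4; ring.
have part a b c K : 0 <= a -> b <= 1 -> 
    (forall v, a <= v <= b -> `|inc v - h * ((gg (arc m v - arc m x) + c) * q)| <= K) ->
    `|\I_(a, b) (phi c)| <= K * \I_(a, b) (fun v => `|w v|).
  move=> a0 b1 HK; rewrite -integralZ'; last exact: summable_sub sw.
  apply: integral_norm_le; first exact: summable_sub (sphi c).
    by apply: summableZ; exact: summable_sub sw.
  by move=> v vab; rewrite normrM mulrC; apply: ler_wpM2r => //; exact: HK.
have step v c : inc v - h * ((gg (arc m v - arc m x) + c) * q) =
   g (arc m v - arc m y) - g (arc m v - arc m x) +
   ((arc m v - arc m y) - (arc m v - arc m x)) * ((gg (arc m v - arc m x) + c) / lambda ^+ 2).
  by rewrite /inc /h -/q; move: (gg _) (g _) (g (arc m v - arc m x)) => c1 c2 c3; ring.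
have hh v : (arc m v - arc m y - (arc m v - arc m x)) ^+ 2 = h ^+ 2 by rewrite /h; ring.
have b1 : `|\I_(0, x) (phi (- 2^-1))| <= B * h ^+ 2 * W.
  apply: le_trans (part _ _ _ (B * h ^+ 2) _ _ _) _ => //; first exact: le_trans y1.
    move=> v /andP[v0 vx]; rewrite step -(hh v).
    have v01 : 0 <= v <= 1 by rewrite v0 (le_trans vx (le_trans xy y1)).
    have i1 := arcB_itv hm v01 x01; have i2 := arcB_itv hm v01 y01.
    have d1 := arc_increment_ge0 hm v0 vx (le_trans xy y1).
    have d2 := arc_increment_ge0 hm v0 (le_trans vx xy) y1.
    by apply: gt2; [exact: nonpos_half i1 d1|exact: nonpos_half i2 d2].
  apply: ler_wpM2l; first by rewrite mulr_ge0 // sqr_ge0.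
  by apply: integral_mono => //; exact: le_trans y1.
have b3 : `|\I_(y, 1) (phi 2^-1)| <= B * h ^+ 2 * W.
  apply: le_trans (part _ _ _ (B * h ^+ 2) _ _ _) _ => //; first exact: le_trans xy.
    move=> v /andP[yv v1]; rewrite step -(hh v).
    have v01 : 0 <= v <= 1 by rewrite v1 (le_trans x0 (le_trans xy yv)).
    have i1 := arcB_itv hm v01 x01; have i2 := arcB_itv hm v01 y01.
    have d1 := arc_increment_ge0 hm x0 (le_trans xy yv) v1.
    have d2 := arc_increment_ge0 hm (le_trans x0 xy) yv v1.
    by apply: gt1; [exact: nonneg_half i1 d1|exact: nonneg_half i2 d2].
  apply: ler_wpM2l; first by rewrite mulr_ge0 // sqr_ge0.
  by apply: integral_mono => //; exact: le_trans xy.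
have b2 : `|\I_(x, y) (phi 2^-1)| <= (B * h + 2 * q * h) * V.
  apply: part => // v /andP[xv vy].
  have v01 : 0 <= v <= 1 by rewrite (le_trans x0 xv) (le_trans vy y1).
  apply: le_trans (ler_normB _ _) _; apply: lerD.
    apply: le_trans (gB.2 _ _ _ _) _; try exact: arcB_itv.
    apply: ler_wpM2l => //.
    have -> : arc m v - arc m y - (arc m v - arc m x) = - h by rewrite /h; ring.
    by rewrite normrN ger0_norm.
  rewrite normrM (ger0_norm hge0) normrM (ger0_norm q0) mulrC.
  apply: ler_wpM2r => //; rewrite mulrC [leRHS]mulrC; apply: ler_wpM2l => //.
  apply: le_trans (ler_normD _ _) _.
  have half : `|2^-1 : R| <= 2^-1 by rewrite ger0_norm.
  apply: le_trans (lerD (green_primitive_norm lambda0 (arcB_itv hm v01 x01)) half) _.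
  by rewrite [leRHS]mulr2n lerD2l invf_le1 ?ler1n.
apply: le_trans (ler_normD _ _) _; apply: le_trans (lerD (ler_normD _ _) b3) _.
apply: le_trans (lerD (lerD b1 b2) (lexx _)) _.
exact: increment_algebra B0 BW0 q0 hge0 (V0 x y).
Qed.

(** Used with [n] the speed: where the speed vanishes, so do [w1] and [w2]. *)
Lemma weighted_young (n a w1 w2 p1 p2 : R) : 0 <= n -> w1 ^+ 2 + w2 ^+ 2 <= n ^+ 2 ->
  2 * a * (w1 * p1 + w2 * p2) <= n * (a ^+ 2 + (p1 ^+ 2 + p2 ^+ 2)).
Proof.
move=> n0 wn; have [n_eq0|n_neq0] := eqVneq n 0.
  have s1 := sqr_ge0 w1; have s2 := sqr_ge0 w2.
  move: wn; rewrite n_eq0 expr0n /= => wn.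
  have /eqP : w1 ^+ 2 = 0 by lra.
  have /eqP : w2 ^+ 2 = 0 by lra.
  by rewrite !sqrf_eq0 => /eqP -> /eqP ->; rewrite !mul0r addr0 mulr0.
have {n_neq0}n0 : 0 < n by rewrite lt_neqAle eq_sym n_neq0.
rewrite -(ler_pM2l n0).
have := sqr_ge0 (n * p1 - a * w1); have := sqr_ge0 (n * p2 - a * w2).
have := ler_wpM2l (sqr_ge0 a) wn.
have -> : (n * p1 - a * w1) ^+ 2 = n ^+ 2 * p1 ^+ 2 - 2 * a * n * (w1 * p1) + a ^+ 2 * w1 ^+ 2 by ring.
have -> : (n * p2 - a * w2) ^+ 2 = n ^+ 2 * p2 ^+ 2 - 2 * a * n * (w2 * p2) + a ^+ 2 * w2 ^+ 2 by ring.
lra.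
Qed.

#[local] Opaque smear Rintegral.

Section spectral_gap.
Variables (m : R -> R) (hm : is_speed m).
Local Notation M := (total m).
Local Notation p w := (smear g m w).
Local Notation S w := (smear_slope m w).

Let wt_summable (f : R -> R) : {within `[0, 1], continuous f} ->
  summable_on 0 1 (fun v => f v * (m v / M)).
Proof.
move=> cf; have [sm _] := arc_prim hm.
have [C _ bf] : exists2 C, True & forall t, 0 <= t <= 1 -> `|f t| <= C.
  have cn : {within `[0, 1], continuous (fun t => `|f t|)}.
    move=> x; apply: continuous_comp; [exact: cf|exact: norm_continuous].
  have [c _ Hc] := EVT_max ler01 cn.
  by exists `|f c| => // t t01; apply: Hc; rewrite in_itv.
have := summable_mul_bounded sm (continuous_measurable cf) bf.
by apply: eq_integrable => // v _ /=; rewrite mulrC.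
Qed.

Let cp w : summable_on 0 1 w -> {within `[0, 1], continuous (p w)}.
Proof.
by move=> hw; have [B [gB _ _]] := green_kernel_bounds; exact: smear_continuous gB hm hw.
Qed.

Let cS w : summable_on 0 1 w -> {within `[0, 1], continuous (S w)}.
Proof. by move=> hw; exact: prim_of_continuous (smear_slope_prim hm hw). Qed.

Let within_mul (f h : R -> R) : {within `[0, 1], continuous f} ->
  {within `[0, 1], continuous h} -> {within `[0, 1], continuous (fun v => f v * h v)}.
Proof. by move=> cf ch x; apply: cvgM; [exact: cf|exact: ch]. Qed.

Let wp_summable w : summable_on 0 1 w -> summable_on 0 1 (fun v => w v * p w v).
Proof.
move=> hw; have [B [gB _ _]] := green_kernel_bounds.
apply: (summable_mul_bounded hw (continuous_measurable (cp hw))) => t t01.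
exact: smear_norm gB hm hw t01.
Qed.

(** In the arclength parameter [w = p - lambda^2 S'] and [p' = S], where [p] is the
    convolution; multiply by [p] and integrate by parts over the closed curve. *)
Lemma smear_energy w : summable_on 0 1 w -> \I_(0, 1) w = 0 ->
  \I_(0, 1) (fun v => w v * p w v) =
    \I_(0, 1) (fun v => (p w v * p w v) * (m v / M)) +
    lambda ^+ 2 * \I_(0, 1) (fun v => (S w v * S w v) * (m v / M)).
Proof.
move=> hw w0; have l0 : lambda != 0 by rewrite gt_eqF.
have [_ /(_ 0 1 (lexx 0) ler01 (lexx 1))] :=
  prim_of_mul (smear_green_prim hm hw w0) (smear_slope_prim hm hw).
have -> : S w 1 = S w 0.
  by rewrite /smear_slope smear_primitive_period // w0 integral_point addr0.
rewrite smear_green_periodic // subrr => e0.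
have sp := wt_summable (within_mul (cp hw) (cp hw)).
have sS := wt_summable (within_mul (cS hw) (cS hw)).
have swp := wp_summable hw.
set iS := \I_(0, 1) (fun v => (S w v * S w v) * (m v / M)).
set ip := \I_(0, 1) (fun v => (p w v * p w v) * (m v / M)).
set iw := \I_(0, 1) (fun v => w v * p w v).
have : iS + (lambda ^+ 2)^-1 * (ip - iw) = 0.
  rewrite e0 /iS /ip /iw -(integralB' sp swp) -(integralZ' _ (summableB sp swp)).
  rewrite -(integralD' sS (summableZ _ (summableB sp swp))).
  by apply: eq_integral_on => v _; move: (p w v) (S w v) => c1 c2; ring.
clearbody iS ip iw => e1; have : lambda ^+ 2 * (iS + (lambda ^+ 2)^-1 * (ip - iw)) = 0.
  by rewrite e1 mulr0.
have -> : lambda ^+ 2 * (iS + (lambda ^+ 2)^-1 * (ip - iw)) = lambda ^+ 2 * iS + ip - iw.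
  by field.
by move=> /eqP; rewrite subr_eq0 => /eqP <-; rewrite addrC.
Qed.

(** Poincare inequality on the circle of length 1, with the constant obtained by
    comparing the two arcs between two points. *)
Lemma smear_poincare w : summable_on 0 1 w -> \I_(0, 1) w = 0 ->
  4 * \I_(0, 1) (fun v => (p w v * p w v) * (m v / M)) <=
    \I_(0, 1) (fun v => (S w v * S w v) * (m v / M)).
Proof.
move=> hw w0; have [sm m0 M0] := hm; have [ss tot] := arc_prim hm.
have one : \I_(0, 1) (fun v => m v / M) = 1 by rewrite -tot // arc1 // arc0 subr0.
have s0 v : 0 <= v <= 1 -> 0 <= m v / M by move=> v01; rewrite divr_ge0 ?m0 // ltW.
have cA : {within `[0, 1], continuous (fun v => `|S w v|)}.
  by move=> x; apply: continuous_comp; [exact: cS|exact: norm_continuous].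
have sA := wt_summable cA.
have [sp pp] := smear_green_prim hm hw w0.
set b := \I_(0, 1) (fun v => `|S w v| * (m v / M)).
(* Two points split the circle into two arcs, and along one of them the
   variation is at most half of the total variation [b]. *)
have arcs x y : 0 <= x -> x <= y -> y <= 1 -> `|p w y - p w x| <= b / 2.
  move=> x0 xy y1; have x1 := le_trans xy y1; have y0 := le_trans x0 xy.
  have inc x' y' : 0 <= x' -> x' <= y' -> y' <= 1 ->
      `|p w y' - p w x'| <= \I_(x', y') (fun v => `|S w v| * (m v / M)).
    move=> x'0 xy' y'1; rewrite pp //; apply: integral_norm_le.
    - exact: summable_sub sp.
    - exact: summable_sub sA.
    move=> v /andP[xv vy]; rewrite normrM [X in _ * X]ger0_norm // s0 //.
    by rewrite (le_trans x'0 xv) (le_trans vy y'1).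
  have := inc _ _ x0 xy y1; have := inc _ _ (lexx 0) x0 x1; have := inc _ _ y0 y1 (lexx 1).
  have : b = \I_(0, x) (fun v => `|S w v| * (m v / M)) +
     \I_(x, y) (fun v => `|S w v| * (m v / M)) + \I_(y, 1) (fun v => `|S w v| * (m v / M)).
    rewrite /b (integral_addition y0 y1 sA) [in LHS](integral_addition x0 xy) //.
    exact: summable_sub sA.
  rewrite smear_green_periodic //.
  set i1 := \I_(0, x) (fun v => `|S w v| * (m v / M)).
  set i2 := \I_(x, y) (fun v => `|S w v| * (m v / M)).
  set i3 := \I_(y, 1) (fun v => `|S w v| * (m v / M)).
  move: i1 i2 i3 => i1 i2 i3.
  move: (p w 0) (p w x) (p w y) b => c0 cx cy b'.
  clear; rewrite !ler_norml => e /andP[? ?] /andP[? ?] /andP[? ?].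
  by apply/andP; split; lra.
(* [p w] has mean zero, so its size is at most its oscillation. *)
have sup y : 0 <= y <= 1 -> `|p w y| <= b / 2.
  move=> /[dup] y01 /andP[y0 y1].
  have cc : {within `[0, 1], continuous (fun v => p w y - p w v)}.
    by move=> x; apply: cvgB; [exact: cvg_cst|exact: cp].
  have -> : p w y = \I_(0, 1) (fun v => (p w y - p w v) * (m v / M)).
    transitivity (p w y * \I_(0, 1) (fun v => m v / M) -
        \I_(0, 1) (fun v => p w v * (m v / M))).
      have t0 := smear_green_total hm hw.
      by rewrite t0 one w0 mulr1 subr0.
    rewrite [X in X - _](esym (integralZ' (p w y) ss)).
    apply: etrans (esym (integralB' (summableZ (p w y) ss) (wt_summable (cp hw)))) _.
    by apply: eq_integral_on => v _; rewrite mulrBl.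
  have eb : b / 2 = \I_(0, 1) (fun v => b / 2 * (m v / M)).
    by rewrite (integralZ' (b / 2) ss) one mulr1.
  rewrite [leRHS]eb.
  apply: integral_norm_le; [exact: wt_summable|exact: summableZ|].
  move=> v /[dup] v01 /andP[v_0 v_1]; rewrite normrM (ger0_norm (s0 _ v01)).
  apply: ler_wpM2r; first exact: s0.
  have [vy|/ltW yv] := leP v y; first exact: arcs.
  by rewrite distrC; exact: arcs.
have b0 : 0 <= b by apply: integral_ge0' => v v01; rewrite mulr_ge0 // s0.
have scc : summable_on 0 1 (fun v => (S w v * S w v) * (m v / M)).
  exact: wt_summable (within_mul (cS hw) (cS hw)).
have cs : b ^+ 2 <= \I_(0, 1) (fun v => (S w v * S w v) * (m v / M)).
  have h2b := summableZ (2 * b) sA.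
  have : 0 <= \I_(0, 1) (fun v => (`|S w v| - b) ^+ 2 * (m v / M)).
    by apply: integral_ge0' => v v01; rewrite mulr_ge0 ?sqr_ge0 // s0.
  have -> : \I_(0, 1) (fun v => (`|S w v| - b) ^+ 2 * (m v / M)) =
     \I_(0, 1) (fun v => (S w v * S w v) * (m v / M)) - 2 * b * b +
      b ^+ 2 * \I_(0, 1) (fun v => m v / M).
    rewrite {3}/b -(integralZ' (b ^+ 2) ss) -(integralZ' (2 * b) sA) -(integralB' scc h2b).
    rewrite -(integralD' (summableB scc h2b) (summableZ (b ^+ 2) ss)).
    apply: eq_integral_on => v _; have -> : S w v * S w v = `|S w v| ^+ 2.
      by rewrite real_normK ?num_real.
    by move: `|S w v| => c; ring.
  by rewrite one; move: (\I_(0, 1) (fun v => S w v * S w v * (m v / M))) => i; clearbody b; lra.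
apply: le_trans cs.
have -> : b ^+ 2 = 4 * ((b / 2) ^+ 2 * 1) by field.
rewrite ler_pM2l //.
have -> : (b / 2) ^+ 2 * 1 = \I_(0, 1) (fun v => (b / 2) ^+ 2 * (m v / M)).
  by rewrite (integralZ' ((b / 2) ^+ 2) ss) one.
apply: integral_le; [exact: wt_summable (within_mul (cp hw) (cp hw))|exact: summableZ|].
move=> v v01; apply: ler_wpM2r; first exact: s0.
rewrite -expr2 -(real_normK (num_real (p w v))); apply: lerXn2r.
- by rewrite nnegrE.
- by rewrite nnegrE divr_ge0.
- exact: sup.
Qed.

(** The spectral gap that makes the length decay: the smoothed unit tangent of a
    closed planar curve correlates with the unit tangent at most by
    [1 / (1 + 4 lambda^2)]. *)
Lemma smear_correlation w1 w2 : summable_on 0 1 w1 -> summable_on 0 1 w2 ->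
  \I_(0, 1) w1 = 0 -> \I_(0, 1) w2 = 0 ->
  (forall v, 0 <= v <= 1 -> w1 v ^+ 2 + w2 v ^+ 2 <= m v ^+ 2) ->
  (1 + 4 * lambda ^+ 2) *
    (\I_(0, 1) (fun v => w1 v * p w1 v) + \I_(0, 1) (fun v => w2 v * p w2 v)) <= M ^+ 2.
Proof.
move=> h1 h2 w10 w20 wm; have [sm m0 M0] := hm; have [ss tot] := arc_prim hm.
have one : \I_(0, 1) (fun v => m v / M) = 1 by rewrite -tot // arc1 // arc0 subr0.
have e1 := smear_energy h1 w10; have e2 := smear_energy h2 w20.
have P1 := smear_poincare h1 w10; have P2 := smear_poincare h2 w20.
have sp1 := wt_summable (within_mul (cp h1) (cp h1)).
have sp2 := wt_summable (within_mul (cp h2) (cp h2)).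
have swp1 := wp_summable h1; have swp2 := wp_summable h2.
set A1 := \I_(0, 1) (fun v => w1 v * p w1 v) in e1 *.
set A2 := \I_(0, 1) (fun v => w2 v * p w2 v) in e2 *.
set B1 := \I_(0, 1) (fun v => (p w1 v * p w1 v) * (m v / M)) in e1 P1.
set B2 := \I_(0, 1) (fun v => (p w2 v * p w2 v) * (m v / M)) in e2 P2.
(* A Cauchy-Schwarz inequality with the speed as weight, where this choice of
   the constant [a] is optimal. *)
pose a := (A1 + A2) / M.
have young : 2 * (a / M) * (A1 + A2) <= a ^+ 2 + (B1 + B2).
  have a2E : a ^+ 2 = \I_(0, 1) (fun v => a ^+ 2 * (m v / M)).
    by rewrite (integralZ' _ ss) one mulr1.
  rewrite [X in _ <= X + _]a2E -(integralD' sp1 sp2).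
  rewrite -(integralD' (summableZ (a ^+ 2) ss) (summableD sp1 sp2)) -(integralD' swp1 swp2).
  rewrite -(integralZ' _ (summableD swp1 swp2)).
  apply: integral_le; [exact/summableZ/summableD| |].
    by apply: summableD; [exact: summableZ|exact: summableD].
  move=> v v01; have := weighted_young a (p w1 v) (p w2 v) (m0 v v01) (wm v v01).
  move: (p w1 v) (p w2 v) => c1 c2 h.
  have -> : 2 * (a / M) * (w1 v * c1 + w2 v * c2) =
    2 * a * (w1 v * c1 + w2 v * c2) * M^-1 by ring.
  have -> : a ^+ 2 * (m v / M) + (c1 * c1 * (m v / M) + c2 * c2 * (m v / M)) =
    m v * (a ^+ 2 + (c1 ^+ 2 + c2 ^+ 2)) * M^-1 by ring.
  by rewrite ler_pM2r // invr_gt0.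
have aM : A1 + A2 = a * M by rewrite /a mulfVK // gt_eqF.
have a2B : a ^+ 2 <= B1 + B2.
  move: young; rewrite aM; have -> : 2 * (a / M) * (a * M) = 2 * a ^+ 2.
    by field; rewrite gt_eqF.
  by rewrite mulr_natl mulr2n lerD2l.
have l2 : 0 <= lambda ^+ 2 by exact: sqr_ge0.
have gap : (1 + 4 * lambda ^+ 2) * (B1 + B2) <= a * M.
  rewrite -aM e1 e2.
  have -> : (1 + 4 * lambda ^+ 2) * (B1 + B2) =
    (B1 + lambda ^+ 2 * (4 * B1)) + (B2 + lambda ^+ 2 * (4 * B2)) by ring.
  exact: lerD (lerD (lexx B1) (ler_wpM2l l2 P1)) (lerD (lexx B2) (ler_wpM2l l2 P2)).
have c0 : 0 < 1 + 4 * lambda ^+ 2 by rewrite ltr_pwDl // mulr_ge0.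
have gap2 := le_trans (ler_wpM2l (ltW c0) a2B) gap.
rewrite aM; have [a0|a0] := leP a 0.
  apply: (@le_trans _ _ 0); last exact: sqr_ge0.
  by rewrite pmulr_rle0 // mulr_le0_ge0 // ltW.
rewrite mulrA expr2; apply: ler_wpM2r; first exact: ltW.
by move: gap2; rewrite expr2 mulrCA ler_pM2l.
Qed.

End spectral_gap.

End green_convolution.

(** * The Euclidean plane *)

Section euclidean_plane.
Context {R : realType}.
Implicit Types (x y z : 'rV[R]_2) (w : R -> 'rV[R]_2).

Definition dot x y : R := x 0 ord0 * y 0 ord0 + x 0 ord_max * y 0 ord_max.

Lemma ord2P (P : 'I_2 -> Prop) : P ord0 -> P ord_max -> forall i, P i.
Proof.
by move=> p0 p1 [[|[|//]] h]; [rewrite (_ : Ordinal h = ord0)|rewrite (_ : Ordinal h = ord_max)];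
  rewrite //; exact: val_inj.
Qed.

Lemma row2P x y : x 0 ord0 = y 0 ord0 -> x 0 ord_max = y 0 ord_max -> x = y.
Proof. by move=> e0 e1; apply/rowP; exact: ord2P. Qed.

Lemma enorm_sqrtE x : enorm x = Num.sqrt (dot x x).
Proof.
rewrite /enorm !big_ord_recl big_ord0 addr0 /dot -!expr2; congr (Num.sqrt (_ + _ ^+ 2)).
by congr (x _ _); exact: val_inj.
Qed.

Lemma dotxx_ge0 x : 0 <= dot x x.
Proof. by rewrite /dot -!expr2 addr_ge0 // sqr_ge0. Qed.

Lemma sqr_enorm x : enorm x ^+ 2 = dot x x.
Proof. by rewrite enorm_sqrtE sqr_sqrtr // dotxx_ge0. Qed.

Lemma enorm_ge0 x : 0 <= enorm x.
Proof. exact: sqrtr_ge0. Qed.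

Lemma enorm0 : enorm (0 : 'rV[R]_2) = 0.
Proof. by rewrite enorm_sqrtE /dot !mxE !mul0r addr0 sqrtr0. Qed.

Lemma cauchy_schwarz x y : `|dot x y| <= enorm x * enorm y.
Proof.
rewrite -ler_sqr ?nnegrE ?mulr_ge0 ?enorm_ge0 // exprMn !sqr_enorm.
rewrite real_normK ?num_real //.
have := sqr_ge0 (x 0 ord0 * y 0 ord_max - x 0 ord_max * y 0 ord0); rewrite /dot.
move: (x 0 ord0) (x 0 ord_max) (y 0 ord0) (y 0 ord_max) => a b c d; nra.
Qed.

Lemma enormD x y : enorm (x + y) <= enorm x + enorm y.
Proof.
rewrite -ler_sqr ?nnegrE ?addr_ge0 ?enorm_ge0 // sqrrD !sqr_enorm.
have := le_trans (ler_norm _) (cauchy_schwarz x y).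
by rewrite /dot !mxE; lra.
Qed.

Lemma enormZ (c : R) x : enorm (c *: x) = `|c| * enorm x.
Proof.
rewrite !enorm_sqrtE; have -> : dot (c *: x) (c *: x) = c ^+ 2 * dot x x.
  by rewrite /dot !mxE; ring.
by rewrite sqrtrM ?sqr_ge0 // sqrtr_sqr.
Qed.

Lemma enormN x : enorm (- x) = enorm x.
Proof. by rewrite -scaleN1r enormZ normrN1 mul1r. Qed.

Lemma enormB x y : enorm (x - y) <= enorm x + enorm y.
Proof. by apply: le_trans (enormD _ _) _; rewrite enormN. Qed.

Lemma enorm_distC x y : enorm (x - y) = enorm (y - x).
Proof. by rewrite -enormN opprB. Qed.

Lemma enorm_dist x y : `|enorm x - enorm y| <= enorm (x - y).
Proof.
have := enormD (x - y) y; have := enormD (y - x) x; rewrite !subrK enorm_distC.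
by move=> h1 h2; rewrite ler_norml; apply/andP; split; lra.
Qed.

Lemma enorm_coord x i : `|x 0 i| <= enorm x.
Proof.
rewrite -ler_sqr ?nnegrE ?enorm_ge0 // real_normK ?num_real // sqr_enorm /dot.
have := sqr_ge0 (x 0 ord0); have := sqr_ge0 (x 0 ord_max).
by move: i; apply: ord2P; rewrite !expr2; lra.
Qed.

Lemma enorm_le_sum x : enorm x <= `|x 0 ord0| + `|x 0 ord_max|.
Proof.
rewrite -ler_sqr ?nnegrE ?enorm_ge0 ?addr_ge0 // sqr_enorm /dot sqrrD.
rewrite !real_normK ?num_real // -!expr2.
by have := mulr_ge0 (normr_ge0 (x 0 ord0)) (normr_ge0 (x 0 ord_max)); lra.
Qed.

Lemma enorm_le c x : (forall i, `|x 0 i| <= c) -> enorm x <= 2 * c.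
Proof.
move=> h; apply: le_trans (enorm_le_sum x) _; have := h ord0; have := h ord_max; lra.
Qed.

Lemma enorm_eq0 x : enorm x = 0 -> x = 0.
Proof.
move=> e; apply: row2P; rewrite mxE; apply/eqP; rewrite -normr_eq0 eq_le normr_ge0 andbT -e;
  exact: enorm_coord.
Qed.

Lemma entryB (x y : 'rV[R]_2) i : (x - y) 0 i = x 0 i - y 0 i.
Proof. by rewrite !mxE. Qed.

Lemma entryZ (c : R) (x : 'rV[R]_2) i : (c *: x) 0 i = c * x 0 i.
Proof. by rewrite mxE. Qed.

Definition vsummable w := forall i, summable_on 0 1 (fun u => w u 0 i).
Definition vintegral (a b : R) w : 'rV[R]_2 := \row_i \I_(a, b) (fun u => w u 0 i).

Lemma measurable_enorm w : (forall i, measurable_fun (`[0, 1] : set R) (fun u => w u 0 i)) ->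
  measurable_fun (`[0, 1] : set R) (fun u => enorm (w u)).
Proof.
move=> mw; have -> : (fun u => enorm (w u)) = Num.sqrt \o (fun u => dot (w u) (w u)).
  by apply/funext => u /=; rewrite enorm_sqrtE.
apply: measurableT_comp.
  exact: continuous_measurable_fun (@sqrt_continuous R).
by apply: measurable_funD; apply: measurable_funM.
Qed.

Lemma vsummable_enorm w : vsummable w -> summable_on 0 1 (fun u => enorm (w u)).
Proof.
move=> hw; apply: (summable_le (g := fun u => `|w u 0 ord0| + `|w u 0 ord_max|)).
- by apply: measurable_enorm => i; exact: summable_measurable.
- by move=> u _; rewrite ger0_norm ?enorm_ge0 // enorm_le_sum.
- by apply: summableD; exact: summable_norm.
Qed.

Lemma vsummableD w w' : vsummable w -> vsummable w' -> vsummable (fun u => w u + w' u).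
Proof.
move=> hw hw' i; apply: eq_integrable (summableD (hw i) (hw' i)) => // u _ /=.
by rewrite mxE.
Qed.

Lemma vsummableZ c w : vsummable w -> vsummable (fun u => c *: w u).
Proof.
move=> hw i; apply: eq_integrable (summableZ c (hw i)) => // u _ /=; by rewrite mxE.
Qed.

Lemma vsummableB w w' : vsummable w -> vsummable w' -> vsummable (fun u => w u - w' u).
Proof.
move=> hw hw' i; apply: eq_integrable (summableB (hw i) (hw' i)) => // u _ /=.
by rewrite !mxE.
Qed.

(** The dot product with the integral itself turns the left-hand side into a
    scalar integral, to which the Cauchy-Schwarz inequality applies. *)
Lemma enorm_vintegral w (h : R -> R) a b : 0 <= a -> b <= 1 -> vsummable w ->
  summable_on 0 1 h -> (forall u, a <= u <= b -> enorm (w u) <= h u) ->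
  enorm (vintegral a b w) <= \I_(a, b) h.
Proof.
move=> a0 b1 hw hh wh; set V := vintegral a b w.
have V0 := enorm_ge0 V.
have hwi i : summable_on a b (fun u => w u 0 i) by exact: summable_sub (hw i).
have h' : summable_on a b h by exact: summable_sub hh.
have [/eqP e|ne] := eqVneq (enorm V) 0.
  by rewrite (eqP e); apply: integral_ge0' => u /wh; apply: le_trans; exact: enorm_ge0.
have Vp : 0 < enorm V by rewrite lt_neqAle eq_sym ne.
rewrite -(ler_pM2l Vp) -expr2 sqr_enorm.
have -> : dot V V = V 0 ord0 * \I_(a, b) (fun u => w u 0 ord0) +
    V 0 ord_max * \I_(a, b) (fun u => w u 0 ord_max) by rewrite /dot !mxE.
rewrite -(integralZ' (V 0 ord0) (hwi ord0)) -(integralZ' (V 0 ord_max) (hwi ord_max)).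
rewrite -(integralZ' (enorm V) h').
rewrite -(integralD' (summableZ (V 0 ord0) (hwi ord0)) (summableZ (V 0 ord_max) (hwi ord_max))).
apply: integral_le; first by apply: summableD; exact: summableZ.
  exact: summableZ.
move=> u /wh wu; apply: le_trans (ler_norm _) _; apply: le_trans (cauchy_schwarz V (w u)) _.
exact: ler_wpM2l.
Qed.

End euclidean_plane.

(** * Periodic functions and test functions *)

Section calculus_complements.
Context {R : realType}.
Implicit Types (f h phi : R -> R).

Lemma is_derive_eps f x l :
  (forall e, 0 < e -> exists2 d, 0 < d & forall y : R, `|y - x| < d ->
    `|f y - f x - (y - x) * l| <= e * `|y - x|) -> is_derive x 1 f l.
Proof.
move=> H; have c : (fun r : R => r^-1 *: (f (r *: (1 : R) + x) - f x)) @ (0 : R)^' --> l.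
  apply/cvgrPdist_le => e e0; have [d d0 Hd] := H e e0.
  exists d => //= h; rewrite /ball /= sub0r normrN => hd h0.
  have /Hd : `|h + x - x| < d by rewrite addrK.
  rewrite addrK /GRing.scale /= mulr1 distrC => h1.
  have -> : l - h^-1 * (f (h + x) - f x) = h^-1 * (h * l - (f (h + x) - f x)) by field.
  by rewrite normrM normfV ler_pdivrMl ?normr_gt0 // [leRHS]mulrC.
apply: DeriveDef; first by apply/cvg_ex; exists l.
by apply: cvg_lim c.
Qed.

Lemma continuous_prim_of phi : (forall x, derivable phi x 1) ->
  continuous (derive1 phi) -> prim_of phi (derive1 phi).
Proof.
move=> dphi cphi; have cw a b : {within `[a, b], continuous (derive1 phi)}.
  exact: continuous_subspaceT.
split; first exact: continuous_summable (cw 0 1).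
move=> x y _; rewrite le_eqVlt => /predU1P[->|xy] _; first by rewrite integral_point subrr.
have cphi' : continuous phi.
  by move=> z; apply: differentiable_continuous; apply/derivable1_diffP; exact: dphi.
have lr : derivable_oo_LRcontinuous phi x y.
  split; first by move=> z _; exact: dphi.
  - by apply: cvg_at_right_filter; exact: cphi'.
  - by apply: cvg_at_left_filter; exact: cphi'.
have same : {in `]x, y[, derive1 phi =1 derive1 phi} by [].
by rewrite /Rintegral (continuous_FTC2 xy (cw x y) lr same).
Qed.

Lemma continuous_ge0_integral_eq0 f : {within `[0, 1], continuous f} ->
  (forall t, 0 <= t <= 1 -> 0 <= f t) -> \I_(0, 1) f = 0 ->
  forall t, 0 <= t <= 1 -> f t = 0.
Proof.
move=> cf f0 i0 t t01; apply/eqP; rewrite eq_le f0 // andbT leNgt; apply/negP => ft.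
have ft2 : 0 < f t / 2 by rewrite divr_gt0.
have [d d0 Hd] := within_continuous_eps cf t01 ft2.
case/andP: (t01) => t0 t1.
pose a := Num.max 0 (t - d / 2); pose b := Num.min 1 (t + d / 2).
have a0 : 0 <= a by rewrite le_max lexx.
have b1 : b <= 1 by rewrite ge_min lexx.
have d2 : 0 < d / 2 by rewrite divr_gt0.
have ab : a < b.
  rewrite /a /b gt_max !lt_min ltr01 /=; apply/and3P; split; lra.
have sf := continuous_summable cf.
have : \I_(a, b) f <= \I_(0, 1) f by apply: integral_mono => //; exact: ltW.
rewrite i0 leNgt => /negP; apply.
apply: (@lt_le_trans _ _ (f t / 2 * (b - a))); first by rewrite mulr_gt0 // subr_gt0.
rewrite -integral_cst' ?(ltW ab) //; apply: integral_le.
- exact: summable_cst.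
- exact: summable_sub sf.
move=> s /andP[as_ sb]; have : `|f s - f t| < f t / 2.
  apply: Hd; first by rewrite (le_trans a0 as_) (le_trans sb b1).
  have : t - d / 2 <= a by rewrite le_max lexx orbT.
  have : b <= t + d / 2 by rewrite ge_min lexx orbT.
  by move=> ? ?; rewrite ltr_norml; apply/andP; split; lra.
by rewrite ltr_norml => /andP[]; lra.
Qed.

Lemma frac_part_itv (u : R) : 0 <= frac_part u < 1.
Proof.
rewrite /frac_part; have /andP[h1 h2] := floor_itv u.
by rewrite intrD in h2; apply/andP; split; lra.
Qed.

Lemma frac_part_le (u : R) : 0 <= frac_part u <= 1.
Proof. by have /andP[-> /ltW ->] := frac_part_itv u. Qed.

Lemma frac_partE (u : R) (n : int) : n%:~R <= u < n%:~R + 1 -> frac_part u = u - n%:~R.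
Proof.
by move=> un; rewrite /frac_part; congr (_ - _%:~R); apply: floor_def; rewrite intrD.
Qed.

Lemma frac_part_id (u : R) : 0 <= u < 1 -> frac_part u = u.
Proof. by move=> u01; rewrite (@frac_partE u 0) ?subr0 // add0r. Qed.

Lemma frac_part0 : frac_part (0 : R) = 0.
Proof. by rewrite frac_part_id // lexx ltr01. Qed.

Lemma frac_part1 : frac_part (1 : R) = 0.
Proof. by rewrite (@frac_partE 1 1) ?subrr //; apply/andP; split; lra. Qed.

Lemma frac_part_periodic : periodic (@frac_part R) 1.
Proof.
move=> u; have /andP[h1 h2] := floor_itv u; rewrite intrD in h2.
rewrite (@frac_partE (u + 1) (Num.floor u + 1)).
  by rewrite /frac_part intrD; ring.
by rewrite intrD; apply/andP; split; lra.
Qed.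

Lemma periodic_frac_part (V : zmodType) (f : R -> V) u : periodic f 1 -> f (frac_part u) = f u.
Proof.
move=> pf; have nat_shift (n : nat) x : f (x + n%:R) = f x.
  elim: n x => [|n IH] x; first by rewrite addr0.
  by rewrite -natr1 addrA pf IH.
rewrite /frac_part; case: (Num.floor u) => n.
  by rewrite -{2}(subrK (n%:R : R) u) nat_shift.
by rewrite NegzE mulrNz opprK nat_shift.
Qed.

Lemma periodic_extension_continuous h : {within `[0, 1], continuous h} -> h 0 = h 1 ->
  continuous (fun u => h (frac_part u)).
Proof.
move=> ch h01; suff H (u : R) : {for u, continuous (fun u => h (frac_part u))} by exact: H.
pose hf := fun u => h (frac_part u).
have piece (n : int) : {within `[n%:~R, n%:~R + 1], continuous hf}.
  have hfE s : n%:~R <= s <= n%:~R + 1 -> hf s = h (s - n%:~R).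
    move=> /andP[ns sn]; have [sn'|ns'] := ltP s (n%:~R + 1).
      by rewrite /hf (@frac_partE s n) // ns.
    have -> : s = n%:~R + 1 by apply/eqP; rewrite eq_le sn ns'.
    rewrite /hf (@frac_partE _ (n + 1)); last by rewrite intrD lexx ltrDl ltr01.
    by rewrite intrD subrr h01; congr h; ring.
  apply: eps_within_continuous => t tn e e0.
  have t01 : 0 <= t - n%:~R <= 1 by case/andP: tn => ? ?; apply/andP; split; lra.
  have [d d0 Hd] := within_continuous_eps ch t01 e0; exists d => // s sn st.
  rewrite !hfE //; apply: Hd; first by case/andP: sn => ? ?; apply/andP; split; lra.
  by rewrite (_ : _ - _ = s - t) //; ring.
pose n := Num.floor u; have /andP[h1 h2] := floor_itv u; rewrite intrD in h2.
have e1 : (n - 1)%:~R + 1 = n%:~R :> R by rewrite intrB subrK.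
have c : {within `[(n - 1)%:~R, n%:~R + 1], continuous hf}.
  have -> : `[(n - 1)%:~R, n%:~R + 1]%classic =
      `[(n - 1)%:~R, (n - 1)%:~R + 1] `|` `[n%:~R : R, n%:~R + 1].
    rewrite e1; apply/seteqP; split=> x /=; rewrite !in_itv /=.
      by move=> /andP[? ?]; have [?|?] := leP x n%:~R; [left|right]; apply/andP; split; lra.
    by move=> [] /andP[? ?]; apply/andP; split; lra.
  by apply: withinU_continuous; [exact: interval_closed|exact: interval_closed|exact: piece|exact: piece].
apply/cvgrPdist_lt => e e0.
have un : (n - 1)%:~R <= u <= n%:~R + 1 by rewrite /n; apply/andP; split; lra.
have [d d0 Hd] := within_continuous_eps c un e0.
pose d' := Num.min d (Num.min (u - (n - 1)%:~R) (n%:~R + 1 - u)).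
have d'0 : 0 < d' by rewrite /d' !lt_min d0 /=; apply/andP; split; lra.
exists d' => //= s; rewrite /ball /= !lt_min => /andP[sd /andP[]].
move=> su1 su2; rewrite distrC; apply: Hd; last by rewrite distrC.
apply/andP; split.
  by have := le_lt_trans (ler_norm _) su1; rewrite ltrD2l ltrN2 => /ltW.
by rewrite distrC in su2; have := le_lt_trans (ler_norm _) su2; rewrite ltrD2r => /ltW.
Qed.

(** The primitive over a period vanishes because the mean does, so the primitive
    on [[0, 1]] closes up into a periodic one. *)
Lemma test_function_of_derivative (psi : R -> R) : continuous psi -> periodic psi 1 ->
  \I_(0, 1) psi = 0 -> exists2 phi, test_function phi & derive1 phi = psi.
Proof.
move=> cpsi ppsi i0.
have sp (a b : R) : summable_on a b psi by apply/continuous_summable/continuous_subspaceT.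
pose phi x := \I_(0, x) psi - \I_(x, 0) psi.
have empty (a b : R) : b < a -> \I_(a, b) psi = 0.
  by move=> ba; rewrite set_itv_ge ?Rintegral_set0 // bnd_simp -ltNge.
have phiB x y : x <= y -> phi y - phi x = \I_(x, y) psi.
  move=> xy; rewrite /phi; have [x0|x0] := ltP x 0; have [y0|y0] := ltP y 0.
  - rewrite !(empty 0) // (integral_addition xy (ltW y0)) //; ring.
  - rewrite (empty 0 x) // (integral_addition (ltW x0) y0 (sp x y)).
    have -> : \I_(y, 0) psi = 0.
      by move: y0; rewrite le_eqVlt => /predU1P[<-|/empty //]; rewrite integral_point.
    ring.
  - by lra.
  - have z t : 0 <= t -> \I_(t, 0) psi = 0.
      by rewrite le_eqVlt => /predU1P[<-|/empty //]; rewrite integral_point.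
    rewrite !z // (integral_addition x0 xy (sp 0 y)); ring.
have dphi (x : R) : is_derive x 1 phi (psi x).
  apply: is_derive_eps => e e0.
  have /cvgrPdist_lt /(_ e e0)[d /= d0 Hd] := cpsi x.
  exists d => // y yx.
  have bd a b : a <= b -> a <= x <= b -> b - a < d ->
      `|\I_(a, b) psi - (b - a) * psi x| <= e * (b - a).
    move=> ab /andP[ax xb] dab; rewrite mulrC -!integral_cst' //.
    rewrite -integralB' //; last exact: summable_cst.
    apply: integral_norm_le; [apply: summableB => //; exact: summable_cst|exact: summable_cst|].
    move=> t /andP[at_ tb]; rewrite distrC; apply/ltW/Hd; rewrite /ball /=.
    by rewrite ltr_norml; apply/andP; split; lra.
  have [xy|/ltW yx'] := leP x y.
    rewrite (ger0_norm (_ : 0 <= y - x)) ?subr_ge0 // in yx *.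
    by rewrite phiB //; apply: bd; rewrite ?lexx.
  rewrite -normrN; have -> : - (phi y - phi x - (y - x) * psi x) =
     phi x - phi y - (x - y) * psi x by ring.
  rewrite (distrC y) (ger0_norm (_ : 0 <= x - y)) ?subr_ge0 // in yx *.
  by rewrite phiB //; apply: bd; rewrite ?lexx ?andbT.
have dE : derive1 phi = psi by apply/funext => x; rewrite derive1E; exact: derive_val.
exists phi => //; split; last by rewrite dE.
- have c x : phi (x + 1) - phi x = phi (0 + 1) - phi 0.
    apply: (@is_derive_0_is_cst _ (fun x => phi (x + 1) - phi x)) => {}x.
    have -> : 0 = psi (x + 1) * 1 - psi x :> R by rewrite mulr1 ppsi subrr.
    apply: is_deriveB; apply: (is_derive1_comp (f := phi) (g := fun x => x + 1)).
    by rewrite -[X in is_derive _ _ _ X]addr0; apply: is_deriveD.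
  move=> u; apply/eqP; rewrite -subr_eq0 c phiB ?add0r ?ler01 // i0 //.
- by move=> u; case: (dphi u).
Qed.

End calculus_complements.

(** * Sobolev curves as indefinite integrals *)

Section sobolev_representation.
Context {R : realType}.
Local Notation mu := (@lebesgue_measure R).
Implicit Types (gamma w : R -> 'rV[R]_2).

(** Elements of [W^{1,1}] are handled as periodic indefinite integrals, with a
    chosen derivative [w] in place of [wderiv gamma]: curves of the flow are
    built from their derivatives, and the choice does not affect norms and
    lengths by [represents_W11_norm] and [represents_len]. *)
Definition represents gamma w : Prop :=
  [/\ vsummable w, forall i, \I_(0, 1) (fun u => w u 0 i) = 0 &
      forall u i, gamma u 0 i = gamma 0 0 i + \I_(0, frac_part u) (fun u => w u 0 i)].

Lemma represents_unit gamma w : represents gamma w -> forall u i, 0 <= u <= 1 ->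
  gamma u 0 i = gamma 0 0 i + \I_(0, u) (fun u => w u 0 i).
Proof.
move=> [hw w0 hg] u i /andP[u0]; rewrite le_eqVlt => /predU1P[->|u1].
  by rewrite hg frac_part1 integral_point w0.
by rewrite hg frac_part_id // u0.
Qed.

Lemma represents_prim gamma w i : represents gamma w ->
  prim_of (fun u => gamma u 0 i) (fun u => w u 0 i).
Proof.
move=> hg; have [hw _ _] := hg.
apply: prim_of_ext (prim_of_integral (gamma 0 0 i) (hw i)) => // u u01.
by rewrite -(represents_unit hg).
Qed.

Lemma represents_weak_derivative gamma w : represents gamma w -> is_weak_derivative gamma w.
Proof.
move=> hg i; have [hw w0 _] := hg; split; first exact: hw.
move=> phi [pphi dphi cphi].
have [s1 s2] := prim_of_mul (represents_prim i hg) (continuous_prim_of dphi cphi).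
have p0 := continuous_prim_of dphi cphi; have p1 := represents_prim i hg.
have [C1 _ b1] := prim_of_bounded p0; have [C2 _ b2] := prim_of_bounded p1.
have cp := continuous_measurable (prim_of_continuous p0).
have sA : summable_on 0 1 (fun u => w u 0 i * phi u).
  exact: (summable_mul_bounded (hw i) cp b1).
have sB : summable_on 0 1 (fun u => gamma u 0 i * derive1 phi u).
  have := summable_mul_bounded p0.1 (continuous_measurable (prim_of_continuous p1)) b2.
  by apply: eq_integrable => // u _ /=; rewrite mulrC.
have := s2 0 1 (lexx 0) ler01 (lexx 1); rewrite (integralD' sA sB).
have -> : gamma 1 0 i = gamma 0 0 i by rewrite (represents_unit hg) ?w0 ?addr0 // lexx ler01.
have -> : phi 1 = phi 0 by rewrite -(pphi 0) add0r.
by rewrite subrr => /esym/eqP; rewrite addrC addr_eq0 => /eqP.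
Qed.

Lemma represents_increment gamma w (u v : R) : represents gamma w ->
  0 <= u -> u <= v -> v <= 1 -> gamma v - gamma u = vintegral u v w.
Proof.
move=> hg u0 uv v1; apply/rowP => i; rewrite !mxE.
exact: (represents_prim i hg).2.
Qed.

Lemma represents_frac gamma w u : represents gamma w -> gamma u = gamma (frac_part u).
Proof.
by move=> [_ _ hg]; apply/rowP => i; rewrite hg [RHS]hg (frac_part_id (frac_part_itv u)).
Qed.

Lemma represents_oscillation gamma w (u v : R) : represents gamma w ->
  enorm (gamma u - gamma v) <= \I_(0, 1) (fun u => enorm (w u)).
Proof.
move=> hg; rewrite (represents_frac u hg) (represents_frac v hg).
have [hw _ _] := hg; have hn := vsummable_enorm hw.
have main a b : 0 <= a -> a <= b -> b <= 1 ->
    enorm (gamma b - gamma a) <= \I_(0, 1) (fun u => enorm (w u)).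
  move=> a0 ab b1; rewrite (represents_increment hg) //.
  apply: (@le_trans _ _ (\I_(a, b) (fun u => enorm (w u)))).
    exact: enorm_vintegral.
  by apply: integral_mono => // t _; exact: enorm_ge0.
have /andP[u0 u1] := frac_part_le u; have /andP[v0 v1] := frac_part_le v.
have [uv|/ltW vu] := leP (frac_part u) (frac_part v); last exact: main.
by rewrite enorm_distC; exact: main.
Qed.

(** Absolute continuity of the integral, applied to the union of the intervals. *)
Lemma represents_absolutely_continuous gamma w :
  represents gamma w -> absolutely_continuous gamma.
Proof.
move=> hg e e0; have [hw _ _] := hg.
pose f := (fun u => enorm (w u)) \_ `[0, 1].
have hf : mu.-integrable setT (EFin \o f).
  by rewrite -restrict_EFin; apply/integrable_restrict => //; rewrite setTI; exact: vsummable_enorm.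
have [d [d0 Hd]] := integral_normr_continuous hf e0.
exists d => // n a b ab tab sd.
pose A := \big[setU/set0]_(i < n) `]a i, b i[%classic.
have mA : measurable A by apply: bigsetU_measurable => i _.
have muA : (mu A < d%:E)%E.
  rewrite /A measure_bigsetU_ord //=.
  apply: le_lt_trans (_ : (\sum_(i < n) (b i - a i))%:E < d%:E)%E; last by rewrite lte_fin.
  rewrite -sumEFin; apply: lee_sum => i _; rewrite lebesgue_measure_itv /= lte_fin.
  by have /and3P[_ + _] := ab i; case: ltP => // h1 h2; rewrite lee_fin subr_ge0.
have := Hd A mA muA; apply: le_lt_trans.
have fn u : `|f u| = f u.
  by rewrite ger0_norm // /f patchE; case: ifP => // _; exact: enorm_ge0.
have mf : measurable_fun setT f by move/integrableP: hf => [/measurable_EFinP].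
have fin i : (\int[mu]_(x in `]a i, b i[) (f x)%:E)%E \is a fin_num.
  by apply: integrable_fin_num => //; apply: integrableS hf.
have -> : \int[mu]_(x in A) `|f x| = \sum_(i < n) \int[mu]_(x in `]a i, b i[) f x.
  rewrite /Rintegral sum_fine; last by move=> i _; exact: fin.
  rewrite -ge0_integral_bigsetU //=.
  - by under eq_integral do rewrite fn.
  - by rewrite index_enum_uniq.
  - by apply: sub_trivIset tab.
  - by apply/measurable_EFinP; exact: measurable_funTS.
  - by move=> x _; rewrite lee_fin -fn.
apply: ler_sum => i _; have /and3P[ai0 aib bi1] := ab i.
rewrite (represents_increment hg) //.
apply: (@le_trans _ _ (\I_(a i, b i) (fun u => enorm (w u)))).
  by apply: enorm_vintegral => //; exact: vsummable_enorm.
have hab : mu.-integrable `[a i, b i] (EFin \o f) by apply: integrableS hf.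
rewrite (@Rintegral_itv_bndo_bndc _ _ (b i)) ?(@Rintegral_itv_obnd_cbnd _ (a i)) //; last 2 first.
- by apply: integrableS hf.
- by apply: integrableS hf.
rewrite le_eqVlt; apply/orP; left; apply/eqP; apply: eq_integral_on => u /andP[au ub].
rewrite /f patchE mem_set //= in_itv /=.
by rewrite (le_trans ai0 au) (le_trans ub bi1).
Qed.

Lemma represents_W11 gamma w : represents gamma w -> W11 gamma.
Proof.
move=> hg; split; last by exists w; exact: represents_weak_derivative.
  move=> u; apply/rowP => i; have [_ _ hg'] := hg.
  by rewrite hg' [RHS]hg' frac_part_periodic.
exact: represents_absolutely_continuous hg.
Qed.

Lemma absolutely_continuous_coord gamma i : absolutely_continuous gamma ->
  {within `[0, 1], continuous (fun u => gamma u 0 i)}.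
Proof.
move=> ac; apply: eps_within_continuous => t t01 e e0; have [d d0 Hd] := ac e e0.
exists d => // s s01 st.
have main (x y : R) : 0 <= x <= 1 -> 0 <= y <= 1 -> x <= y -> y - x < d ->
    enorm (gamma y - gamma x) < e.
  move=> /andP[x0 x1] /andP[y0 y1] xy yx.
  have := Hd 1%N (fun=> x) (fun=> y); rewrite !big_ord1; apply => //.
  - by move=> _; rewrite x0 xy y1.
  - by move=> j k _ _ _; rewrite !ord1.
have -> : gamma s 0 i - gamma t 0 i = (gamma s - gamma t) 0 i by rewrite !mxE.
apply: le_lt_trans (enorm_coord _ i) _.
have [ts|/ltW st'] := leP t s.
  by apply: main => //; rewrite ger0_norm ?subr_ge0 // in st.
by rewrite enorm_distC; apply: main => //; rewrite distrC ger0_norm ?subr_ge0 // in st.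
Qed.

(** Testing the weak derivative against primitives of continuous functions of
    mean zero shows that the difference between the curve and the indefinite
    integral of its weak derivative is orthogonal to itself, up to its mean. *)
Lemma weak_derivative_represents gamma w : periodic gamma 1 ->
  absolutely_continuous gamma -> is_weak_derivative gamma w -> represents gamma w.
Proof.
move=> pg ac wd; have hw : vsummable w by move=> i; case: (wd i).
have w0 i : \I_(0, 1) (fun u => w u 0 i) = 0.
  have [_ /(_ (fun=> 1))] := wd i.
  have d1 : derive1 (fun=> 1 : R) = (fun=> 0).
    by apply/funext => x; rewrite derive1_cst.
  rewrite d1 => /(_ _)/eqP; under eq_Rintegral do rewrite mulr0.
  under [X in - X]eq_Rintegral do rewrite mulr1.
  rewrite integral_cst' // mul0r eq_sym oppr_eq0 => H; apply/eqP/H.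
  by split => //; rewrite d1; exact: cst_continuous.
have unit_case i u : 0 <= u <= 1 -> gamma u 0 i = gamma 0 0 i + \I_(0, u) (fun u => w u 0 i).
  pose W x := 0 + \I_(0, x) (fun u => w u 0 i).
  have pW : prim_of W (fun u => w u 0 i) := prim_of_integral 0 (hw i).
  have cg := absolutely_continuous_coord (i := i) ac.
  pose h x := gamma x 0 i - W x.
  have ch : {within `[0, 1], continuous h}.
    have cW := prim_of_continuous pW.
    by move=> x; apply: cvgB; [exact: cg|exact: cW].
  have W1 : W 1 = 0 by rewrite /W add0r w0.
  have W0 : W 0 = 0 by rewrite /W integral_point addr0.
  have g1 : gamma 1 0 i = gamma 0 0 i by rewrite -[1]add0r pg.
  have h01 : h 0 = h 1 by rewrite /h W0 W1 g1.
  pose hbar := \I_(0, 1) h.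
  have sh := continuous_summable ch.
  have cext := periodic_extension_continuous ch h01.
  pose psi u := h (frac_part u) - hbar.
  have cpsi : continuous psi by move=> x; apply: cvgB; [exact: cext|exact: cvg_cst].
  have psiE u' : 0 <= u' <= 1 -> psi u' = h u' - hbar.
    move=> /andP[u0]; rewrite le_eqVlt => /predU1P[->|u1].
      by rewrite /psi frac_part1 h01.
    by rewrite /psi frac_part_id // u0.
  have ipsi : \I_(0, 1) psi = 0.
    rewrite (eq_integral_on psiE) integralB' //; last exact: summable_cst.
    by rewrite integral_cst' // subr0 mulr1 subrr.

  have ppsi : periodic psi 1 by move=> x; rewrite /psi frac_part_periodic.
  have [phi tphi dphi] := test_function_of_derivative cpsi ppsi ipsi.
  have [pphi derphi cphi] := tphi.
  have [_ /(_ phi tphi)] := wd i; rewrite dphi => e1.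
  have p0 := continuous_prim_of derphi cphi; rewrite dphi in p0.
  have [C1 _ b1] := prim_of_bounded p0; have [C2 _ b2] := prim_of_bounded pW.
  have cp := continuous_measurable (prim_of_continuous p0).
  have cp' : {within `[0, 1], continuous psi} by exact: continuous_subspaceT.
  have sA : summable_on 0 1 (fun u => w u 0 i * phi u).
    exact: (summable_mul_bounded (hw i) cp b1).
  have sB : summable_on 0 1 (fun u => W u * psi u).
    have := summable_mul_bounded p0.1 (continuous_measurable (prim_of_continuous pW)) b2.
    by apply: eq_integrable => // u' _ /=; rewrite mulrC.
  have sC : summable_on 0 1 (fun u => gamma u 0 i * psi u).
    by apply: continuous_summable => x; apply: cvgM; [exact: cg|exact: cp'].
  have := (prim_of_mul pW p0).2 0 1 (lexx 0) ler01 (lexx 1).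
  rewrite W0 W1 !mul0r subrr (integralD' sA sB) => e2.
  have e3 : \I_(0, 1) (fun u => h u * psi u) = 0.
    transitivity (\I_(0, 1) (fun u => gamma u 0 i * psi u) - \I_(0, 1) (fun u => W u * psi u)).
      by rewrite -(integralB' sC sB); apply: eq_integral_on => u' _; rewrite /h mulrBl.
    rewrite e1; lra.
  have cq : {within `[0, 1], continuous (fun u => psi u * psi u)}.
    by move=> x; apply: cvgM; exact: cp'.
  have shp : summable_on 0 1 (fun u => h u * psi u).
    by apply: continuous_summable => x; apply: cvgM; [exact: ch|exact: cp'].
  have e4 : \I_(0, 1) (fun u => psi u * psi u) = 0.
    transitivity (\I_(0, 1) (fun u => h u * psi u) - \I_(0, 1) (fun u => hbar * psi u)).
      rewrite -(integralB' shp (summableZ hbar p0.1)).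
      by apply: eq_integral_on => u' /psiE ->; ring.
    by rewrite e3 (integralZ' hbar p0.1) ipsi; ring.
  have z u' : 0 <= u' <= 1 -> h u' = hbar.
    move=> u01; have := continuous_ge0_integral_eq0 cq _ e4 u01.
    rewrite psiE // => /(_ _)/eqP; rewrite mulf_eq0 orbb subr_eq0 => H; apply/eqP/H.
    by move=> t _; rewrite -expr2 sqr_ge0.
  move=> u01; have := z u u01; rewrite -(z 0) ?lexx ?ler01 // /h W0 /W add0r; lra.
split=> // u i; rewrite -unit_case ?frac_part_le //.
by rewrite (periodic_frac_part u pg).
Qed.

Lemma W11_represents gamma : W11 gamma -> represents gamma (wderiv gamma).
Proof.
move=> [pg ac ex]; apply: weak_derivative_represents => //.
by rewrite /wderiv; case: xgetP => [g _ //|no]; case: ex => g /no.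
Qed.

(** Extended by zero, [d] has a vanishing primitive on the whole line, which
    Lebesgue differentiation gives back as [d] almost everywhere. *)
Lemma zero_primitive_ae (d : R -> R) : summable_on 0 1 d ->
  (forall u, 0 <= u <= 1 -> \I_(0, u) d = 0) ->
  {ae mu, forall u, `[0, 1]%classic u -> d u = 0}.
Proof.
move=> sd d0; pose f := d \_ `[0, 1].
have hf : mu.-integrable setT (EFin \o f).
  by rewrite -restrict_EFin; apply/integrable_restrict => //; rewrite setTI.
have hy (y : R) : mu.-integrable `]-oo, y] (EFin \o f) by apply: integrableS hf.
have locf : locally_integrable setT f.
  split=> //; [by move/integrableP : hf => [/measurable_EFinP]|exact: openT|].
  move=> K _ cK; have /integrableP[_] : mu.-integrable K (EFin \o f).
    by apply: integrableS hf => //; exact: compact_measurable.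
  by [].
have := FTC1Ny hy locf.
have F0 : (fun x => \int[mu]_(t in [set` `]-oo, x]]) f t) = (fun=> 0).
  apply/funext => x; rewrite /f -Rintegral_mkcondr.
  have [x0|x0] := ltP x 0.
    rewrite (_ : _ `&` _ = set0) ?Rintegral_set0 //.
    by apply/seteqP; split=> // t /=; rewrite !in_itv /= => -[tx /andP[t0 _]]; lra.
  have [x1|x1] := leP x 1.
    rewrite (_ : _ `&` _ = `[0, x]%classic) ?d0 ?x0 //.
    by apply/seteqP; split=> t /=; rewrite !in_itv /=;
      [move=> [tx /andP[t0 _]]; rewrite t0|move=> /andP[t0 tx]; rewrite tx t0 (le_trans tx)].
  rewrite (_ : _ `&` _ = `[0, 1]%classic) ?d0 ?ler01 ?lexx //.
  by apply/seteqP; split=> t /=; rewrite !in_itv /=;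
    [case|move=> /andP[t0 tx]; rewrite t0 tx (le_trans tx) // ltW].
apply: filterS; first exact: (ae_filter_ringOfSetsType mu).
move=> u [_]; rewrite F0 derive1_cst => fu u01.
by rewrite [RHS]fu /f patchE mem_set.
Qed.

Lemma represents_ae_unique gamma w w' : represents gamma w -> represents gamma w' ->
  {ae mu, forall u, `[0, 1]%classic u -> w u = w' u}.
Proof.
move=> hg hg'; have [hw _ _] := hg; have [hw' _ _] := hg'.
have aei i : {ae mu, forall u, `[0, 1]%classic u -> w u 0 i - w' u 0 i = 0}.
  apply: zero_primitive_ae; first exact: summableB.
  move=> u u01; have /andP[u0 u1] := u01.
  rewrite integralB'; [|exact: summable_sub (hw i)|exact: summable_sub (hw' i)].
  by have := represents_unit hg i u01; rewrite (represents_unit hg' i u01); lra.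
have aF := ae_filter_ringOfSetsType mu.
have := @filterI _ _ aF _ _ (aei ord0) (aei ord_max).
apply: filterS => u [h0 h1] u01; apply: row2P.
  by have := h0 u01; lra.
by have := h1 u01; lra.
Qed.

Lemma ae_eq_integral_on (f h : R -> R) a b : 0 <= a -> b <= 1 ->
  measurable_fun (`[0, 1] : set R) f -> measurable_fun (`[0, 1] : set R) h ->
  {ae mu, forall u, `[0, 1]%classic u -> f u = h u} -> \I_(a, b) f = \I_(a, b) h.
Proof.
move=> a0 b1 mf mh ae.
have sub : `[a, b]%classic `<=` (`[0, 1] : set R).
  by move=> x /=; rewrite !in_itv /= => /andP[? ?]; apply/andP; split; lra.
have aF := ae_filter_ringOfSetsType mu.
rewrite /Rintegral; congr fine; apply: ae_eq_integral => //.
- by apply/measurable_EFinP; exact: measurable_funS mf.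
- by apply/measurable_EFinP; exact: measurable_funS mh.
- by apply: filterS ae => u fu /sub/fu ->.
Qed.

Lemma represents_lin c gamma w gamma' w' : represents gamma w -> represents gamma' w' ->
  represents (fun u => c *: gamma u + gamma' u) (fun u => c *: w u + w' u).
Proof.
move=> [hw w0 hg] [hw' w0' hg'].
have hs : vsummable (fun u => c *: w u + w' u) by apply: vsummableD => //; exact: vsummableZ.
have E a b i : 0 <= a -> b <= 1 -> \I_(a, b) (fun u => (c *: w u + w' u) 0 i) =
    c * \I_(a, b) (fun u => w u 0 i) + \I_(a, b) (fun u => w' u 0 i).
  move=> a0 b1; have h1 : summable_on a b (fun u => w u 0 i) by exact: summable_sub (hw i).
  have h2 : summable_on a b (fun u => w' u 0 i) by exact: summable_sub (hw' i).
  rewrite -(integralZ' c h1) -(integralD' (summableZ c h1) h2).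
  by apply: eq_integral_on => u _; rewrite !mxE.
split=> // [i|u i]; first by rewrite E // w0 w0' mulr0 addr0.
have /andP[f0 f1] := frac_part_le u.
by rewrite E // !mxE hg hg'; ring.
Qed.

Lemma represents_cst (x : 'rV[R]_2) : represents (fun=> x) (fun=> 0).
Proof.
have z (a b : R) (i : 'I_2) : a <= b -> \I_(a, b) (fun=> (0 : 'rV[R]_2) 0 i) = 0.
  by move=> ab; under eq_Rintegral do rewrite mxE; rewrite integral_cst' // mul0r.
split=> [i|i|u i]; [exact: summable_cst|exact: z|].
by rewrite z ?addr0 //; have /andP[] := frac_part_le u.
Qed.

Lemma represents_ext gamma gamma' w w' : (forall u, gamma u = gamma' u) ->
  (forall u, w u = w' u) -> represents gamma w -> represents gamma' w'.
Proof. by move=> /funext -> /funext ->. Qed.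

Lemma representsZ (c : R) (gamma w : R -> 'rV[R]_2) : represents gamma w ->
  represents (fun u => c *: gamma u) (fun u => c *: w u).
Proof.
move=> hg; apply: represents_ext (represents_lin c hg (represents_cst 0)) => u; exact: addr0.
Qed.

Lemma representsB (gamma w gamma' w' : R -> 'rV[R]_2) : represents gamma w -> represents gamma' w' ->
  represents (fun u => gamma u - gamma' u) (fun u => w u - w' u).
Proof.
move=> hg hg'; apply: represents_ext (represents_lin (-1) hg' hg) => u;
  by rewrite scaleN1r addrC.
Qed.

Lemma representsD (gamma w gamma' w' : R -> 'rV[R]_2) : represents gamma w ->
  represents gamma' w' -> represents (fun u => gamma u + gamma' u) (fun u => w u + w' u).
Proof.
move=> hg hg'; apply: represents_ext (represents_lin 1 hg hg') => u; by rewrite scale1r.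
Qed.

Lemma represents_integral gamma w (Phi : 'rV[R]_2 -> R) : represents gamma w ->
  (forall v, vsummable v -> measurable_fun (`[0, 1] : set R) (fun u => Phi (v u))) ->
  \I_(0, 1) (fun u => Phi (wderiv gamma u)) = \I_(0, 1) (fun u => Phi (w u)).
Proof.
move=> hg mPhi; have hd := W11_represents (represents_W11 hg).
have [hw _ _] := hg; have [hw' _ _] := hd.
apply: ae_eq_integral_on => //; [exact: mPhi|exact: mPhi|].
have aF := ae_filter_ringOfSetsType mu.
by apply: filterS (represents_ae_unique hd hg) => u e /e ->.
Qed.

Lemma represents_len gamma w : represents gamma w ->
  len gamma = \I_(0, 1) (fun u => enorm (w u)).
Proof.
move=> hg; apply: (represents_integral hg) => v hv.
exact: summable_measurable (vsummable_enorm hv).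
Qed.

Lemma represents_continuous gamma w : represents gamma w ->
  {within `[0, 1], continuous (fun u => enorm (gamma u))}.
Proof.
move=> hg; have hc i := prim_of_continuous (represents_prim i hg).
apply: eps_within_continuous => t t01 e e0; have e2 : 0 < e / 2 by rewrite divr_gt0.
have [d0 d00 H0] := within_continuous_eps (hc ord0) t01 e2.
have [d1 d10 H1] := within_continuous_eps (hc ord_max) t01 e2.
exists (Num.min d0 d1); first by rewrite lt_min d00.
move=> s s01; rewrite lt_min => /andP[/(H0 s s01) h0 /(H1 s s01) h1].
apply: le_lt_trans (enorm_dist _ _) _; apply: le_lt_trans (enorm_le_sum _) _.
by rewrite !mxE; lra.
Qed.

Lemma represents_W11_norm gamma w : represents gamma w ->
  W11_norm gamma = \I_(0, 1) (fun u => enorm (gamma u)) + \I_(0, 1) (fun u => enorm (w u)).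
Proof. by move=> hg; rewrite /W11_norm -(represents_len hg). Qed.

(** A curve is at distance at most its length from each of its points, and this
    is averaged over the curve. *)
Lemma represents_sup_le gamma w u : represents gamma w -> enorm (gamma u) <= W11_norm gamma.
Proof.
move=> hg; rewrite (represents_W11_norm hg) -[enorm (gamma u)]mulr1 -[X in _ * X](subr0 1).
set l := \I_(0, 1) (fun u => enorm (w u)).
have sg := continuous_summable (represents_continuous hg).
have -> : \I_(0, 1) (fun u => enorm (gamma u)) + l = \I_(0, 1) (fun u => enorm (gamma u) + l).
  by rewrite integralD' // ?integral_cst' ?subr0 ?mulr1 //; exact: summable_cst.
rewrite -integral_cst' //; apply: integral_le; first exact: summable_cst.
  by apply: summableD => //; exact: summable_cst.
move=> v _; rewrite -{1}(subrK (gamma v) (gamma u)) addrC.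
by apply: le_trans (enormD _ _) _; rewrite lerD2l; exact: represents_oscillation hg.
Qed.

Lemma represents_W11_norm_le gamma w c : represents gamma w ->
  enorm (gamma 0) <= c -> W11_norm gamma <= c + 2 * \I_(0, 1) (fun u => enorm (w u)).
Proof.
move=> hg g0; rewrite (represents_W11_norm hg).
set l := \I_(0, 1) (fun u => enorm (w u)).
have sg := continuous_summable (represents_continuous hg).
suff : \I_(0, 1) (fun u => enorm (gamma u)) <= \I_(0, 1) (fun=> c + l).
  by rewrite integral_cst' // subr0 mulr1; lra.
apply: integral_le => //; first exact: summable_cst.
move=> v _; rewrite -{1}(subrK (gamma 0) (gamma v)) addrC.
apply: le_trans (enormD _ _) _; apply: lerD => //; exact: represents_oscillation hg.
Qed.

End sobolev_representation.

(** * The flow field in terms of the derivative of the curve *)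

Section velocity_field.
Context {R : realType} (lambda : R) (lambda0 : 0 < lambda).
Local Notation mu := (@lebesgue_measure R).
Local Notation g := (green lambda).
Local Notation gg := (green_primitive lambda).
Implicit Types (gamma w : R -> 'rV[R]_2) (i : 'I_2).

Definition speed w (u : R) : R := enorm (w u).
Definition coord w i (u : R) : R := w u 0 i.

(** For a closed curve with derivative [w], [velocity w] is the opposite of
    the sum of the curve and its convolution with [G], and [velocity_deriv w] is
    its derivative.  Neither of them sees the position of the curve, because
    [green] has mass 1 over a period. *)
Definition velocity w (u : R) : 'rV[R]_2 := \row_i
  (smear gg (speed w) (coord w i) (frac_part u) - \I_(0, frac_part u) (coord w i)).
Definition smoothed_tangent w (u : R) : 'rV[R]_2 := \row_i
  (smear g (speed w) (coord w i) u / total (speed w)).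
Definition velocity_deriv w (u : R) : 'rV[R]_2 := - w u + speed w u *: smoothed_tangent w u.

Definition is_density w : Prop := vsummable w /\ 0 < total (speed w).

Lemma density_speed w : is_density w -> is_speed (speed w).
Proof. by move=> [hw M0]; split=> // [|u _]; [exact: vsummable_enorm|exact: enorm_ge0]. Qed.

Lemma coord_le_speed w i u : `|coord w i u| <= speed w u.
Proof. exact: enorm_coord. Qed.

(** Since [green] has mass 1 over a period, its convolution is an average; the
    mass is computed by convolving the constant curve [one]. *)
Lemma smear_green_le_total (m h : R -> R) (u : R) : is_speed m -> summable_on 0 1 h ->
  (forall v, 0 <= v <= 1 -> `|h v| <= m v) -> 0 <= u <= 1 -> `|smear g m h u| <= total m.
Proof.
move=> hm hh hmb u01; have [_ _ M0] := hm.
have [B [gB _ _]] := green_kernel_bounds lambda0.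
pose one := fun _ : R => (1 : R).
have pone : prim_of one (fun=> 0).
  split=> [|x y _ xy _]; first exact: summable_cst.
  by rewrite integral_cst' // mul0r subrr.
have i0 : \I_(0, 1) (fun=> (0 : R)) = 0 by rewrite integral_cst' // mul0r.
have := green_conv_by_parts lambda0 hm pone i0 u01.
have -> : smear gg m (fun=> 0) u = 0.
  by rewrite /smear; under eq_Rintegral do rewrite mul0r.
rewrite addr0 => e1.
have sm : summable_on 0 1 (fun v => m v * g (arc m v - arc m u)).
  by case: (hm) => sm _ _; exact: smear_summable gB hm sm u01.
have -> : total m = \I_(0, 1) (fun v => m v * g (arc m v - arc m u)).
  rewrite -[LHS]mulr1 -[X in _ * X]/(one 0) -e1 -integralZ'.
    by apply: eq_integral_on => v _; rewrite /one mul1r; field; rewrite gt_eqF.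
  have := summableZ (total m)^-1 sm.
  by apply: eq_integrable => // v _ /=; rewrite /one mul1r; congr (_%:E); ring.
apply: integral_norm_le => //; first exact: smear_summable gB hm hh u01.
move=> v v01; rewrite normrM [X in _ * X]ger0_norm ?green_ge0 //.
by apply: ler_wpM2r; [exact: green_ge0|exact: hmb].
Qed.

Lemma smoothed_tangent_bound w u : is_density w -> 0 <= u <= 1 ->
  forall i, `|smoothed_tangent w u 0 i| <= 1.
Proof.
move=> hw u01 i; have hm := density_speed hw; have [vw M0] := hw; rewrite mxE normrM.
rewrite normfV (gtr0_norm M0) ler_pdivrMr // mul1r.
by apply: (smear_green_le_total hm (vw i)) => // v _; exact: coord_le_speed.
Qed.

Lemma smear_coord_continuous w i : is_density w ->
  {within `[0, 1], continuous (smear g (speed w) (coord w i))}.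
Proof.
move=> hw; have [B [gB _ _]] := green_kernel_bounds lambda0.
by apply: (smear_continuous gB (density_speed hw)); case: hw => vw _; exact: vw.
Qed.

Lemma velocity_represents w : is_density w -> (forall i, \I_(0, 1) (coord w i) = 0) ->
  represents (velocity w) (velocity_deriv w).
Proof.
move=> hw w0; have hm := density_speed hw; have [vw M0] := hw.
have p i : prim_of (fun u => smear gg (speed w) (coord w i) u - (0 + \I_(0, u) (coord w i)))
    (fun u => velocity_deriv w u 0 i).
  have := prim_ofB (smear_primitive_prim lambda0 hm (vw i)) (prim_of_integral 0 (vw i)).
  apply: prim_of_ext => // u _.
  by rewrite !mxE /coord; move: (smear _ _ _ _) (speed w u) => c1 c2; ring.
split=> [i|i|u i].
- by case: (p i).
- rewrite -(p i).2 // (smear_primitive_period lambda0 hm (vw i)).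
  rewrite -[\I_(0, 1) _]/(\I_(0, 1) (coord w i)) w0 integral_point; ring.
have /andP[f0 f1] := frac_part_le u.
rewrite -(p i).2 // !mxE frac_part0 !integral_point.
move: (smear _ _ _ _) (smear _ _ _ 0) (\I_(0, frac_part u) (coord w i)) => c1 c2 c3.
ring.
Qed.

(** Only integrals of [w] enter the velocity. *)
Lemma eq_velocity w w' : is_density w -> is_density w' ->
  {ae mu, forall u, `[0, 1]%classic u -> w u = w' u} -> velocity w = velocity w'.
Proof.
move=> hw hw' ae; have aF := ae_filter_ringOfSetsType mu.
have [vw _] := hw; have [vw' _] := hw'.
have mc v i : vsummable v -> measurable_fun (`[0, 1] : set R) (coord v i).
  by move=> hv; exact: summable_measurable (hv i).
have ms v : vsummable v -> measurable_fun (`[0, 1] : set R) (speed v).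
  by move=> hv; exact: summable_measurable (vsummable_enorm hv).
have es b : b <= 1 -> \I_(0, b) (speed w) = \I_(0, b) (speed w').
  move=> b1; apply: ae_eq_integral_on => //; [exact: ms|exact: ms|].
  by apply: filterS ae => v e /e; rewrite /speed => ->.
have ea v : v <= 1 -> arc (speed w) v = arc (speed w') v.
  by move=> v1; rewrite /arc /total !es.
have [B [_ ggB _]] := green_kernel_bounds lambda0.
apply/funext => u; apply/rowP => i; have f01 := frac_part_le u; have /andP[f0 f1] := f01.
have e1 : smear gg (speed w) (coord w i) (frac_part u) =
    smear gg (speed w') (coord w' i) (frac_part u).
  transitivity (\I_(0, 1)
      (fun v => coord w i v * gg (arc (speed w') v - arc (speed w') (frac_part u)))).
    by apply: eq_integral_on => v /andP[_ v1]; rewrite !ea.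
  apply: ae_eq_integral_on => //.
  - exact: summable_measurable (smear_summable ggB (density_speed hw') (vw i) f01).
  - exact: summable_measurable (smear_summable ggB (density_speed hw') (vw' i) f01).
  - by apply: filterS ae => v e /e; rewrite /coord => ->.
have e2 : \I_(0, frac_part u) (coord w i) = \I_(0, frac_part u) (coord w' i).
  apply: (ae_eq_integral_on (lexx 0) f1 (mc _ _ vw) (mc _ _ vw')).
  by apply: filterS ae => v e /e; rewrite /coord => ->.
by rewrite !mxE e1 e2.
Qed.

Lemma represents_density gamma w : represents gamma w -> 0 < len gamma -> is_density w.
Proof. by move=> hg; rewrite (represents_len hg) => L0; split=> //; case: hg. Qed.

Lemma curve_conv_smear gamma w u i : represents gamma w -> is_density w ->
  (forall v, rho gamma v = arc (speed w) (frac_part v)) ->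
  \I_(0, 1) (fun v => gamma v 0 i * G lambda (rho gamma v - rho gamma u) *
     (speed w v / total (speed w))) =
  - (gamma 0 0 i + smear gg (speed w) (coord w i) (frac_part u)).
Proof.
move=> hg hw rE; have hm := density_speed hw; have [vw M0] := hw; have [_ w0 _] := hg.
have f01 := frac_part_le u.
have := green_conv_by_parts lambda0 hm (represents_prim i hg) (w0 i) f01.
move=> <-; have [B [gB _ _]] := green_kernel_bounds lambda0.
have sg : summable_on 0 1 (fun v => gamma v 0 i *
    g (arc (speed w) v - arc (speed w) (frac_part u)) * (speed w v / total (speed w))).
  have [sm _] := arc_prim hm.
  have cg := prim_of_continuous (represents_prim i hg).
  have ck := kernel_arc_continuous gB hm f01.
  have cgk : {within `[0, 1], continuous (fun v => gamma v 0 i *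
      g (arc (speed w) v - arc (speed w) (frac_part u)))}.
    by move=> x; apply: cvgM; [exact: cg|exact: ck].
  have [C _ bC] := prim_of_bounded (represents_prim i hg).
  have bk v : 0 <= v <= 1 -> `|gamma v 0 i * g (arc (speed w) v - arc (speed w) (frac_part u))|
      <= C * B.
    by move=> v01; rewrite normrM; apply: ler_pM => //; [exact: bC|apply: gB.1; exact: arcB_itv].
  have := summable_mul_bounded sm (continuous_measurable cgk) bk.
  by apply: eq_integrable => // v _ /=; rewrite mulrC.
rewrite -integralN' //; apply: eq_integral_on => v v01.
rewrite !rE; set a := arc (speed w) (frac_part u).
have -> : G lambda (arc (speed w) (frac_part v) - a) = - g (arc (speed w) v - a).
  case/andP: (v01) => v0; rewrite le_eqVlt => /predU1P[->|v1]; last first.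
    rewrite frac_part_id ?v0 // G_green //; exact: arcB_itv.
  rewrite frac_part1 arc0 arc1 // G_green //; last first.
    by rewrite -(arc0 (speed w)); apply: arcB_itv; rewrite ?lexx ?ler01.
  rewrite sub0r greenN -(green_shift lambda0 (arc_itv hm f01)) -/a -(greenN _ (1 - a)).
  by rewrite opprB.
by move: (g _) => c; ring.
Qed.

(** Integration by parts replaces the curve by its derivative under the
    convolution, and any derivative [w] will do since it is unique almost
    everywhere. *)
Lemma F_velocity a gamma w : represents gamma w -> 0 < len gamma ->
  F lambda a gamma = fun u => (len gamma `^ (a - 2) / lambda ^+ 2) *: velocity w u.
Proof.
move=> hg L0; have hd := W11_represents (represents_W11 hg).
have dw := represents_density hg L0; have dd := represents_density hd L0.
rewrite (eq_velocity dw dd); last exact: represents_ae_unique hg hd.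
rewrite /F gt_eqF //; apply/funext => u; rewrite scaleNr -scalerN; congr (_ *: _).
apply/rowP => i; rewrite !mxE.
have e := curve_conv_smear u i hd dd (fun v => _); rewrite {}e; last first.
  by move=> v; rewrite /rho /arc mulrC.
have [_ _ hg'] := hd; rewrite (hg' u) -[coord (wderiv gamma) i]/(fun u => wderiv gamma u 0 i).
by move: (smear _ _ _ _) => c; ring.
Qed.

(** The convolution is an average of the curve, so it stays in its convex hull. *)
Lemma average_bound gamma w c u : represents gamma w -> is_density w ->
  (forall v, enorm (gamma v) <= c) -> enorm (gamma u + velocity w u) <= c.
Proof.
move=> hg hw gc; have hm := density_speed hw; have [vw M0] := hw.
have [B [gB _ _]] := green_kernel_bounds lambda0.
have f01 := frac_part_le u; set a := arc (speed w) (frac_part u).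
pose k v := g (arc (speed w) v - a) * (speed w v / total (speed w)).
have [sm _] := arc_prim hm.
have ck := kernel_arc_continuous gB hm f01.
have sk : summable_on 0 1 k.
  have bk v : 0 <= v <= 1 -> `|g (arc (speed w) v - a)| <= B.
    by move=> v01; apply: gB.1; exact: arcB_itv.
  have := summable_mul_bounded sm (continuous_measurable ck) bk.
  by apply: eq_integrable => // v _ /=; rewrite mulrC.
have k0 v : 0 <= k v.
  by rewrite mulr_ge0 ?green_ge0 // divr_ge0 ?enorm_ge0 // ltW.
have k1 : \I_(0, 1) k = 1.
  pose one := fun _ : R => (1 : R).
  have pone : prim_of one (fun=> 0).
    split=> [|x y _ xy _]; first exact: summable_cst.
    by rewrite integral_cst' // mul0r subrr.
  have i0 : \I_(0, 1) (fun=> (0 : R)) = 0 by rewrite integral_cst' // mul0r.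
  have := green_conv_by_parts lambda0 hm pone i0 f01.
  have -> : smear gg (speed w) (fun=> 0) (frac_part u) = 0.
    by rewrite /smear; under eq_Rintegral do rewrite mul0r; rewrite integral_cst' // mul0r.
  rewrite addr0 => e1; rewrite -[RHS]/(one 0) -e1.
  by apply: eq_integral_on => v _; rewrite mul1r.
have skg : vsummable (fun v => k v *: gamma v).
  move=> i; have [C _ bC] := prim_of_bounded (represents_prim i hg).
  have cg := continuous_measurable (prim_of_continuous (represents_prim i hg)).
  have := summable_mul_bounded sk cg bC.
  by apply: eq_integrable => // v _ /=; rewrite !mxE.
have -> : gamma u + velocity w u = vintegral 0 1 (fun v => k v *: gamma v).
  apply/rowP => i; rewrite !mxE; have [_ w0 hg'] := hg.
  have := green_conv_by_parts lambda0 hm (represents_prim i hg) (w0 i) f01.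
  move=> e1; rewrite (hg' u i) -[fun u0 => w u0 0 i]/(coord w i).
  transitivity (gamma 0 0 i + smear gg (speed w) (coord w i) (frac_part u)).
    by move: (smear _ _ _ _) => c1; ring.
  apply: etrans (esym e1) _; apply: eq_integral_on => v _.
  by rewrite !mxE /k -/a; move: (g _) => c1; ring.
apply: le_trans (_ : \I_(0, 1) (fun v => c * k v) <= c); last first.
  by rewrite (integralZ' c sk) k1 mulr1.
apply: enorm_vintegral => //; first exact: summableZ.
by move=> v _; rewrite enormZ ger0_norm // mulrC ler_wpM2r.
Qed.

(** The derivative of the length along the flow is the left-hand integral,
    without its factor, minus the length: this is what makes the length decay
    exponentially. *)
Lemma dissipation w : is_density w -> (forall i, \I_(0, 1) (coord w i) = 0) ->
  (1 + 4 * lambda ^+ 2) * \I_(0, 1) (fun u => dot (w u) (smoothed_tangent w u)) <=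
    total (speed w).
Proof.
move=> hw w0; have hm := density_speed hw; have [vw M0] := hw.
have := smear_correlation lambda0 hm (vw ord0) (vw ord_max) (w0 ord0) (w0 ord_max).
have sp i : summable_on 0 1 (fun v => coord w i v * smear g (speed w) (coord w i) v).
  have [B [gB _ _]] := green_kernel_bounds lambda0.
  have bS v : 0 <= v <= 1 -> `|smear g (speed w) (coord w i) v| <=
      B * \I_(0, 1) (fun v => `|coord w i v|).
    by move=> v01; apply: smear_norm gB hm (vw i) v01.
  apply: (summable_mul_bounded (f := coord w i) (vw i) _ bS).
  by apply: continuous_measurable; exact: smear_coord_continuous.
have -> : \I_(0, 1) (fun u => dot (w u) (smoothed_tangent w u)) =
  (total (speed w))^-1 * (\I_(0, 1) (fun v => coord w ord0 v * smear g (speed w) (coord w ord0) v) +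
   \I_(0, 1) (fun v => coord w ord_max v * smear g (speed w) (coord w ord_max) v)).
  rewrite -(integralD' (sp ord0) (sp ord_max)).
  rewrite -(integralZ' (total (speed w))^-1 (summableD (sp ord0) (sp ord_max))).
  apply: eq_integral_on => v _; rewrite /dot !mxE /coord.
  by move: (smear _ _ _ _) (smear _ _ (fun u => w u 0 ord_max) _) => c1 c2; ring.
set I := (_ + _ : R) => H; rewrite mulrCA -(ler_pM2l M0) mulVKf ?gt_eqF // -expr2; apply: H.
by move=> v _; rewrite /speed sqr_enorm /dot /coord !expr2.
Qed.

End velocity_field.

(** * Picard iteration *)

Section picard_iteration.
Context {R : realType}.

Lemma expr2V_cvg (C : R) : (fun n => C / 2 ^+ n) @ \oo --> (0 : R).
Proof.
have -> : (fun n => C / 2 ^+ n) = (fun n => C * (2^-1) ^+ n).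
  by apply/funext => n; rewrite exprVn.
rewrite -[X in _ --> X](mulr0 C); apply: cvgM; first exact: cvg_cst.
by apply: cvg_expr; rewrite ger0_norm // invf_lt1 // ltr1n.
Qed.

(** Corrected by the bound on their tail, the terms form a monotone sequence on
    either side of the limit; this also gives the rate. *)
Lemma geometric_cvg (a : nat -> R) C : (forall n, `|a n.+1 - a n| <= C / 2 ^+ n) ->
  exists l, a @ \oo --> l /\ forall n, `|a n - l| <= 2 * C / 2 ^+ n.
Proof.
move=> H; have C0 : 0 <= C by have := H 0%N; rewrite expr0 divr1; exact: le_trans.
pose r n := 2 * C / 2 ^+ n.
have r0 n : 0 <= r n by rewrite divr_ge0 ?mulr_ge0 ?exprn_ge0.
have rS n : r n.+1 = r n - C / 2 ^+ n by rewrite /r exprS; field; rewrite expf_neq0.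
pose b n := a n - r n; pose c n := a n + r n.
have bn : nondecreasing_seq b.
  apply/nondecreasing_seqP => n; have := H n; rewrite ler_norml /b rS => /andP[]; lra.
have cn : nonincreasing_seq c.
  apply/nonincreasing_seqP => n; have := H n; rewrite ler_norml /c rS => /andP[]; lra.
have ub : has_ubound (range b).
  exists (c 0%N) => _ [n _ <-]; apply: le_trans (cn _ _ (leq0n n)).
  by rewrite /b /c; have := r0 n; lra.
have cb := nondecreasing_is_cvgn bn ub.
have rc : r @ \oo --> (0 : R) := expr2V_cvg (2 * C).
pose l := limn b.
have ca : a @ \oo --> l.
  have -> : a = (fun n => b n + r n) by apply/funext => n; rewrite /b subrK.
  by rewrite -[l]addr0; apply: cvgD.
have cc : c @ \oo --> l by rewrite -[l]addr0; apply: cvgD.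
exists l; split=> // n.
have h1 : b n <= l by exact: nondecreasing_cvgn_le.
have h2 : l <= c n.
  have e : limn c = l by exact: cvg_lim cc.
  rewrite -e; apply: nonincreasing_cvgn_ge => //; apply/cvg_ex; by exists l.
by rewrite ler_norml; move: h1 h2; rewrite /b /c /r => ? ?; apply/andP; split; lra.
Qed.

Lemma integral_expR (c t : R) : 0 <= t ->
  \I_(0, t) (fun s => c * expR (c * s)) <= expR (c * t) - 1.
Proof.
move=> t0; have q := quad_deriv_expR c.
have := quad_deriv_le (quad_deriv_primitive (quad_deriv_lipschitz_deriv q)) q
  (fun s _ => lexx _) (lexx 0) t0.
by rewrite integral_point mulr0 expR0; lra.
Qed.

Variables (U : Type) (V : R -> (U -> R) -> U -> R) (y0 : U -> R).
Variable good : R -> (U -> R) -> Prop.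
Hypothesis V_lip : forall T, 0 <= T -> exists2 K, 0 <= K &
  forall s t x y d, 0 <= s <= T -> 0 <= t <= T -> good s x -> good t y ->
    (forall u, `|x u - y u| <= d) -> forall u, `|V s x u - V t y u| <= K * (`|s - t| + d).
Hypothesis V_bound : forall T, 0 <= T -> exists2 B, 0 <= B &
  forall t x u, 0 <= t <= T -> good t x -> `|V t x u| <= B.
Hypothesis good_init : forall t, 0 <= t -> good t y0.
Hypothesis good_step : forall x : R -> U -> R, (forall t, 0 <= t -> good t (x t)) ->
  loc_lipschitz (fun t => V t (x t)) ->
  forall t, 0 <= t -> good t (fun u => y0 u + \I_(0, t) (fun s => V s (x s) u)).
Hypothesis good_lim : forall t (xn : nat -> U -> R) x, 0 <= t ->
  (forall n, good t (xn n)) -> (forall u, xn n u @[n --> \oo] --> x u) -> good t x.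

Let next (x : R -> U -> R) t u := y0 u + \I_(0, t) (fun s => V s (x s) u).
Let iterate n := iter n next (fun=> y0).

Let primitive_lipschitz (q : R -> R) T B : (forall s, 0 <= s <= T -> `|q s| <= B) ->
  summable_on 0 T q -> forall s t, 0 <= s <= T -> 0 <= t <= T ->
  `|\I_(0, s) q - \I_(0, t) q| <= B * `|s - t|.
Proof.
move=> bq sq.
have main a b : 0 <= a -> a <= b -> b <= T -> `|\I_(0, b) q - \I_(0, a) q| <= B * (b - a).
  move=> a0 ab bT; rewrite (integral_addition a0 ab); last exact: summable_sub sq.
  rewrite addrC addKr -integral_cst' //; apply: integral_norm_le.
  - exact: summable_sub sq.
  - exact: summable_cst.
  - by move=> t /andP[at_ tb]; apply: bq; rewrite (le_trans a0) // (le_trans tb).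
move=> s t /andP[s0 sT] /andP[t0 tT]; have [st|/ltW ts] := leP s t.
  by rewrite distrC (distrC s) (ger0_norm (_ : 0 <= t - s)) ?subr_ge0 //; exact: main.
by rewrite (ger0_norm (_ : 0 <= s - t)) ?subr_ge0 //; exact: main.
Qed.

Let loc_lip_V (x : R -> U -> R) : (forall t, 0 <= t -> good t (x t)) ->
  loc_lipschitz x -> loc_lipschitz (fun t => V t (x t)).
Proof.
move=> gx lx T T0; have [K K0 HK] := V_lip T0; have [L L0 HL] := lx T T0.
exists (K * (1 + L)); first by rewrite mulr_ge0 // addr_ge0.
move=> s t u sT tT; rewrite -mulrA mulrDl mul1r.
have [s0 _] := andP sT; have [t0 _] := andP tT.
by apply: HK => //; [exact: gx|exact: gx|move=> v; exact: HL].
Qed.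

Let summable_V (x : R -> U -> R) T u : 0 <= T -> loc_lipschitz (fun t => V t (x t)) ->
  summable_on 0 T (fun t => V t (x t) u).
Proof.
move=> T0 /(_ T T0)[L _ HL]; apply: continuous_summable.
by apply: (lipschitz_within_continuous (K := L)) => s t sT tT; exact: HL.
Qed.

Let next_lipschitz (x : R -> U -> R) T B : 0 <= T -> (forall t, 0 <= t -> good t (x t)) ->
  loc_lipschitz (fun t => V t (x t)) ->
  (forall t z u, 0 <= t <= T -> good t z -> `|V t z u| <= B) ->
  forall s t u, 0 <= s <= T -> 0 <= t <= T -> `|next x s u - next x t u| <= B * `|s - t|.
Proof.
move=> T0 gx lx HB s t u sT tT; rewrite /next opprD addrACA subrr add0r.
apply: (primitive_lipschitz (T := T)) => //; last exact: summable_V.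
by move=> r /[dup] rT /andP[r0 _]; apply: HB => //; exact: gx.
Qed.

Let iterate_good n : (forall t, 0 <= t -> good t (iterate n t)) /\ loc_lipschitz (iterate n).
Proof.
elim: n => [|n [gn ln]].
  split=> // T T0; exists 0 => // s t u _ _.
  by rewrite /iterate /= subrr normr0 mul0r.
have lV := loc_lip_V gn ln; split; first exact: good_step.
move=> T T0; have [B B0 HB] := V_bound T0; exists B => // s t u.
exact: next_lipschitz T0 gn lV HB s t u.
Qed.

(** The weight [expR (2 * K * t)] makes the iteration a contraction on the whole
    half-line, locally uniformly. *)
Let iterate_step T : 0 <= T -> exists2 C, 0 <= C & forall n t u, 0 <= t <= T ->
  `|iterate n.+1 t u - iterate n t u| <= C / 2 ^+ n.
Proof.
move=> T0; have [K K0 HK] := V_lip T0; have [B B0 HB] := V_bound T0.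
have BT : 0 <= B * T by rewrite mulr_ge0.
have main n t u : 0 <= t <= T ->
    `|iterate n.+1 t u - iterate n t u| <= B * T / 2 ^+ n * expR (2 * K * t).
  elim: n t u => [|n IH] t u /[dup] tT /andP[t0 t1].
    rewrite expr0 divr1; have [g0 l0] := iterate_good 0.
    have := next_lipschitz T0 g0 (loc_lip_V g0 l0) HB u tT (_ : 0 <= 0 <= T).
    rewrite /next integral_point addr0 subr0 (ger0_norm t0) => h.
    apply: le_trans (h _) _; first by rewrite lexx.
    apply: (@le_trans _ _ (B * T)); first exact: ler_wpM2l.
    by rewrite ler_peMr // expR_ge1 // !mulr_ge0.
  have [g0 l0] := iterate_good n; have [g1 l1] := iterate_good n.+1.
  have s0 := summable_V u t0 (loc_lip_V g0 l0); have s1 := summable_V u t0 (loc_lip_V g1 l1).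
  have -> : iterate n.+2 t u - iterate n.+1 t u = \I_(0, t) (fun s =>
      V s (iterate n.+1 s) u - V s (iterate n s) u).
    by rewrite (integralB' s1 s0) /iterate /= /next; ring.
  set b := B * T / 2 ^+ n.
  have b0 : 0 <= b by rewrite divr_ge0 // exprn_ge0.
  have se : summable_on 0 t (fun s => (2 * K) * expR ((2 * K) * s)).
    apply: continuous_summable; apply: continuous_subspaceT => x.
    apply: cvgM; [exact: cvg_cst|apply: continuous_comp; [|exact: continuous_expR]].
    by apply: cvgM; [exact: cvg_cst|exact: cvg_id].
  have -> : B * T / 2 ^+ n.+1 * expR (2 * K * t) = b / 2 * expR (2 * K * t).
    by rewrite /b exprS; field; rewrite expf_neq0.
  have b2 : 0 <= b / 2 by rewrite divr_ge0.
  have sharp := integral_expR (2 * K) t0.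
  have {}sharp : \I_(0, t) (fun s => (2 * K) * expR ((2 * K) * s)) <= expR (2 * K * t) by lra.
  apply: le_trans (ler_wpM2l b2 sharp).
  rewrite -(integralZ' (b / 2) se); apply: integral_norm_le.
  - exact: summableB.
  - exact: summableZ.
  move=> s /andP[s_0 st]; have sT : 0 <= s <= T by rewrite s_0 (le_trans st).
  have := HK s s _ _ _ sT sT (g1 s s_0) (g0 s s_0) (fun v => IH s v sT) u.
  rewrite subrr normr0 add0r -/b => h; apply: le_trans h _.
  by rewrite le_eqVlt; apply/orP; left; apply/eqP; field.
exists (B * T * expR (2 * K * T)); first by rewrite mulr_ge0 // expR_ge0.
move=> n t u /[dup] tT /andP[t0 t1]; apply: le_trans (main n t u tT) _.
rewrite [leRHS]mulrAC; apply: ler_wpM2l; first by rewrite divr_ge0 // exprn_ge0.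
by rewrite ler_expR ler_wpM2l // mulr_ge0.
Qed.

(** Solves [y' = V t y] for functions on [U] with the sup norm.  The set of
    admissible states [good t] may grow with [t], as it does for bounds of
    exponential type; it has to be preserved by an iteration step and by
    pointwise limits. *)
Theorem picard : exists y : R -> U -> R, [/\ y 0 = y0,
  forall t, 0 <= t -> good t (y t) & quad_deriv y (fun t => V t (y t))].
Proof.
have cv t u : 0 <= t -> exists l : R, (iterate n t u @[n --> \oo] --> l).
  move=> t0; have [C _ HC] := iterate_step t0.
  have [|l [cl _]] := @geometric_cvg (fun n => iterate n t u) C; last by exists l.
  by move=> n; apply: HC; rewrite t0 lexx.
pose y t u : R := limn (fun n => iterate n t u).
have cy t u : 0 <= t -> iterate n t u @[n --> \oo] --> y t u.
  by move=> /(cv t u)[l cl]; rewrite /y (cvg_lim _ cl).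
have gy t : 0 <= t -> good t (y t).
  move=> t0; apply: (good_lim t0 (xn := fun n => iterate n t)).
    by move=> n; case: (iterate_good n) => h _; exact: h.
  by move=> u; exact: cy.
have dist T : 0 <= T -> exists2 C, 0 <= C & forall n t u, 0 <= t <= T ->
    `|iterate n t u - y t u| <= C / 2 ^+ n.
  move=> T0; have [C C0 HC] := iterate_step T0; exists (2 * C); first exact: mulr_ge0.
  move=> n t u /[dup] tT /andP[t0 _].
  have [|l [cl Hl]] := @geometric_cvg (fun n => iterate n t u) C.
    by move=> k; exact: HC.
  by rewrite /y (cvg_lim _ cl).
have ly : loc_lipschitz y.
  move=> T T0; have [B B0 HB] := V_bound T0; have [C C0 HC] := dist T T0.
  exists B => // s t u sT tT; apply/ler_addgt0Pr => e e0.
  have /cvgrPdist_lt /(_ e e0)[n _ Hn] := expr2V_cvg (2 * C).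
  have := Hn n.+1 (leqW (leqnn n)); rewrite /= sub0r normrN ger0_norm => [hn|]; last first.
    by rewrite divr_ge0 ?mulr_ge0 ?exprn_ge0.
  have [gn ln] := iterate_good n.
  have h1 := next_lipschitz T0 gn (loc_lip_V gn ln) HB u sT tT.
  have h2 := HC n.+1 s u sT; have h3 := HC n.+1 t u tT.
  have -> : y s u - y t u = (next (iterate n) s u - next (iterate n) t u)
    - (iterate n.+1 s u - y s u) + (iterate n.+1 t u - y t u) by rewrite /iterate /=; ring.
  apply: le_trans (ler_normD _ _) _; apply: le_trans (lerD (ler_normB _ _) (lexx _)) _.
  lra.
have lV := loc_lip_V gy ly.
have fix_y t u : 0 <= t -> y t u = next y t u.
  move=> t0; have [C C0 HC] := dist t t0; have [K K0 HK] := V_lip t0.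
  have tt : 0 <= t <= t by rewrite t0 lexx.
  have cS : iterate n.+1 t u @[n --> \oo] --> next y t u.
    apply/cvgrPdist_le => e e0.
    have /cvgrPdist_le /(_ e e0)[n0 _ Hn] := expr2V_cvg (K * C * t).
    exists n0 => // n /Hn; rewrite /= sub0r normrN ger0_norm => [hn|]; last first.
      by rewrite divr_ge0 ?mulr_ge0 ?exprn_ge0.
    apply: le_trans hn; have [gn ln] := iterate_good n.
    have sn := summable_V u t0 (loc_lip_V gn ln); have sy := summable_V u t0 lV.
    have -> : next y t u - iterate n.+1 t u =
        \I_(0, t) (fun s => V s (y s) u - V s (iterate n s) u).
      by rewrite (integralB' sy sn) /iterate /= /next; ring.
    have -> : K * C * t / 2 ^+ n = K * (C / 2 ^+ n) * (t - 0) by rewrite subr0; ring.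
    rewrite -integral_cst' //; apply: integral_norm_le; first exact: summableB.
      exact: summable_cst.
    move=> s /[dup] st /andP[s0 _].
    have dsn v : `|y s v - iterate n s v| <= C / 2 ^+ n by rewrite distrC; exact: HC.
    have := HK s s _ _ _ st st (gy s s0) (gn s s0) dsn u.
    by rewrite subrr normr0 add0r.
  move: cS; rewrite (cvg_shiftS (fun n => iterate n t u)) => cS.
  by rewrite /y (cvg_lim _ cS).
exists y; split=> //.
  by apply/funext => u; rewrite fix_y // /next integral_point addr0.
move=> T T0; have [C C0 HC] := quad_deriv_primitive lV T0; exists C => // s t u sT tT.
have [s0 _] := andP sT; have [t0 _] := andP tT.
by rewrite !fix_y // /next opprD addrACA subrr add0r; exact: HC.
Qed.

End picard_iteration.

(** * Barriers and Lipschitz dependence of the velocity *)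

Section barriers.
Context {R : realType}.
Implicit Types f g : R -> R.

(** The Gronwall inequality is only needed where [f] is positive, which makes
    this a barrier lemma. *)
Lemma quad_deriv_barrier f f' (K : R) : 0 <= K ->
  quad_deriv (fun t (_ : unit) => f t) (fun t _ => f' t) -> f 0 <= 0 ->
  (forall t, 0 <= t -> 0 < f t -> f' t <= K * f t) -> forall t, 0 <= t -> f t <= 0.
Proof.
move=> K0 qf f0 H t t0; have [C C0 HC] := qf t t0.
have [L L0 HL] := quad_deriv_loc_lipschitz (B := `|f' 0|) qf (fun=> lexx _) t0.
apply: (dini_gronwall K0 (T := t)) => //; last by rewrite t0 lexx.
  by apply: (lipschitz_within_continuous (K := L)) => x y xt yt; exact: HL tt xt yt.
move=> x /andP[x0 xt] fx e e0; exists (e / (C + 1)); first by rewrite divr_gt0 // ltr_wpDl.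
move=> s /andP[xs sd] st; have s01 : 0 <= s <= t by rewrite st (le_trans x0) // ltW.
have x01 : 0 <= x <= t by rewrite x0 ltW.
have := HC s x tt s01 x01; rewrite ler_norml => /andP[_ h].
have sx : 0 < s - x by rewrite subr_gt0.
have h1 : (s - x) * f' x <= (s - x) * (K * f x) by rewrite ler_pM2l //; exact: H.
have h2 : C * (s - x) ^+ 2 <= (s - x) * e.
  rewrite expr2 mulrCA ler_pM2l //; apply: (@le_trans _ _ ((C + 1) * (s - x))).
    by apply: ler_wpM2r; [exact: ltW|rewrite lerDl].
  by rewrite mulrC -ler_pdivlMr ?ltr_wpDl // lerBlDl ltW.
rewrite mulrDr; lra.
Qed.

Lemma quad_deriv_mul f f' g g' :
  quad_deriv (fun t (_ : unit) => f t) (fun t _ => f' t) ->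
  quad_deriv (fun t (_ : unit) => g t) (fun t _ => g' t) ->
  quad_deriv (fun t (_ : unit) => f t * g t) (fun t _ => f' t * g t + f t * g' t).
Proof.
move=> qf qg T T0; have [C C0 HC] := qf T T0; have [D D0 HD] := qg T T0.
have [K K0 HK] := quad_deriv_loc_lipschitz (B := `|f' 0|) qf (fun=> lexx _) T0.
have [L L0 HL] := quad_deriv_loc_lipschitz (B := `|g' 0|) qg (fun=> lexx _) T0.
have bnd (h : R -> R) (M : R) : 0 <= M -> (forall s t, 0 <= s <= T -> 0 <= t <= T ->
    `|h s - h t| <= M * `|s - t|) -> forall s, 0 <= s <= T -> `|h s| <= `|h 0| + M * T.
  move=> M0 hl s /[dup] sT /andP[s0 s1]; rewrite -[h s](subrK (h 0)) addrC.
  apply: le_trans (ler_normD _ _) _; rewrite lerD2l.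
  apply: le_trans (hl s 0 sT _) _; first by rewrite lexx.
  by rewrite subr0 ger0_norm // ler_wpM2l.
have bf := bnd f K K0 (fun s t sT tT => HK s t tt sT tT).
have bg := bnd g L L0 (fun s t sT tT => HL s t tt sT tT).
set F := `|f 0| + K * T in bf; set G := `|g 0| + L * T in bg.
have F0 : 0 <= F by rewrite addr_ge0 // mulr_ge0.
have G0 : 0 <= G by rewrite addr_ge0 // mulr_ge0.
exists (C * G + (F * D + K * L)); first by rewrite !addr_ge0 // mulr_ge0.
move=> s t [] sT tT; have h1 := HC s t tt sT tT; have h2 := HD s t tt sT tT.
have h3 := HK s t tt sT tT; have h4 := HL s t tt sT tT.
have -> : f s * g s - f t * g t - (s - t) * (f' t * g t + f t * g' t) =
  (f s - f t - (s - t) * f' t) * g t +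
  (f t * (g s - g t - (s - t) * g' t) + (f s - f t) * (g s - g t)) by ring.
rewrite [leRHS]mulrDl [X in _ <= _ + X]mulrDl.
apply: le_trans (ler_normD _ _) _; apply: lerD.
  by rewrite normrM [leRHS]mulrAC; apply: ler_pM => //; exact: bg.
apply: le_trans (ler_normD _ _) _; apply: lerD.
  by rewrite normrM -mulrA; apply: ler_pM => //; exact: bf.
rewrite normrM; have -> : K * L * (s - t) ^+ 2 = (K * `|s - t|) * (L * `|s - t|).
  by rewrite -[X in _ * X = _]ger0_norm ?sqr_ge0 // normrX; ring.
exact: ler_pM.
Qed.

End barriers.

Section lipschitz_velocity.
Context {R : realType} (lambda : R) (lambda0 : 0 < lambda).
Local Notation g := (green lambda).
Local Notation gg := (green_primitive lambda).
Implicit Types (w : R -> 'rV[R]_2) (i : 'I_2) (m f : R -> R).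

(** Lengths bounded from below control both the convolution and its division by
    the total length. *)
Lemma smear_average_lipschitz (k : R -> R) (B l Lam : R) : kernel_bound k B -> 0 < l ->
  exists2 K, 0 <= K & forall m m' f f' (D u : R),
    is_speed m -> is_speed m' -> summable_on 0 1 f -> summable_on 0 1 f' ->
    (forall v, 0 <= v <= 1 -> `|f' v| <= m' v) ->
    l <= total m -> l <= total m' -> total m' <= Lam ->
    \I_(0, 1) (fun v => `|f v - f' v|) <= D -> \I_(0, 1) (fun v => `|m v - m' v|) <= D ->
    0 <= u <= 1 ->
    `|smear k m f u - smear k m' f' u| <= K * D /\
    `|smear k m f u / total m - smear k m' f' u / total m'| <= K * D.
Proof.
move=> kB l0; have B0 := kernel_bound_ge0 kB.
set A := B + 4 * B * (`|Lam| / l).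
have A0 : 0 <= A.
  by apply: addr_ge0 => //; apply: mulr_ge0; [exact: mulr_ge0|rewrite divr_ge0 // ltW].
have Al : 0 <= A / l by rewrite divr_ge0 // ltW.
have Bl : 0 <= B / l by rewrite divr_ge0 // ltW.
exists (A + (A / l + B / l)); first exact: addr_ge0 A0 (addr_ge0 Al Bl).
move=> m m' f f' D u hm hm' sf sf' fm lm lm' mL hf hmm u01.
have M0 : 0 < total m := lt_le_trans l0 lm; have M'0 : 0 < total m' := lt_le_trans l0 lm'.
have D0 : 0 <= D by apply: le_trans hf; exact: integral_ge0'.
have [sm _ _] := hm; have [sm' _ _] := hm'.
have e1 : `|smear k m f u - smear k m' f' u| <= A * D.
  apply: le_trans (smear_speed_lipschitz kB hm hm' sf sf' fm u01) _.
  rewrite [leRHS]mulrDl; apply: lerD; first exact: ler_wpM2l.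
  apply: ler_pM => //.
    by apply: mulr_ge0; [exact: mulr_ge0|rewrite divr_ge0 // ltW].
    by apply: integral_ge0' => *.
  apply: ler_wpM2l; first by rewrite mulr_ge0.
  apply: ler_pM; [exact: ltW|by rewrite invr_ge0 ltW| |by rewrite lef_pV2].
  by apply: le_trans mL (ler_norm _).
split; first by apply: le_trans e1 _; apply: ler_wpM2r => //; rewrite lerDl addr_ge0.
have e2 : `|total m' - total m| <= D.
  rewrite distrC /total -(integralB' sm sm'); apply: le_trans hmm.
  apply: integral_norm_le; [exact: summableB|exact: summable_norm (summableB sm sm')|by []].
have e3 : `|smear k m' f' u| <= B * total m'.
  apply: le_trans (smear_norm kB hm' sf' u01) _; apply: ler_wpM2l => //.
  by apply: integral_le => //; exact: summable_norm.
have -> : smear k m f u / total m - smear k m' f' u / total m' =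
  (smear k m f u - smear k m' f' u) / total m +
  smear k m' f' u / total m' * ((total m' - total m) / total m).
  move: (smear _ _ _ _) (smear _ _ _ _) => a b; field.
  by rewrite !gt_eqF.
apply: le_trans (ler_normD _ _) _.
rewrite [leRHS](_ : _ = A * D + (A * D / l + B * (D / l))); last by ring.
rewrite -[leLHS]add0r; apply: lerD; first exact: mulr_ge0.
apply: lerD.
  rewrite normrM normfV (gtr0_norm M0); apply: ler_pM => //; rewrite ?invr_ge0 ?(ltW M0) //.
  by rewrite lef_pV2.
rewrite normrM; apply: ler_pM => //.
  by rewrite normrM normfV (gtr0_norm M'0) ler_pdivrMr.
rewrite normrM normfV (gtr0_norm M0); apply: ler_pM => //; rewrite ?invr_ge0 ?(ltW M0) //.
by rewrite lef_pV2.
Qed.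

Lemma velocity_at0 w i : velocity lambda w 0 0 i = smear gg (speed w) (coord w i) 0.
Proof. by rewrite mxE frac_part0 integral_point subr0. Qed.

Lemma vsummable_velocity_deriv w : is_density w -> (forall i, \I_(0, 1) (coord w i) = 0) ->
  vsummable (velocity_deriv lambda w).
Proof. by move=> hw w0; case: (velocity_represents lambda0 hw w0). Qed.

(** In [velocity_deriv w - velocity_deriv w'] the products [speed * tangent] are
    split so that the difference of the tangents comes with the integrable
    factor [speed w'], and the difference of the speeds with a bounded tangent. *)
Lemma velocity_lipschitz (l Lam : R) : 0 < l ->
  exists2 K, 0 <= K & forall w w', is_density w -> is_density w' ->
    (forall i, \I_(0, 1) (coord w i) = 0) -> (forall i, \I_(0, 1) (coord w' i) = 0) ->
    l <= total (speed w) -> l <= total (speed w') -> total (speed w') <= Lam ->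
    (forall i, `|velocity lambda w 0 0 i - velocity lambda w' 0 0 i| <=
      K * \I_(0, 1) (fun u => enorm (w u - w' u))) /\
    \I_(0, 1) (fun u => enorm (velocity_deriv lambda w u - velocity_deriv lambda w' u)) <=
      K * \I_(0, 1) (fun u => enorm (w u - w' u)).
Proof.
move=> l0; have [B [gB ggB _]] := green_kernel_bounds lambda0.
have [K K0 HK] := smear_average_lipschitz Lam gB l0.
have [K' K'0 HK'] := smear_average_lipschitz Lam ggB l0.
have LK : 0 <= `|Lam| * (2 * K) by rewrite !mulr_ge0.
exists (K' + (3 + `|Lam| * (2 * K))); first by rewrite !addr_ge0.
move=> w w' hw hw' w0 w'0 lw lw' wL.
have [vw _] := hw; have [vw' _] := hw'; have vd := vsummableB vw vw'.
have sd := vsummable_enorm vd; set D := \I_(0, 1) (fun u => enorm (w u - w' u)).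
have D0 : 0 <= D by apply: integral_ge0' => t _; exact: enorm_ge0.
have hm := density_speed hw; have hm' := density_speed hw'.
have dc i : \I_(0, 1) (fun v => `|coord w i v - coord w' i v|) <= D.
  apply: integral_le => //; first exact: summable_norm (summableB (vw i) (vw' i)).
  by move=> t _; have := enorm_coord (w t - w' t) i; rewrite !mxE.
have ds : \I_(0, 1) (fun v => `|speed w v - speed w' v|) <= D.
  apply: integral_le => //.
    exact: summable_norm (summableB (vsummable_enorm vw) (vsummable_enorm vw')).
  by move=> t _; exact: enorm_dist.
have cb i v : 0 <= v <= 1 -> `|coord w' i v| <= speed w' v by move=> _; exact: coord_le_speed.
split=> [i|].
  rewrite !velocity_at0; have u01 : 0 <= (0 : R) <= 1 by rewrite lexx ler01.
  have [h _] := HK' _ _ _ _ D 0 hm hm' (vw i) (vw' i) (cb i) lw lw' wL (dc i) ds u01.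
  by apply: le_trans h _; apply: ler_wpM2r => //; rewrite lerDl addr_ge0.
set q := 2 * (K * D).
have bd u : 0 <= u <= 1 ->
    enorm (velocity_deriv lambda w u - velocity_deriv lambda w' u) <=
    3 * enorm (w u - w' u) + q * speed w' u.
  move=> u01.
  have -> : velocity_deriv lambda w u - velocity_deriv lambda w' u =
    - (w u - w' u) + ((speed w u - speed w' u) *: smoothed_tangent lambda w u +
    speed w' u *: (smoothed_tangent lambda w u - smoothed_tangent lambda w' u)).
    apply/rowP => i; rewrite !mxE; move: (smear _ _ _ _) (smear _ _ _ _) => a b; ring.
  apply: le_trans (enormD _ _) _; rewrite enormN.
  have -> : 3 * enorm (w u - w' u) = enorm (w u - w' u) + enorm (w u - w' u) * 2 by ring.
  rewrite -addrA lerD2l; apply: le_trans (enormD _ _) _; rewrite !enormZ; apply: lerD.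
    apply: ler_pM => //; [exact: enorm_ge0|exact: enorm_dist|].
    rewrite -[2]mulr1; apply: enorm_le => i; exact: smoothed_tangent_bound.
  rewrite mulrC (ger0_norm (enorm_ge0 _)); apply: ler_wpM2r; first exact: enorm_ge0.
  apply: enorm_le => i; rewrite !mxE.
  by have [_] := HK _ _ _ _ D u hm hm' (vw i) (vw' i) (cb i) lw lw' wL (dc i) ds u01.
have ss' := vsummable_enorm vw'.
have vv := vsummableB (vsummable_velocity_deriv hw w0) (vsummable_velocity_deriv hw' w'0).
have h1 := integral_le (vsummable_enorm vv) (summableD (summableZ 3 sd) (summableZ q ss')) bd.
apply: le_trans h1 _; rewrite (integralD' (summableZ 3 sd) (summableZ q ss')).
rewrite (integralZ' 3 sd) (integralZ' q ss') -/D.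
have q0 : 0 <= q by rewrite !mulr_ge0.
have : q * total (speed w') <= q * `|Lam| by apply: ler_wpM2l => //; exact: le_trans (ler_norm _).
rewrite -[\I_(0, 1) (fun u => enorm (w' u))]/(total (speed w')) => h2.
have h3 : 0 <= K' * D by exact: mulr_ge0.
have -> : (K' + (3 + `|Lam| * (2 * K))) * D = K' * D + (3 * D + q * `|Lam|) by rewrite /q; ring.
lra.
Qed.

Lemma velocity_at0_bound w i : is_density w -> `|velocity lambda w 0 0 i| <= total (speed w).
Proof.
move=> hw; have hm := density_speed hw; have [vw _] := hw; have [sm _ _] := hm.
have [B [_ ggB _]] := green_kernel_bounds lambda0.
rewrite velocity_at0; have u01 : 0 <= (0 : R) <= 1 by rewrite lexx ler01.
apply: integral_norm_le => //; first exact: smear_summable ggB hm (vw i) u01.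
move=> v v01; rewrite normrM -[leRHS]mulr1; apply: ler_pM => //; first exact: coord_le_speed.
by apply: green_primitive_norm => //; exact: arcB_itv.
Qed.

Lemma velocity_deriv_bound w u : is_density w -> 0 <= u <= 1 ->
  enorm (velocity_deriv lambda w u) <= 3 * speed w u.
Proof.
move=> hw u01; apply: le_trans (enormD _ _) _; rewrite enormN enormZ.
rewrite (ger0_norm (enorm_ge0 _)).
have : enorm (smoothed_tangent lambda w u) <= 2.
  by rewrite -[2]mulr1; apply: enorm_le => i; exact: smoothed_tangent_bound.
move=> /(ler_wpM2l (enorm_ge0 (w u))); rewrite -/(speed w u); lra.
Qed.

Lemma velocity_W11_norm w : is_density w -> (forall i, \I_(0, 1) (coord w i) = 0) ->
  W11_norm (velocity lambda w) <= 8 * total (speed w).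
Proof.
move=> hw w0; have hr := velocity_represents lambda0 hw w0; have [vw _] := hw.
have h := represents_W11_norm_le hr (enorm_le (fun i => velocity_at0_bound i hw)).
apply: le_trans h _; have vv := vsummable_velocity_deriv hw w0.
have := integral_le (vsummable_enorm vv) (summableZ 3 (vsummable_enorm vw))
  (fun u u01 => velocity_deriv_bound hw u01).
rewrite (integralZ' 3 (vsummable_enorm vw)) -[\I_(0, 1) (fun u => enorm (w u))]/(total (speed w)).
lra.
Qed.

End lipschitz_velocity.

(** * The rescaled flow along rays *)

Section measurable_primitive.
Context {R : realType}.

(** The integral is a pointwise limit of Riemann sums. *)
Lemma measurable_primitive (q : R -> R -> R) (t C : R) : 0 <= t ->
  (forall s, 0 <= s <= t -> measurable_fun (`[0, 1] : set R) (q s)) ->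
  (forall r s u, 0 <= r <= t -> 0 <= s <= t -> `|q r u - q s u| <= C * `|r - s|) ->
  measurable_fun (`[0, 1] : set R) (fun u => \I_(0, t) (q^~ u)).
Proof.
move=> t0 mq lq.
pose h n := t / n.+1%:R; pose S n u := \sum_(k < n.+1) h n * q (k%:R * h n) u.
have h0 n : 0 <= h n by rewrite divr_ge0.
have hin n k : (k <= n.+1)%N -> 0 <= k%:R * h n <= t.
  move=> kn; rewrite mulr_ge0 //= /h mulrCA ler_piMr // ler_pdivrMr ?ltr0Sn //.
  by rewrite mul1r ler_nat.
apply: (@measurable_fun_cvg _ _ _ _ S) => [n|u _].
  rewrite (_ : S n = fun u => \sum_(k <- enum 'I_n.+1) h n * q (k%:R * h n) u); last first.
    by apply/funext => u; rewrite /S big_enum.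
  apply: measurable_sum => k; apply: measurable_funM; first exact: measurable_cst.
  by apply: mq; apply: hin; exact: ltnW (ltn_ord k).
have err n k : (k <= n.+1)%N ->
    `|\I_(0, k%:R * h n) (q^~ u) - \sum_(j < k) h n * q (j%:R * h n) u| <=
    k%:R * (C * h n ^+ 2).
  elim: k => [_|k IH kn]; first by rewrite !mul0r integral_point big_ord0 subrr normr0.
  have e1 := primitive_increment (fun r s rt st => lq r s u rt st)
    (hin n k.+1 kn) (hin n k (ltnW kn)).
  have hE : k.+1%:R * h n - k%:R * h n = h n by rewrite -mulrBl -natrB // subSnn mul1r.
  rewrite hE in e1; rewrite big_ord_recr /=.
  move: e1 (IH (ltnW kn)).
  move: (\I_(0, k.+1%:R * h n) (q^~ u)) (\I_(0, k%:R * h n) (q^~ u)) => I1 I0.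
  move: (\sum_(_ < _) _) => s e1 {}IH; have -> : I1 - (s + h n * q (k%:R * h n) u) = (I1 - I0 - h n * q (k%:R * h n) u) + (I0 - s).
    by ring.
  apply: le_trans (ler_normD _ _) _; rewrite -natr1 mulrDl mul1r; lra.
apply/cvgrPdist_le => e e0.
have c0 : (fun n => C * t ^+ 2 * (n.+1%:R)^-1) @ \oo --> (0 : R).
  rewrite -[X in _ --> X](mulr0 (C * t ^+ 2)); apply: cvgM; first exact: cvg_cst.
  exact: cvg_harmonic.
have /cvgrPdist_le /(_ e e0)[n0 _ Hn] := c0; exists n0 => // n /Hn /=.
rewrite sub0r normrN => hn; apply: le_trans hn; apply: le_trans (ler_norm _).
have := err n n.+1 (leqnn _); have -> : n.+1%:R * h n = t by rewrite /h; field.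
move=> h1; apply: le_trans h1 _; rewrite le_eqVlt; apply/orP; left; apply/eqP; rewrite /h.
by field.
Qed.

End measurable_primitive.

Section ray_field.
Context {R : realType} (lambda : R) (lambda0 : 0 < lambda).
Local Notation g := (green lambda).
Variables (w0 : R -> 'rV[R]_2) (hd : is_density w0).
Local Notation U := ('I_2 * R)%type.
Implicit Types (x y : U -> R) (u t s T : R) (i : 'I_2).

Let r0 := speed w0.
Let L0 := total r0.
Let L0_gt0 : 0 < L0. Proof. by case: hd. Qed.
Let r0_ge0 u : 0 <= r0 u. Proof. exact: enorm_ge0. Qed.
Let r0_summable : summable_on 0 1 r0. Proof. by case: hd => h _; exact: vsummable_enorm. Qed.

Definition ray_vector x u : 'rV[R]_2 := \row_i x (i, u).
Definition ray_speed t x u : R := Num.max (enorm (ray_vector x u)) (expR (- 3 * t)).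
(** Extends the tangent constantly outside [[0, 1]], so that the estimates for
    the field hold at all points. *)
Definition unit_clamp u : R := Num.max 0 (Num.min u 1).
Definition ray_tangent t x i u : R :=
  smear g (fun v => ray_speed t x v * r0 v) (fun v => x (i, v) * r0 v) (unit_clamp u) /
  total (fun v => ray_speed t x v * r0 v).

(** The equation for the derivative [w] is an ordinary differential equation at
    each point [u], coupled through integrals only, and it changes [speed w u]
    by at most exponential factors.  So it is solved for the quotient of [w u]
    by the initial size [speed w0 u]: its values stay bounded, and the Picard
    iteration runs in the sup norm although [w] is merely integrable.  The floor
    [expR (- 3 * t)] in [ray_speed] bounds the length from below, which keeps
    the field Lipschitz. *)
Definition ray_field t x (iu : U) : R :=
  - x iu + ray_speed t x iu.2 * ray_tangent t x iu.1 iu.2.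
Definition ray_bounded t x : Prop :=
  (forall i, measurable_fun (`[0, 1] : set R) (fun u => x (i, u))) /\
  forall iu, `|x iu| <= expR (3 * t).
(** Where [w0] vanishes the direction is arbitrary, but a unit vector keeps the
    norm equal to 1 everywhere. *)
Definition ray_initial (iu : U) : R :=
  if r0 iu.2 == 0 then (iu.1 == ord0)%:R else w0 iu.2 0 iu.1 / r0 iu.2.

Lemma unit_clamp_itv u : 0 <= unit_clamp u <= 1.
Proof.
rewrite /unit_clamp le_max lexx /= ge_max ler01 /= ge_min lexx orbT //.
Qed.

Lemma unit_clamp_id u : 0 <= u <= 1 -> unit_clamp u = u.
Proof. by move=> /andP[u0 u1]; rewrite /unit_clamp (min_idPl u1) (max_idPr u0). Qed.

Lemma ray_initial_mul i u : ray_initial (i, u) * r0 u = w0 u 0 i.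
Proof.
rewrite /ray_initial /=; case: eqP => [e|/eqP n0]; last by rewrite divfK.
by rewrite (enorm_eq0 e) mxE e mulr0.
Qed.

Lemma ray_initial_norm u : enorm (ray_vector ray_initial u) = 1.
Proof.
have [e|n0] := eqVneq (r0 u) 0.
  apply/eqP; rewrite -(@pexpr_eq1 _ _ 2) ?enorm_ge0 // sqr_enorm /dot !mxE /ray_initial /=.
  by rewrite e eqxx /= mulr0 addr0 mulr1.
have -> : ray_vector ray_initial u = (r0 u)^-1 *: w0 u.
  by apply/rowP => i; rewrite !mxE /ray_initial /= (negbTE n0) mulrC.
by rewrite enormZ normfV (ger0_norm (r0_ge0 u)) mulVf.
Qed.

Lemma ray_initial_bounded t : 0 <= t -> ray_bounded t ray_initial.
Proof.
move=> t0; split=> [i|[i u]]; last first.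
  apply: (@le_trans _ _ 1); last by rewrite expR_ge1 // mulr_ge0.
  by rewrite -(ray_initial_norm u); have := enorm_coord (ray_vector ray_initial u) i; rewrite mxE.
have [vw _] := hd; have mr := summable_measurable r0_summable.
have -> : (fun u => ray_initial (i, u)) = (fun u => if r0 u == 0 then (i == ord0)%:R
  else w0 u 0 i / r0 u) by [].
have me : measurable_fun (`[0, 1] : set R) (fun u => r0 u == 0).
  by apply: (measurable_fun_eqr mr); exact: measurable_cst.
have mi := @measurable_itv R `[0, 1].
apply: (measurable_fun_if mi me); first exact: measurable_cst.
apply: (@measurable_funS _ _ _ _ (`[0, 1] : set R)) => //.
apply: measurable_funM; first exact: summable_measurable (vw i).
rewrite (_ : (fun v : R => (r0 v)^-1) = fun v => r0 v `^ (-1)); last first.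
  by apply/funext => v; rewrite powR_inv1.
exact: (measurableT_comp (measurable_powR (-1)) mr).
Qed.

Lemma ray_speed_measurable t x : ray_bounded t x ->
  measurable_fun (`[0, 1] : set R) (ray_speed t x).
Proof.
move=> [mx _]; apply: measurable_maxr; last exact: measurable_cst.
apply: measurable_enorm => i; rewrite (_ : (fun u => _) = fun u => x (i, u)) //.
by apply/funext => u; rewrite mxE.
Qed.

Lemma ray_speed_bounds t T x u : 0 <= t <= T -> ray_bounded t x ->
  expR (- 3 * T) <= ray_speed t x u /\ ray_speed t x u <= 2 * expR (3 * T).
Proof.
move=> /andP[t0 tT] [_ bx]; have T0 : 0 <= T by apply: le_trans tT.
have e1 : expR (3 * t) <= expR (3 * T) by rewrite ler_expR ler_wpM2l.
split; first by rewrite /ray_speed le_max [X in _ || X]ler_expR ler_wnM2l ?orbT // lerN10.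
rewrite /ray_speed ge_max; apply/andP; split.
  apply: enorm_le => i; rewrite mxE; exact: le_trans (bx _) e1.
apply: (@le_trans _ _ 1); first by rewrite -expR0 ler_expR mulNr oppr_le0 mulr_ge0.
by have := expR_ge1 (mulr_ge0 (ler0n _ 3) T0); lra.
Qed.

Lemma ray_speed_lipschitz s t x y d u : 0 <= s -> 0 <= t -> (forall iu, `|x iu - y iu| <= d) ->
  `|ray_speed s x u - ray_speed t y u| <= 3 * `|s - t| + 2 * d.
Proof.
move=> s0 t0 xy.
have d0 : 0 <= d by apply: le_trans (xy (ord0, 0)).
have h1 : `|enorm (ray_vector x u) - enorm (ray_vector y u)| <= 2 * d.
  apply: le_trans (enorm_dist _ _) _; apply: enorm_le => i; rewrite !mxE; exact: xy.
have h2 : `|expR (- 3 * s) - expR (- 3 * t)| <= 3 * `|s - t|.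
  have H := @derive_lipschitz _ (fun z : R => expR (- 3 * z)) (fun z => - 3 * expR (- 3 * z)) 0
    (Num.max s t) 3.
  apply: H.
  - by move=> z; exact: is_derive_expR_scaled.
  - move=> z /andP[z0 _]; rewrite normrM normrN (ger0_norm (ler0n _ 3)) (ger0_norm (expR_ge0 _)).
    by rewrite ler_piMr // -expR0 ler_expR mulNr oppr_le0 mulr_ge0.
  - by rewrite s0 le_max lexx.
  - by rewrite t0 le_max lexx orbT.
move: h1 h2; rewrite /ray_speed; set a := enorm _; set b := enorm _; set c := expR _; set e := expR _.
have := normr_ge0 (s - t); rewrite !ler_norml.
by move=> ? /andP[? ?] /andP[? ?]; apply/andP; split; case: (leP a c) => ?; case: (leP b e) => ?; lra.
Qed.

Lemma ray_speed_is_speed t T x : 0 <= t <= T -> ray_bounded t x ->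
  [/\ is_speed (fun v => ray_speed t x v * r0 v),
      expR (- 3 * T) * L0 <= total (fun v => ray_speed t x v * r0 v) &
      total (fun v => ray_speed t x v * r0 v) <= 2 * expR (3 * T) * L0].
Proof.
move=> tT hx; have b u := ray_speed_bounds u tT hx.
have c0 u : 0 <= ray_speed t x u by case: (b u) => h _; apply: le_trans h; exact: expR_ge0.
have ss : summable_on 0 1 (fun v => ray_speed t x v * r0 v).
  have bb v : 0 <= v <= 1 -> `|ray_speed t x v| <= 2 * expR (3 * T).
    by move=> _; rewrite ger0_norm //; case: (b v).
  have := summable_mul_bounded r0_summable (ray_speed_measurable hx) bb.
  by apply: eq_integrable => // v _ /=; rewrite mulrC.
have h1 : expR (- 3 * T) * L0 <= total (fun v => ray_speed t x v * r0 v).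
  rewrite /L0 /total -(integralZ' _ r0_summable); apply: integral_le => //; first exact: summableZ.
  by move=> v _; apply: ler_wpM2r => //; case: (b v).
split=> //; last first.
  rewrite /L0 /total -(integralZ' (2 * expR (3 * T)) r0_summable); apply: integral_le => //.
    exact: summableZ.
  by move=> v _; apply: ler_wpM2r => //; case: (b v).
split=> //; first by move=> u _; exact: mulr_ge0.
by apply: lt_le_trans h1; rewrite mulr_gt0 // expR_gt0.
Qed.

Lemma ray_coord_summable t x i : ray_bounded t x -> summable_on 0 1 (fun v => x (i, v) * r0 v).
Proof.
move=> [mx bx]; have := summable_mul_bounded r0_summable (mx i) (fun v _ => bx (i, v)).
by apply: eq_integrable => // v _ /=; rewrite mulrC.
Qed.

Lemma ray_coord_le_speed t x i v : `|x (i, v) * r0 v| <= ray_speed t x v * r0 v.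
Proof.
rewrite normrM (ger0_norm (r0_ge0 v)); apply: ler_wpM2r => //.
by rewrite /ray_speed le_max; have := enorm_coord (ray_vector x v) i; rewrite mxE => ->.
Qed.

Lemma ray_tangent_bound t x i u : 0 <= t -> ray_bounded t x -> `|ray_tangent t x i u| <= 1.
Proof.
move=> t0 hx; have tt : 0 <= t <= t by rewrite t0 lexx.
have [hs _ _] := ray_speed_is_speed tt hx; have [_ _ M0] := hs.
rewrite /ray_tangent normrM normfV (gtr0_norm M0) ler_pdivrMr // mul1r.
apply: smear_green_le_total => //; [exact: ray_coord_summable hx| |exact: unit_clamp_itv].
by move=> v _; exact: ray_coord_le_speed.
Qed.

Lemma ray_field_bound t x iu : 0 <= t -> ray_bounded t x -> `|ray_field t x iu| <= 3 * expR (3 * t).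
Proof.
move=> t0 hx; have tt : 0 <= t <= t by rewrite t0 lexx.
have [h1 h2] := ray_speed_bounds iu.2 tt hx; have := ray_tangent_bound iu.1 iu.2 t0 hx.
have s0 : 0 <= ray_speed t x iu.2 by apply: le_trans h1; exact: expR_ge0.
move=> /(ler_wpM2l s0) h3; have [_ /(_ iu) h4] := hx.
apply: le_trans (ler_normD _ _) _; rewrite normrN normrM (ger0_norm s0); lra.
Qed.

Lemma ray_field_lipschitz T : 0 <= T -> exists2 K, 0 <= K &
  forall s t x y d, 0 <= s <= T -> 0 <= t <= T -> ray_bounded s x -> ray_bounded t y ->
    (forall u : U, `|x u - y u| <= d) ->
    forall u : U, `|ray_field s x u - ray_field t y u| <= K * (`|s - t| + d).
Proof.
move=> T0; have [B [gB _ _]] := green_kernel_bounds lambda0.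
have l0 : 0 < expR (- 3 * T) * L0 by rewrite mulr_gt0 // expR_gt0.
have [K K0 HK] := smear_average_lipschitz (2 * expR (3 * T) * L0) gB l0.
set c := 2 * expR (3 * T) * (K * (3 * L0)).
have c0 : 0 <= c by rewrite !mulr_ge0 ?expR_ge0 // ltW.
exists (6 + c); first exact: addr_ge0.
move=> s t x y d sT tT hx hy xy [i u].
have [s0 _] := andP sT; have [t0 _] := andP tT.
have d0 : 0 <= d by apply: le_trans (xy (ord0, 0)).
have n0 := normr_ge0 (s - t).
set D := `|s - t| + d; have D0 : 0 <= D by exact: addr_ge0.
have [hsx lx ux] := ray_speed_is_speed sT hx; have [hsy ly uy] := ray_speed_is_speed tT hy.
have [sx _ _] := hsx; have [sy _ _] := hsy.
have scx := ray_coord_summable i hx; have scy := ray_coord_summable i hy.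
have lipm v : `|ray_speed s x v - ray_speed t y v| <= 3 * D.
  by have := ray_speed_lipschitz v s0 t0 xy; rewrite /D; lra.
have e1 : \I_(0, 1) (fun v => `|x (i, v) * r0 v - y (i, v) * r0 v|) <= D * (3 * L0).
  rewrite mulrCA /L0 /total mulrA -(integralZ' (3 * D) r0_summable); apply: integral_le.
  - exact: summable_norm (summableB scx scy).
  - exact: summableZ.
  move=> v _; rewrite -mulrBl normrM (ger0_norm (r0_ge0 v)); apply: ler_wpM2r => //.
  by apply: le_trans (xy _) _; rewrite /D; lra.
have e2 : \I_(0, 1) (fun v => `|ray_speed s x v * r0 v - ray_speed t y v * r0 v|) <= D * (3 * L0).
  rewrite mulrCA /L0 /total mulrA -(integralZ' (3 * D) r0_summable); apply: integral_le.
  - exact: summable_norm (summableB sx sy).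
  - exact: summableZ.
  by move=> v _; rewrite -mulrBl normrM (ger0_norm (r0_ge0 v)); apply: ler_wpM2r.
have tanl : `|ray_tangent s x i u - ray_tangent t y i u| <= K * (D * (3 * L0)).
  by have [] := HK _ _ _ _ _ (unit_clamp u) hsx hsy scx scy
    (fun v _ => ray_coord_le_speed t y i v) lx ly uy e1 e2 (unit_clamp_itv u).
have tb := ray_tangent_bound i u s0 hx.
have [h1 h2] := ray_speed_bounds u tT hy.
have my0 : 0 <= ray_speed t y u by apply: le_trans h1; exact: expR_ge0.
rewrite /ray_field /=.
move: tanl tb (lipm u) (xy (i, u)) h2 my0; move: (ray_tangent _ _ _ _) (ray_tangent _ _ _ _).
move: (ray_speed _ _ _) (ray_speed _ _ _) (x (i, u)) (y (i, u)) => m' m a b p' p h1' h2' h3' h4' h5' m0.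
have -> : - a + m * p - (- b + m' * p') = - (a - b) + ((m - m') * p + m' * (p - p')) by ring.
apply: le_trans (ler_normD _ _) _; rewrite normrN.
have -> : (6 + c) * D = 3 * D + (3 * D * 1 + c * D) by ring.
apply: lerD; first by rewrite /D; lra.
apply: le_trans (ler_normD _ _) _; rewrite !normrM (ger0_norm m0); apply: lerD.
  exact: ler_pM.
by have := ler_pM m0 (normr_ge0 (p - p')) h5' h1'; rewrite /c; lra.
Qed.

Lemma ray_field_measurable t x i : 0 <= t -> ray_bounded t x ->
  measurable_fun (`[0, 1] : set R) (fun u => ray_field t x (i, u)).
Proof.
move=> t0 hx; have tt : 0 <= t <= t by rewrite t0 lexx.
have [hs _ _] := ray_speed_is_speed tt hx; have [mx _] := hx.
apply: measurable_funD; first exact: measurableT_comp.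
apply: measurable_funM; first exact: ray_speed_measurable.
have [B [gB _ _]] := green_kernel_bounds lambda0.
have mc := continuous_measurable (smear_continuous gB hs (ray_coord_summable i hx)).
apply: (eq_measurable_fun (fun u => smear g (fun v => ray_speed t x v * r0 v)
  (fun v => x (i, v) * r0 v) u / total (fun v => ray_speed t x v * r0 v))).
  by move=> u; rewrite inE /= in_itv /= => u01; rewrite /ray_tangent unit_clamp_id.
by apply: measurable_funM => //; exact: measurable_cst.
Qed.

(** The field is at most [3 * expR (3 * s)], whose primitive is exactly
    [expR (3 * t) - 1]; this explains the exponent in [ray_bounded]. *)
Lemma ray_step (x : R -> U -> R) : (forall t, 0 <= t -> ray_bounded t (x t)) ->
  loc_lipschitz (fun t => ray_field t (x t)) ->
  forall t, 0 <= t ->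
    ray_bounded t (fun u : U => ray_initial u + \I_(0, t) (fun s => ray_field s (x s) u)).
Proof.
move=> hx lf t t0; have [C C0 HC] := lf t t0; split=> [i|iu].
  apply: measurable_funD; first by case: (ray_initial_bounded t0).
  apply: (@measurable_primitive _ (fun s u => ray_field s (x s) (i, u)) t C t0) => [s /andP[s0 _]|].
    by apply: ray_field_measurable => //; exact: hx.
  by move=> r s u; exact: HC.
apply: le_trans (ler_normD _ _) _.
have h0 : `|ray_initial iu| <= 1.
  by have [_ /(_ iu)] := ray_initial_bounded (lexx 0); rewrite mulr0 expR0.
have se : summable_on 0 t (fun s => 3 * expR (3 * s)).
  apply: continuous_summable; apply: continuous_subspaceT => z.
  apply: cvgM; [exact: cvg_cst|apply: continuous_comp; [|exact: continuous_expR]].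
  by apply: cvgM; [exact: cvg_cst|exact: cvg_id].
have sf : summable_on 0 t (fun s => ray_field s (x s) iu).
  by apply: continuous_summable; apply: (lipschitz_within_continuous (K := C)) => r s rt st; exact: HC.
have := integral_norm_le sf se (fun s st => ray_field_bound iu (proj1 (andP st)) (hx s (proj1 (andP st)))).
by have := integral_expR 3 t0; lra.
Qed.

Lemma ray_limit t (xn : nat -> U -> R) x : 0 <= t -> (forall n, ray_bounded t (xn n)) ->
  (forall u : U, xn n u @[n --> \oo] --> x u) -> ray_bounded t x.
Proof.
move=> t0 hn cx; split=> [i|iu].
  apply: (@measurable_fun_cvg _ _ _ _ (fun n u => xn n (i, u))) => [n|u _]; last exact: cx.
  by case: (hn n).
apply: (cvgr_to_le (cvg_norm (cx iu))); near=> n; by case: (hn n) => _; exact.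
Unshelve. all: by end_near.
Qed.

End ray_field.

(** * Existence of the rescaled flow *)

Section rescaled_flow.
Context {R : realType} (lambda : R) (lambda0 : 0 < lambda).
Local Notation g := (green lambda).
Local Notation U := ('I_2 * R)%type.

(** The velocity is a closed curve: [green] preserves the integral. *)
Lemma velocity_deriv_mean w i : is_density w ->
  summable_on 0 1 (fun u => velocity_deriv lambda w u 0 i) /\
  \I_(0, 1) (fun u => velocity_deriv lambda w u 0 i) = 0.
Proof.
move=> hw; have hm := density_speed hw; have [vw M0] := hw.
have [ss _] := smear_primitive_prim lambda0 hm (vw i).
have E u : velocity_deriv lambda w u 0 i =
    smear g (speed w) (coord w i) u * (speed w u / total (speed w)) - w u 0 i.
  by rewrite !mxE; move: (smear _ _ _ _) => c; ring.
have -> : (fun u => velocity_deriv lambda w u 0 i) = fun u =>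
    smear g (speed w) (coord w i) u * (speed w u / total (speed w)) - w u 0 i.
  by apply/funext.
split; first exact: summableB.
rewrite (integralB' ss (vw i)).
by have -> := smear_green_total lambda0 hm (vw i); rewrite subrr.
Qed.

Section density_flow.
Variables (w0 : R -> 'rV[R]_2) (hd : is_density w0) (w0i : forall i, \I_(0, 1) (coord w0 i) = 0).
Local Notation L0 := (total (speed w0)).

Let ray_flow : exists z : R -> U -> R, [/\ z 0 = ray_initial w0,
  forall t, 0 <= t -> ray_bounded t (z t) &
  quad_deriv z (fun t => ray_field lambda w0 t (z t))].
Proof.
apply: (@picard _ _ (ray_field lambda w0) (ray_initial w0) (@ray_bounded R)).
- exact: ray_field_lipschitz.
- move=> T T0; exists (3 * expR (3 * T)); first by rewrite mulr_ge0 // expR_ge0.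
  move=> t x u /andP[t0 tT] hx; apply: le_trans (ray_field_bound lambda0 hd u t0 hx) _.
  by rewrite ler_pM2l // ler_expR ler_pM2l.
- exact: ray_initial_bounded.
- exact: ray_step.
- exact: ray_limit.
Qed.

(** The floor in [ray_speed] is never felt: [enorm (z t u) ^+ 2] cannot cross
    the barrier [expR (- 6 * t)] downwards. *)
Let ray_floor (z : R -> U -> R) : z 0 = ray_initial w0 ->
  (forall t, 0 <= t -> ray_bounded t (z t)) ->
  quad_deriv z (fun t => ray_field lambda w0 t (z t)) ->
  forall t u, 0 <= t -> ray_speed t (z t) u = enorm (ray_vector (z t) u).
Proof.
move=> z0 bz qz t u t0.
suff : expR (- 3 * t) <= enorm (ray_vector (z t) u) by move=> h; rewrite /ray_speed (max_idPl h).
rewrite -ler_sqr ?nnegrE ?expR_ge0 ?enorm_ge0 // sqr_enorm -subr_le0.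
have exp2 (s : R) : expR (- 3 * s) ^+ 2 = expR (- 6 * s).
  by rewrite -expRM_natl; congr expR; ring.
pose d s := dot (ray_vector (z s) u) (ray_vector (z s) u).
pose d' s := 2 * (z s (ord0, u) * ray_field lambda w0 s (z s) (ord0, u) +
  z s (ord_max, u) * ray_field lambda w0 s (z s) (ord_max, u)).
have qi i : quad_deriv (fun s (_ : unit) => z s (i, u))
    (fun s _ => ray_field lambda w0 s (z s) (i, u)).
  by move=> T /qz[C C0 HC]; exists C => // s r _; exact: HC.
have qd : quad_deriv (fun s (_ : unit) => d s) (fun s _ => d' s).
  move=> T T0; have [C C0 HC] := quad_deriv_mul (qi ord0) (qi ord0) T0.
  have [D D0 HD] := quad_deriv_mul (qi ord_max) (qi ord_max) T0.
  exists (C + D); first exact: addr_ge0.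
  move=> s r [] sT rT; rewrite [leRHS]mulrDl.
  apply: le_trans (lerD (HC s r tt sT rT) (HD s r tt sT rT)).
  apply: le_trans (ler_normD _ _); rewrite le_eqVlt; apply/orP; left; apply/eqP.
  rewrite /d /d' /dot !mxE; move: (ray_field _ _ _ _ _) (ray_field _ _ _ _ _) => a b.
  by congr `|_|; ring.
have := @quad_deriv_barrier _ (fun s => expR (- 6 * s) - d s)
  (fun s => - 6 * expR (- 6 * s) - d' s) 0 (lexx 0) (quad_derivB (quad_deriv_expR (- 6)) qd).
rewrite exp2; apply=> //.
  by rewrite mulr0 expR0 /d z0 -sqr_enorm ray_initial_norm // expr1n subrr.
move=> s s0; rewrite subr_gt0 mul0r -exp2 => low; rewrite /d'.
have hm : ray_speed s (z s) u = expR (- 3 * s).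
  rewrite /ray_speed; apply/max_idPr; rewrite -ler_sqr ?nnegrE ?expR_ge0 ?enorm_ge0 //.
  by rewrite sqr_enorm; exact: ltW.
have tb i := ray_tangent_bound lambda0 hd i u s0 (bz s s0).
have db i : `|z s (i, u)| <= expR (- 3 * s).
  rewrite -hm; apply: le_trans (_ : enorm (ray_vector (z s) u) <= _).
    by have := enorm_coord (ray_vector (z s) u) i; rewrite mxE.
  by rewrite /ray_speed le_max lexx.
have e0 := expR_ge0 (- 3 * s).
rewrite /ray_field /= hm; move: (tb ord0) (tb ord_max) (db ord0) (db ord_max) low; rewrite /d /dot !mxE.
move: (ray_tangent _ _ _ _ _ _) (ray_tangent _ _ _ _ _ _) (z s (ord0, u)) (z s (ord_max, u)) => q p a b.
move: (expR (- 3 * s)) e0 => c c0 hp hq ha hb low.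
have prod (x y : R) : `|x| <= c -> `|y| <= 1 -> - c <= x * y.
  move=> hx hy; have := ler_pM (normr_ge0 x) (normr_ge0 y) hx hy.
  by rewrite -normrM mulr1 ler_norml => /andP[].
have := ler_wpM2l c0 (prod a p ha hp); have := ler_wpM2l c0 (prod b q hb hq); nra.
Qed.

(** Multiplying back by the initial size turns sup norm estimates for the rays
    into [L^1] estimates for the derivative.  Its mean stays zero because its
    rate of change has mean zero. *)
Theorem density_flow : exists w : R -> R -> 'rV[R]_2, [/\ w 0 = w0,
  forall t, 0 <= t -> is_density (w t),
  forall t i, 0 <= t -> \I_(0, 1) (coord (w t) i) = 0,
  forall T, 0 <= T -> exists2 l, 0 < l & forall t, 0 <= t <= T -> l <= total (speed (w t)) &
  forall T, 0 <= T -> exists2 C, 0 <= C & forall s t, 0 <= s <= T -> 0 <= t <= T ->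
    [/\ total (speed (w t)) <= C, \I_(0, 1) (fun u => enorm (w s u - w t u)) <= C * `|s - t| &
     \I_(0, 1) (fun u => enorm (w s u - w t u - (s - t) *: velocity_deriv lambda (w t) u)) <=
       C * (s - t) ^+ 2]].
Proof.
have [z [z0 bz qz]] := ray_flow; have fz := ray_floor z0 bz qz.
pose w t u : 'rV[R]_2 := speed w0 u *: ray_vector (z t) u.
have wE t u i : w t u 0 i = z t (i, u) * speed w0 u by rewrite !mxE mulrC.
have [vw0 L00] := hd; have sr := vsummable_enorm vw0.
have sw t u : 0 <= t -> speed (w t) u = ray_speed t (z t) u * speed w0 u.
  by move=> t0; rewrite fz // /speed enormZ ger0_norm ?enorm_ge0 // mulrC.
have cw t i : coord (w t) i = fun u => z t (i, u) * speed w0 u.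
  by apply/funext => u; exact: wE.
have vw t : 0 <= t -> vsummable (w t).
  by move=> t0 i; rewrite -[fun u => _]/(coord (w t) i) cw; exact: ray_coord_summable (bz t t0).
have tw t : 0 <= t -> total (speed (w t)) = total (fun v => ray_speed t (z t) v * speed w0 v).
  by move=> t0; congr total; apply/funext => u; exact: sw.
have dw t : 0 <= t -> is_density (w t).
  move=> t0; split; first exact: vw.
  have tt : 0 <= t <= t by rewrite t0 lexx.
  by rewrite tw //; have [[]] := ray_speed_is_speed hd tt (bz t t0).
have fieldE t u i : 0 <= t -> 0 <= u <= 1 ->
    velocity_deriv lambda (w t) u 0 i = ray_field lambda w0 t (z t) (i, u) * speed w0 u.
  move=> t0 u01; rewrite /velocity_deriv !mxE sw // tw // cw (_ : speed (w t) = fun v =>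
    ray_speed t (z t) v * speed w0 v); last by apply/funext => v; exact: sw.
  rewrite /ray_field /ray_tangent /= unit_clamp_id //.
  by move: (smear _ _ _ _) (total _) => a b; ring.
have quad T : 0 <= T -> exists2 C, 0 <= C & forall s t i u, 0 <= s <= T -> 0 <= t <= T ->
    0 <= u <= 1 ->
    `|coord (w s) i u - coord (w t) i u| <= C * `|s - t| * speed w0 u /\
    `|coord (w s) i u - coord (w t) i u - (s - t) * velocity_deriv lambda (w t) u 0 i| <=
      C * (s - t) ^+ 2 * speed w0 u.
  move=> T0; have [C C0 HC] := qz T T0.
  have b0 iu : `|ray_field lambda w0 0 (z 0) iu| <= 3 * expR (3 * 0).
    by apply: ray_field_bound => //; exact: bz.
  have [D D0 HD] := quad_deriv_loc_lipschitz qz b0 T0.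
  exists (C + D) => [|s t i u sT tT u01]; first exact: addr_ge0.
  have r0 : 0 <= speed w0 u by exact: enorm_ge0.
  have [t0 _] := andP tT.
  rewrite !cw; split.
    rewrite -mulrBl normrM (ger0_norm r0); apply: ler_wpM2r => //.
    by apply: le_trans (HD s t (i, u) sT tT) _; apply: ler_wpM2r => //; rewrite lerDr.
  rewrite fieldE // mulrA -!mulrBl normrM (ger0_norm r0); apply: ler_wpM2r => //.
  apply: le_trans (HC s t (i, u) sT tT) _; apply: ler_wpM2r; first exact: sqr_ge0.
  by rewrite lerDl.
have quadv T : 0 <= T -> exists2 C, 0 <= C & forall s t u, 0 <= s <= T -> 0 <= t <= T ->
    0 <= u <= 1 ->
    enorm (w s u - w t u) <= C * `|s - t| * speed w0 u /\
    enorm (w s u - w t u - (s - t) *: velocity_deriv lambda (w t) u) <=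
      C * (s - t) ^+ 2 * speed w0 u.
  move=> T0; have [C C0 HC] := quad T T0; exists (2 * C) => [|s t u sT tT u01].
    by rewrite mulr_ge0.
  have assoc (x : R) : 2 * C * x * speed w0 u = 2 * (C * x * speed w0 u) by ring.
  rewrite !assoc; split; apply: enorm_le => i.
    by have [h _] := HC s t i u sT tT u01; rewrite entryB.
  by have [_ h] := HC s t i u sT tT u01; rewrite 2!entryB (entryZ (s - t)).
have vv t i : 0 <= t -> summable_on 0 1 (fun u => velocity_deriv lambda (w t) u 0 i).
  by move=> t0; have [] := velocity_deriv_mean i (dw t t0).
exists w; split=> //.
- by apply/funext => u; apply/rowP => i; rewrite wE z0; exact: ray_initial_mul.
- move=> t i t0.
  have qf c : quad_deriv (fun t (_ : unit) => c * \I_(0, 1) (coord (w t) i)) (fun=> fun=> 0).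
    move=> T T0; have [C C0 HC] := quad T T0.
    exists (`|c| * (C * L0)); first by rewrite !mulr_ge0 // ltW.
    move=> s r _ sT rT; have [s0 _] := andP sT; have [r0 _] := andP rT.
    have [_ m0] := velocity_deriv_mean i (dw r r0).
    rewrite mulr0 subr0 -mulrBr normrM -mulrA; apply: ler_wpM2l => //.
    have sd := summableB (vw s s0 i) (vw r r0 i); have sz := summableZ (s - r) (vv r i r0).
    have <- : \I_(0, 1) (fun u => coord (w s) i u - coord (w r) i u -
        (s - r) * velocity_deriv lambda (w r) u 0 i) =
        \I_(0, 1) (coord (w s) i) - \I_(0, 1) (coord (w r) i).
      rewrite (integralB' sd sz) (integralZ' (s - r) (vv r i r0)) m0 mulr0 subr0.
      by rewrite (integralB' (vw s s0 i) (vw r r0 i)).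
    have -> : C * L0 * (s - r) ^+ 2 = C * (s - r) ^+ 2 * L0 by ring.
    rewrite /total -(integralZ' (C * (s - r) ^+ 2) sr); apply: integral_norm_le.
    + exact: summableB.
    + exact: summableZ.
    by move=> u u01; have [_] := HC s r i u sT rT u01.
  have c0 : \I_(0, 1) (coord (w 0) i) = 0.
    apply: etrans (w0i i); apply: eq_integral_on => u _.
    by rewrite /coord wE z0; exact: ray_initial_mul.
  have up := quad_deriv_nonincreasing (qf 1) (fun _ _ => lexx 0) (lexx 0) t0.
  have dn := quad_deriv_nonincreasing (qf (-1)) (fun _ _ => lexx 0) (lexx 0) t0.
  by move: up dn; rewrite c0; move: (\I_(0, 1) (coord (w t) i)) => I; lra.
- move=> T T0; exists (expR (- 3 * T) * L0); first by rewrite mulr_gt0 // expR_gt0.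
  move=> t tT; have [t0 _] := andP tT; rewrite tw //.
  by have [] := ray_speed_is_speed hd tT (bz t t0).
move=> T T0; have [C C0 HC] := quadv T T0.
have e0 : 0 <= 2 * expR (3 * T) * L0 by rewrite mulr_ge0 ?mulr_ge0 ?expR_ge0 // ltW.
have CL : 0 <= C * L0 by rewrite mulr_ge0 // ltW.
exists (2 * expR (3 * T) * L0 + C * L0); first exact: addr_ge0.
move=> s t sT tT; have [s0 _] := andP sT; have [t0 _] := andP tT.
have vd := vsummableB (vw s s0) (vw t t0).
have vz : vsummable (fun u => (s - t) *: velocity_deriv lambda (w t) u).
  by apply: vsummableZ => i; exact: vv.
split.
- rewrite tw //; apply: le_trans (_ : 2 * expR (3 * T) * L0 <= _); last by rewrite lerDl.
  by have [] := ray_speed_is_speed hd tT (bz t t0).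
- apply: (@le_trans _ _ (C * `|s - t| * L0)); last first.
    by rewrite mulrDl mulrAC lerDr mulr_ge0.
  rewrite /total -(integralZ' (C * `|s - t|) sr); apply: integral_le.
  + exact: vsummable_enorm vd.
  + exact: summableZ.
  by move=> u u01; have [] := HC s t u sT tT u01.
apply: (@le_trans _ _ (C * (s - t) ^+ 2 * L0)); last first.
  by rewrite mulrDl mulrAC lerDr mulr_ge0 // sqr_ge0.
rewrite /total -(integralZ' (C * (s - t) ^+ 2) sr); apply: integral_le.
- exact: vsummable_enorm (vsummableB vd vz).
- exact: summableZ.
by move=> u u01; have [_] := HC s t u sT tT u01.
Qed.

End density_flow.
(** The position is recovered from the derivative by integrating the velocity of
    the base point in time. *)
Theorem rescaled_flow X0 w0 : represents X0 w0 -> is_density w0 ->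
  exists X w : R -> R -> 'rV[R]_2, [/\ X 0 = X0,
    forall t, 0 <= t -> represents (X t) (w t),
    forall t, 0 <= t -> is_density (w t) &
    forall T, 0 <= T -> exists2 C, 0 <= C & forall s t, 0 <= s <= T -> 0 <= t <= T ->
      W11_norm (fun u => X s u - X t u - (s - t) *: velocity lambda (w t) u) <= C * (s - t) ^+ 2].
Proof.
move=> h0 hd; have [_ w0i X0E] := h0.
have [w [wE dw wi wl wC]] := density_flow hd w0i.
pose q i t := velocity lambda (w t) 0 0 i.
have lq T : 0 <= T -> exists2 C, 0 <= C & forall i s t, 0 <= s <= T -> 0 <= t <= T ->
    `|q i s - q i t| <= C * `|s - t|.
  move=> T0; have [l l0 Hl] := wl T T0; have [C C0 HC] := wC T T0.
  have [K K0 HK] := velocity_lipschitz lambda0 C l0.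
  exists (K * C) => [|i s t sT tT]; first exact: mulr_ge0.
  have [s0 _] := andP sT; have [t0 _] := andP tT; have [h1 h2 _] := HC s t sT tT.
  have [h _] := HK _ _ (dw s s0) (dw t t0) (wi s ^~ s0) (wi t ^~ t0) (Hl s sT) (Hl t tT) h1.
  by apply: le_trans (h i) _; rewrite -mulrA; apply: ler_wpM2l.
pose X t u : 'rV[R]_2 :=
  \row_i (X0 0 0 i + \I_(0, t) (q i) + \I_(0, frac_part u) (coord (w t) i)).
have XE t u i : X t u 0 i =
    X0 0 0 i + \I_(0, t) (q i) + \I_(0, frac_part u) (coord (w t) i) by rewrite mxE.
have hX t : 0 <= t -> represents (X t) (w t).
  move=> t0; split=> [|i|u i]; [by case: (dw t t0)|exact: wi|].
  by rewrite !XE frac_part0 integral_point addr0.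
exists X, w; split=> //.
  apply/funext => u; apply/rowP => i.
  by rewrite XE integral_point addr0 wE [RHS]X0E.
move=> T T0; have [C C0 HC] := wC T T0; have [D D0 HD] := lq T T0.
exists (2 * D + 2 * C) => [|s t sT tT]; first by rewrite addr_ge0 // mulr_ge0.
have [s0 _] := andP sT; have [t0 _] := andP tT; have [_ _ h] := HC s t sT tT.
have hv := representsZ (s - t) (velocity_represents lambda0 (dw t t0) (wi t ^~ t0)).
have hr := representsB (representsB (hX s s0) (hX t t0)) hv.
rewrite mulrDl -!mulrA; apply: le_trans (represents_W11_norm_le hr (c := 2 * (D * (s - t) ^+ 2)) _) _.
  apply: enorm_le => i; rewrite 2!entryB (entryZ (s - t)) !XE frac_part0 !integral_point !addr0.
  have := primitive_increment (HD i) sT tT; rewrite -/(q i t).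
  by move: (\I_(0, s) (q i)) (\I_(0, t) (q i)) => a b; congr (`|_| <= _); ring.
by rewrite lerD2l ler_pM2l.
Qed.

End rescaled_flow.

(** * Limits in time and Sobolev norms *)

Section calculus.
Context {R : realType}.

Lemma pointwise_lipschitz_continuous (f : R -> R) (a b : R) :
  (forall t, a <= t <= b -> exists M, exists2 d, 0 < d &
    forall s, a <= s <= b -> `|s - t| < d -> `|f s - f t| <= M * `|s - t|) ->
  {within `[a, b], continuous f}.
Proof.
move=> H; apply: eps_within_continuous => t tab e e0; have [M [d d0 HM]] := H t tab.
have M0 : 0 < `|M| + 1 by rewrite ltr_wpDl.
exists (Num.min d (e / (`|M| + 1))); first by rewrite lt_min d0 divr_gt0.
move=> s sab; rewrite lt_min => /andP[sd]; rewrite ltr_pdivlMr // => h.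
apply: le_lt_trans (HM s sab sd) _.
apply: le_lt_trans h; rewrite mulrC; apply: ler_wpM2l => //.
by apply: le_trans (ler_norm _) _; rewrite lerDl.
Qed.

(** The form of [dini_gronwall] for Euler steps. *)
Lemma dini_quadratic (phi : R -> R) (C T : R) : 0 <= C ->
  {within `[0, T], continuous phi} -> phi 0 <= 0 ->
  (forall s t, 0 <= t -> t < s -> s <= T -> s <= t + 1 -> 0 < phi t ->
    phi s <= phi t + C * (s - t) ^+ 2) ->
  forall t, 0 <= t <= T -> phi t <= 0.
Proof.
move=> C0 cf f0 H; apply: (@dini_gronwall _ phi 0 T (lexx 0) cf f0).
move=> t /andP[t0 tT] ft e e0; have C1 : 0 < C + 1 by rewrite ltr_wpDl.
exists (Num.min 1 (e / (C + 1))); first by rewrite lt_min ltr01 divr_gt0.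
move=> s /andP[ts]; rewrite -ltrBlDl lt_min => /andP[s1 se] sT.
apply: le_trans (H s t t0 ts sT _ ft) _; first by rewrite -lerBlDl ltW.
rewrite lerD2l mul0r add0r expr2 mulrCA ler_pM2l ?subr_gt0 //.
move: se; rewrite ltr_pdivlMr // => se; apply: le_trans (ltW se); rewrite mulrC.
by apply: ler_wpM2l; rewrite ?lerDl // subr_ge0 ltW.
Qed.

Lemma quad_derivZ {U : Type} (c : R) (f f' : R -> U -> R) :
  quad_deriv f f' -> quad_deriv (fun t u => c * f t u) (fun t u => c * f' t u).
Proof.
move=> qf T T0; have [C C0 HC] := qf T T0; exists (`|c| * C) => [|s t u sT tT].
  exact: mulr_ge0.
rewrite (_ : _ - _ = c * (f s u - f t u - (s - t) * f' t u)); last by ring.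
by rewrite normrM -mulrA; apply: ler_wpM2l => //; exact: HC.
Qed.

(** [p] plus and minus [A * expR (- k * t)] are monotone, so they enclose the
    limit. *)
Lemma decaying_derivative_limit (p p' : R -> R) (A k : R) : 0 < k ->
  quad_deriv (fun t (_ : unit) => p t) (fun t _ => p' t) ->
  (forall t, 0 <= t -> `|p' t| <= A * k * expR (- k * t)) ->
  exists x, forall t, 0 <= t -> `|p t - x| <= A * expR (- k * t).
Proof.
move=> k0 qp bp.
have A0 : 0 <= A.
  have := le_trans (normr_ge0 _) (bp 0 (lexx 0)); rewrite mulr0 expR0 mulr1.
  by rewrite pmulr_lge0.
have qe := quad_derivZ A (quad_deriv_expR (- k)).
have qlo := quad_derivB qe qp.
have qup := quad_derivB qp (quad_derivZ (-1) qe).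
have lo := quad_deriv_nonincreasing (f := fun t => A * expR (- k * t) - p t) qlo.
have up := quad_deriv_nonincreasing (f := fun t => p t - (-1) * (A * expR (- k * t))) qup.
have {}lo s t : 0 <= s -> s <= t -> p s - A * expR (- k * s) <= p t - A * expR (- k * t).
  move=> s0 st; suff hc r : 0 <= r -> A * (- k * expR (- k * r)) - p' r <= 0.
    by have := lo hc s t s0 st; lra.
  by move=> r0; have := bp r r0; rewrite ler_norml => /andP[]; lra.
have {}up s t : 0 <= s -> s <= t -> p t + A * expR (- k * t) <= p s + A * expR (- k * s).
  move=> s0 st; suff hc r : 0 <= r -> p' r - -1 * (A * (- k * expR (- k * r))) <= 0.
    by have := up hc s t s0 st; lra.
  by move=> r0; have := bp r r0; rewrite ler_norml => /andP[]; lra.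
have e0 t : 0 <= A * expR (- k * t) by rewrite mulr_ge0 // expR_ge0.
pose E := [set p t - A * expR (- k * t) | t in [set t | 0 <= t]].
have lu s t : 0 <= s -> 0 <= t -> p s - A * expR (- k * s) <= p t + A * expR (- k * t).
  move=> s0 t0; have [st|/ltW ts] := leP s t.
    by have := lo s t s0 st; have := e0 t; lra.
  by have := up t s t0 ts; have := e0 s; lra.
have E0 : E !=set0 by exists (p 0 - A * expR (- k * 0)), 0 => //=.
exists (sup E) => t t0; rewrite ler_norml; apply/andP; split; last first.
  rewrite lerBlDr -lerBlDl; apply: sup_upper_bound; last by exists t.
  by split=> //; exists (p 0 + A * expR (- k * 0)) => _ [s s0 <-]; exact: lu.
have : sup E <= p t + A * expR (- k * t) by apply: ge_sup => // _ [s s0 <-]; exact: lu.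
lra.
Qed.

End calculus.

Section sobolev_norm.
Context {R : realType}.
Implicit Types (gamma w : R -> 'rV[R]_2).

Lemma represents_W11_norm_lin (c : R) gamma w gamma' w' :
  represents gamma w -> represents gamma' w' ->
  W11_norm (fun u => c *: gamma u + gamma' u) <= `|c| * W11_norm gamma + W11_norm gamma'.
Proof.
move=> hg hg'; rewrite (represents_W11_norm (represents_lin c hg hg')).
rewrite (represents_W11_norm hg) (represents_W11_norm hg').
have main v v' : summable_on 0 1 (fun u => enorm (v u)) -> summable_on 0 1 (fun u => enorm (v' u)) ->
    summable_on 0 1 (fun u => enorm (c *: v u + v' u)) ->
    \I_(0, 1) (fun u => enorm (c *: v u + v' u)) <=
    `|c| * \I_(0, 1) (fun u => enorm (v u)) + \I_(0, 1) (fun u => enorm (v' u)).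
  move=> sv sv' s; rewrite -(integralZ' `|c| sv) -(integralD' (summableZ `|c| sv) sv').
  apply: integral_le => //; first exact: summableD (summableZ `|c| sv) sv'.
  by move=> u _; apply: le_trans (enormD _ _) _; rewrite enormZ.
have sc (G W : R -> 'rV[R]_2) : represents G W -> summable_on 0 1 (fun u => enorm (G u)).
  by move=> hG; apply: continuous_summable; exact: represents_continuous hG.
have [vw _ _] := hg; have [vw' _ _] := hg'.
have := main _ _ (sc _ _ hg) (sc _ _ hg') (sc _ _ (represents_lin c hg hg')).
have := main _ _ (vsummable_enorm vw) (vsummable_enorm vw')
  (vsummable_enorm (vsummableD (vsummableZ c vw) vw')).
by rewrite mulrDr addrACA => h1 h2; exact: lerD h2 h1.
Qed.

Lemma represents_W11_norm_ge0 gamma w : represents gamma w -> 0 <= W11_norm gamma.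
Proof. by move=> hg; apply: le_trans (represents_sup_le 0 hg); exact: enorm_ge0. Qed.

Lemma represents_W11_normZ (c : R) gamma w : represents gamma w ->
  W11_norm (fun u => c *: gamma u) = `|c| * W11_norm gamma.
Proof.
move=> hg; rewrite (represents_W11_norm (representsZ c hg)) (represents_W11_norm hg) mulrDr.
have [vw _ _] := hg; have sg := continuous_summable (represents_continuous hg).
rewrite -(integralZ' `|c| sg) -(integralZ' `|c| (vsummable_enorm vw)).
by congr (_ + _); apply: eq_integral_on => u _; exact: enormZ.
Qed.

Lemma represents_W11_normD gamma w gamma' w' : represents gamma w -> represents gamma' w' ->
  W11_norm (fun u => gamma u + gamma' u) <= W11_norm gamma + W11_norm gamma'.
Proof.
move=> hg hg'; have := represents_W11_norm_lin 1 hg hg'; rewrite normr1 mul1r.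
have -> // : (fun u => 1 *: gamma u + gamma' u) = (fun u => gamma u + gamma' u).
by apply/funext => u; rewrite scale1r.
Qed.

Lemma represents_W11_norm_distC gamma w gamma' w' : represents gamma w -> represents gamma' w' ->
  W11_norm (fun u => gamma u - gamma' u) = W11_norm (fun u => gamma' u - gamma u).
Proof.
move=> hg hg'; rewrite -[RHS]mul1r -[X in X * _]normrN1 -(represents_W11_normZ _ (representsB hg' hg)).
by congr W11_norm; apply/funext => u; rewrite scaleN1r opprB.
Qed.

Lemma represents_W11_normB (gamma w gamma' w' : R -> 'rV[R]_2) :
  represents gamma w -> represents gamma' w' ->
  W11_norm (fun u => gamma u - gamma' u) <= W11_norm gamma + W11_norm gamma'.
Proof.
move=> hg hg'; have := represents_W11_normD hg (representsZ (-1) hg').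
rewrite (represents_W11_normZ (-1) hg') normrN1 mul1r.
have -> // : (fun u => gamma u + -1 *: gamma' u) = (fun u => gamma u - gamma' u).
by apply/funext => u; rewrite scaleN1r.
Qed.

(** Distances between two moving curves are continuous in time if the curves
    move continuously. *)
Lemma represents_dist_lipschitz (y y' z z' v v' r r' : R -> 'rV[R]_2) :
  represents y v -> represents y' v' -> represents z r -> represents z' r' ->
  `|W11_norm (fun u => y u - z u) - W11_norm (fun u => y' u - z' u)| <=
    W11_norm (fun u => y u - y' u) + W11_norm (fun u => z u - z' u).
Proof.
have half (x x' p p' q q' o o' : R -> 'rV[R]_2) : represents x q -> represents x' q' ->
    represents p o -> represents p' o' ->
    W11_norm (fun u => x u - p u) <= W11_norm (fun u => x' u - p' u) +
      (W11_norm (fun u => x u - x' u) + W11_norm (fun u => p u - p' u)).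
  move=> hx hx' hp hp'; have -> : (fun u => x u - p u) = (fun u => (x' u - p' u) +
      ((x u - x' u) + (p' u - p u))).
    by apply/funext => u; apply/rowP => i; rewrite !mxE; ring.
  apply: le_trans (represents_W11_normD (representsB hx' hp')
    (representsD (representsB hx hx') (representsB hp' hp))) _.
  rewrite lerD2l (represents_W11_norm_distC hp hp').
  exact: represents_W11_normD (representsB hx hx') (representsB hp' hp).
move=> hy hy' hz hz'; have h1 := half _ _ _ _ _ _ _ _ hy hy' hz hz'.
have := half _ _ _ _ _ _ _ _ hy' hy hz' hz.
rewrite (represents_W11_norm_distC hy' hy) (represents_W11_norm_distC hz' hz) => h2.
by rewrite ler_norml lerBlDl h1 andbT lerNl opprB lerBlDl.
Qed.

Lemma represents_len_dist gamma w gamma' w' : represents gamma w -> represents gamma' w' ->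
  `|len gamma - len gamma'| <= \I_(0, 1) (fun u => enorm (w u - w' u)) /\
  \I_(0, 1) (fun u => enorm (w u - w' u)) <= W11_norm (fun u => gamma u - gamma' u).
Proof.
move=> hg hg'; rewrite (represents_len hg) (represents_len hg').
rewrite (represents_W11_norm (representsB hg hg')).
have [vw _ _] := hg; have [vw' _ _] := hg'.
split; last by rewrite lerDr; apply: integral_ge0' => u _; exact: enorm_ge0.
have s := vsummable_enorm vw; have s' := vsummable_enorm vw'.
rewrite -(integralB' s s'); apply: integral_norm_le; first exact: summableB.
  exact: vsummable_enorm (vsummableB vw vw').
by move=> u _; exact: enorm_dist.
Qed.

Lemma represents_le_Linfty gamma w u : represents gamma w -> enorm (gamma u) <= Linfty_norm gamma.
Proof.
move=> hg; apply: sup_upper_bound; last by exists u.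
split; first by exists (enorm (gamma 0)), 0.
by exists (W11_norm gamma) => _ [v _ <-]; exact: represents_sup_le hg.
Qed.

Lemma Linfty_norm_le gamma c : (forall u, enorm (gamma u) <= c) -> Linfty_norm gamma <= c.
Proof.
by move=> H; apply: ge_sup; [exists (enorm (gamma 0)), 0|move=> _ [u _ <-]; exact: H].
Qed.

End sobolev_norm.

(** * Decay of the length and convergence of the rescaled flow *)

Section flow_properties.
Context {R : realType} (lambda : R) (lambda0 : 0 < lambda).

(** Expanding [enorm ^+ 2] and dividing by [2 * enorm x] (arithmetic-geometric
    mean) avoids differentiating the norm, which fails at the origin. *)
Lemma enorm_euler_step (x p : 'rV[R]_2) (h : R) : enorm p <= 2 ->
  enorm (x + h *: (- x + enorm x *: p)) <=
    enorm x - h * (enorm x - dot x p) + 5 * enorm x * h ^+ 2.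
Proof.
move=> p2; have [x0|xn0] := eqVneq (enorm x) 0.
  rewrite x0 (enorm_eq0 x0) oppr0 scale0r addr0 scaler0 addr0 enorm0.
  by rewrite /dot !mxE !mul0r addr0 subr0 !mulr0 !mul0r subr0 addr0.
have n0 : 0 < enorm x by rewrite lt0r xn0 enorm_ge0.
set y := x + _; have nx := sqr_enorm x; have ny := sqr_enorm y; have np := sqr_enorm p.
have yE : dot y y = (1 - h) ^+ 2 * dot x x + 2 * h * (1 - h) * enorm x * dot x p +
    h ^+ 2 * enorm x ^+ 2 * dot p p.
  by rewrite /y /dot !mxE; ring.
have cs := cauchy_schwarz x p; have p0 := enorm_ge0 p.
move: n0 nx ny np yE cs p0 p2; move: (dot y y) (dot x x) (dot p p) (dot x p) => yy xx pp xp.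
move: (enorm x) (enorm y) (enorm p) => n m q n0 <- <- <- yE cs q0 q2.
rewrite -(ler_pM2l n0).
have amgm : 2 * (n * m) <= n ^+ 2 + m ^+ 2 by have := sqr_ge0 (n - m); rewrite sqrrB; lra.
have h1 : - (n * 2) <= xp.
  by have : `|xp| <= n * 2 := le_trans cs (ler_wpM2l (ltW n0) q2); rewrite ler_norml => /andP[].
have h2 : h ^+ 2 * (n * - (n * 2)) <= h ^+ 2 * (n * xp).
  by apply: ler_wpM2l; [exact: sqr_ge0|apply: ler_wpM2l h1; exact: ltW].
have h3 : h ^+ 2 * n ^+ 2 * q ^+ 2 <= h ^+ 2 * n ^+ 2 * 2 ^+ 2.
  by apply: ler_wpM2l; [rewrite mulr_ge0 ?sqr_ge0|rewrite ler_sqr ?nnegrE].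
have h4 : 0 <= h ^+ 2 * n ^+ 2 by rewrite mulr_ge0 ?sqr_ge0.
have E1 : m ^+ 2 = n ^+ 2 - 2 * h * n ^+ 2 + h ^+ 2 * n ^+ 2 + 2 * (h * (n * xp)) -
    2 * (h ^+ 2 * (n * xp)) + h ^+ 2 * n ^+ 2 * q ^+ 2 by rewrite yE; ring.
have E2 : n * (n - h * (n - xp) + 5 * n * h ^+ 2) =
  n ^+ 2 - h * n ^+ 2 + h * (n * xp) + 5 * (h ^+ 2 * n ^+ 2) by ring.
have E3 : h ^+ 2 * (n * - (n * 2)) = - 2 * (h ^+ 2 * n ^+ 2) by ring.
rewrite E3 in h2; rewrite E2; lra.
Qed.

Let upper_algebra (a b c d h k x y : R) : a <= b - h * (k * b) + x ->
  - y <= c - d - h * (- k * d) -> 0 <= h * (k * (b - d)) -> a - c <= b - d + (x + y).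
Proof. lra. Qed.

Let step_algebra (a b d e h k m c : R) :
  a <= e + ((1 - h + 5 * h ^+ 2) * b + h * d) -> h * d <= h * (b - k * b) ->
  b * h ^+ 2 <= m * h ^+ 2 -> e <= c * h ^+ 2 ->
  a <= b - h * (k * b) + (c + 5 * m) * h ^+ 2.
Proof. lra. Qed.

Let low_algebra1 (a b d e h : R) : b <= a + (h * d + e) -> h * d <= h * (3 * b) ->
  (1 - 3 * h) * b - e <= a.
Proof. lra. Qed.

Let low_algebra2 (a b e h m c : R) : (1 - 3 * h) * b - e <= a -> e <= c * h ^+ 2 ->
  0 <= 5 * m * h ^+ 2 -> b - 3 * h * b - (c + 5 * m) * h ^+ 2 <= a.
Proof. lra. Qed.

Let lower_algebra (a b c d h x y : R) : b - 3 * h * b - x <= a ->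
  c - d - h * (- 3 * d) <= y -> 0 <= h * (d - b) -> c - a <= d - b + (x + y).
Proof. lra. Qed.

Variables X w : R -> R -> 'rV[R]_2.
Hypothesis X_rep : forall t, 0 <= t -> represents (X t) (w t).
Hypothesis w_density : forall t, 0 <= t -> is_density (w t).
Hypothesis X_quad : forall T, 0 <= T -> exists2 C, 0 <= C &
  forall s t, 0 <= s <= T -> 0 <= t <= T ->
    W11_norm (fun u => X s u - X t u - (s - t) *: velocity lambda (w t) u) <= C * (s - t) ^+ 2.

Let kappa := 4 * lambda ^+ 2 / (1 + 4 * lambda ^+ 2).
Let L t := len (X t).

Let LE t : 0 <= t -> L t = total (speed (w t)).
Proof. by move=> /X_rep/represents_len. Qed.

Let L_ge0 t : 0 <= t -> 0 <= L t.
Proof. by move=> t0; rewrite LE //; case: (w_density t0) => _ /ltW. Qed.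

Let mean0 t i : 0 <= t -> \I_(0, 1) (coord (w t) i) = 0.
Proof. by move=> /X_rep[_ h _]; exact: h. Qed.

Let velocity_rep t : 0 <= t -> represents (velocity lambda (w t)) (velocity_deriv lambda (w t)).
Proof. by move=> t0; apply: velocity_represents => //; [exact: w_density|move=> i; exact: mean0]. Qed.

Let quad_rep s t : 0 <= s -> 0 <= t ->
  represents (fun u => X s u - X t u - (s - t) *: velocity lambda (w t) u)
    (fun u => w s u - w t u - (s - t) *: velocity_deriv lambda (w t) u).
Proof.
move=> s0 t0; apply: representsB; first exact: representsB (X_rep s0) (X_rep t0).
exact: representsZ (velocity_rep t0).
Qed.

Lemma flow_step T : 0 <= T -> exists2 C, 0 <= C & forall s t, 0 <= s <= T -> 0 <= t <= T ->
  W11_norm (fun u => X s u - X t u) <= (8 * L t + C) * `|s - t|.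
Proof.
move=> T0; have [C C0 HC] := X_quad T0; exists (C * T) => [|s t sT tT]; first exact: mulr_ge0.
have [s0 s1] := andP sT; have [t0 t1] := andP tT.
have -> : (fun u => X s u - X t u) = (fun u => (s - t) *: velocity lambda (w t) u +
    (X s u - X t u - (s - t) *: velocity lambda (w t) u)).
  by apply/funext => u; rewrite [RHS]addrC subrK.
apply: le_trans (represents_W11_norm_lin (s - t) (velocity_rep t0) (quad_rep s0 t0)) _.
rewrite mulrDl; apply: lerD.
  have vb : W11_norm (velocity lambda (w t)) <= 8 * L t.
    rewrite LE //; apply: velocity_W11_norm => //; first exact: w_density.
    by move=> i; exact: mean0.
  by rewrite mulrC; exact: ler_wpM2r vb.
apply: le_trans (HC s t sT tT) _; rewrite -mulrA; apply: ler_wpM2l => //.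
have -> : (s - t) ^+ 2 = `|s - t| * `|s - t| by rewrite -normrM -expr2 ger0_norm ?sqr_ge0.
by apply: ler_wpM2r => //; rewrite ler_norml; apply/andP; split; lra.
Qed.

Let flow_continuous (f : (R -> 'rV[R]_2) -> R) :
  (forall gamma v gamma' v', represents gamma v -> represents gamma' v' ->
    `|f gamma - f gamma'| <= W11_norm (fun u => gamma u - gamma' u)) ->
  forall T, 0 <= T -> {within `[0, T], continuous (fun t => f (X t))}.
Proof.
move=> Hf T T0; have [C C0 HC] := flow_step T0.
apply: pointwise_lipschitz_continuous => t tT; exists (8 * L t + C), 1 => // s sT _.
have [s0 _] := andP sT; have [t0 _] := andP tT.
exact: le_trans (Hf _ _ _ _ (X_rep s0) (X_rep t0)) (HC s t sT tT).
Qed.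

Lemma flow_len_continuous T : 0 <= T -> {within `[0, T], continuous (fun t => len (X t))}.
Proof.
apply: flow_continuous => gamma v gamma' v' hg hg'.
by have [h1 h2] := represents_len_dist hg hg'; exact: le_trans h1 h2.
Qed.

(** One Euler step of the flow.  The upper bound is [dissipation]; the lower one
    holds because the derivative of the velocity is at most three times the
    speed. *)
Let len_step T : 0 <= T -> exists2 C, 0 <= C & forall s t, 0 <= t -> t < s -> s <= T ->
  L s <= L t - (s - t) * (kappa * L t) + C * (s - t) ^+ 2 /\
  L t - 3 * (s - t) * L t - C * (s - t) ^+ 2 <= L s.
Proof.
move=> T0; have [C C0 HC] := X_quad T0.
have [M _ HM] := EVT_max T0 (flow_len_continuous T0).
have M0 : 0 <= `|L M| by [].
exists (C + 5 * `|L M|) => [|s t t0 ts sT]; first by rewrite addr_ge0 // mulr_ge0.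
have s0 : 0 <= s by rewrite (le_trans t0) // ltW.
have tT : t <= T by rewrite (le_trans _ sT) // ltW.
have LM : L t <= `|L M|.
  by apply: le_trans (ler_norm _); apply: HM; rewrite in_itv /= t0.
set h := s - t; have h0 : 0 < h by rewrite subr_gt0.
have hw := w_density t0; have [vw LL] := hw; have [vs _] := w_density s0.
have [vv _ _] := velocity_rep t0; have sw := vsummable_enorm vw.
have vz := vsummableZ h vv; have vd := vsummableB (vsummableB vs vw) vz.
have err : \I_(0, 1) (fun u => enorm (w s u - w t u - h *: velocity_deriv lambda (w t) u)) <=
    C * h ^+ 2.
  apply: le_trans (HC s t _ _); rewrite ?s0 ?t0 //.
  rewrite (represents_W11_norm (quad_rep s0 t0)) lerDr.
  by apply: integral_ge0' => u _; exact: enorm_ge0.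
set e := fun u => enorm (w s u - w t u - h *: velocity_deriv lambda (w t) u) in err.
have se : summable_on 0 1 e by exact: vsummable_enorm vd.
have sL : L s = \I_(0, 1) (fun u => enorm (w s u)) by rewrite LE.
have tL : L t = \I_(0, 1) (fun u => enorm (w t u)) by rewrite LE.
have wE u : w s u = (w t u + h *: velocity_deriv lambda (w t) u) +
    (w s u - w t u - h *: velocity_deriv lambda (w t) u).
  by rewrite -addrA (addrC (h *: _)) subrK addrC subrK.
have ss := vsummable_enorm vs.
have tang u : 0 <= u <= 1 -> enorm (smoothed_tangent lambda (w t) u) <= 2.
  by move=> u01; rewrite -[2]mulr1; apply: enorm_le => i; exact: smoothed_tangent_bound.
split.
  have sd : summable_on 0 1 (fun u => dot (w t u) (smoothed_tangent lambda (w t) u)).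
    have si i : summable_on 0 1 (fun u => w t u 0 i * smoothed_tangent lambda (w t) u 0 i).
      apply: (@summable_mul_bounded _ _ _ _ _ 1) => //.
        have := continuous_measurable (smear_coord_continuous (i := i) lambda0 hw).
        move=> /(measurable_funM (@measurable_cst _ _ _ _ _ (total (speed (w t)))^-1)).
        apply: eq_measurable_fun => u _ /=; rewrite mxE mulrC //.
      by move=> u u01; exact: smoothed_tangent_bound.
    exact: summableD (si ord0) (si ord_max).
  have m0 i : \I_(0, 1) (coord (w t) i) = 0 by exact: mean0.
  have := dissipation lambda0 hw m0.
  rewrite -LE //; set D := \I_(0, 1) (fun u => dot (w t u) (smoothed_tangent lambda (w t) u)).
  move=> diss.
  have step u : 0 <= u <= 1 -> enorm (w s u) <= e u + ((1 - h + 5 * h ^+ 2) * enorm (w t u) +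
      h * dot (w t u) (smoothed_tangent lambda (w t) u)).
    move=> u01; rewrite {1}wE; apply: le_trans (enormD _ _) _; rewrite addrC lerD2l.
    apply: le_trans (enorm_euler_step (w t u) h (tang u u01)) _.
    by move: (dot _ _) (enorm _) => a b; rewrite le_eqVlt; apply/orP; left; apply/eqP; ring.
  have s1 := summableZ (1 - h + 5 * h ^+ 2) sw; have s2 := summableZ h sd.
  have := integral_le ss (summableD se (summableD s1 s2)) step.
  rewrite (integralD' se (summableD s1 s2)) (integralD' s1 s2).
  rewrite (integralZ' (1 - h + 5 * h ^+ 2) sw) (integralZ' h sd) -/D -sL -tL => main.
  have k1 : 0 < 1 + 4 * lambda ^+ 2 by rewrite ltr_wpDr // mulr_ge0 // sqr_ge0.
  have hD : h * D <= h * (L t - kappa * L t).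
    rewrite ler_pM2l // -(ler_pM2l k1); apply: le_trans diss _.
    by rewrite le_eqVlt; apply/orP; left; apply/eqP; rewrite /kappa; field; rewrite gt_eqF.
  exact: step_algebra main hD (ler_wpM2r (sqr_ge0 h) LM) err.
have step u : 0 <= u <= 1 -> (1 - 3 * h) * enorm (w t u) - e u <= enorm (w s u).
  move=> u01; have vb := velocity_deriv_bound lambda0 hw u01.
  have : enorm (w t u) <= enorm (w s u) + (enorm (h *: velocity_deriv lambda (w t) u) + e u).
    have {1}-> : w t u = w s u - (h *: velocity_deriv lambda (w t) u +
        (w s u - w t u - h *: velocity_deriv lambda (w t) u)).
      by rewrite (addrC (h *: _)) subrK opprB addrC subrK.
    apply: le_trans (enormB _ _) _; rewrite lerD2l; exact: enormD.
  rewrite enormZ (gtr0_norm h0) => h1.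
  exact: low_algebra1 h1 (ler_wpM2l (ltW h0) vb).
have s1 := summableZ (1 - 3 * h) sw.
have := integral_le (summableB s1 se) ss step.
rewrite (integralB' s1 se) (integralZ' (1 - 3 * h) sw) -sL -tL.
move=> main; apply: low_algebra2 main err _.
by apply: mulr_ge0; [exact: mulr_ge0|exact: sqr_ge0].
Qed.

Let kappa_gt0 : 0 < kappa.
Proof. by rewrite divr_gt0 ?mulr_gt0 ?exprn_gt0 // ltr_wpDr // mulr_ge0 // sqr_ge0. Qed.

Let exp_quad (c T : R) : 0 <= T -> exists2 C, 0 <= C &
  forall s t, 0 <= s <= T -> 0 <= t <= T ->
  `|L 0 * expR (c * s) - L 0 * expR (c * t) - (s - t) * (c * (L 0 * expR (c * t)))| <=
    C * (s - t) ^+ 2.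
Proof.
move=> T0; have [C C0 HC] := quad_derivZ (L 0) (quad_deriv_expR c) T0.
exists C => // s t sT tT; have := HC s t tt sT tT.
by have -> : c * (L 0 * expR (c * t)) = L 0 * (c * expR (c * t)) by ring.
Qed.

Let exp_continuous (c T : R) : {within `[0, T], continuous (fun t => L 0 * expR (c * t))}.
Proof.
apply: continuous_subspaceT => z; apply: cvgM; first exact: cvg_cst.
apply: continuous_comp; last exact: continuous_expR.
by apply: cvgM; [exact: cvg_cst|exact: cvg_id].
Qed.

Lemma flow_len_decay t : 0 <= t -> len (X t) <= len (X 0) * expR (- kappa * t).
Proof.
move=> t0; rewrite -subr_le0; have [C C0 HC] := len_step t0.
have [D D0 HD] := exp_quad (- kappa) t0.
apply: (@dini_quadratic _ (fun t => L t - L 0 * expR (- kappa * t)) (C + D) t).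
- exact: addr_ge0.
- by move=> x; apply: cvgB; [exact: flow_len_continuous|exact: exp_continuous].
- by rewrite mulr0 expR0 mulr1 subrr.
- move=> s r r0 rs st _ pos; have [h1 _] := HC s r r0 rs st.
  have rt : 0 <= r <= t by rewrite r0 (le_trans _ st) // ltW.
  have s01 : 0 <= s <= t by rewrite st (le_trans r0) // ltW.
  have := HD s r s01 rt; rewrite ler_norml => /andP[h2 _].
  have sr : 0 <= s - r by rewrite subr_ge0 ltW.
  rewrite mulrDl; apply: (upper_algebra h1 h2).
  exact: mulr_ge0 sr (mulr_ge0 (ltW kappa_gt0) (ltW pos)).
- by rewrite t0 lexx.
Qed.

Lemma flow_len_lower t : 0 <= t -> len (X 0) * expR (- 3 * t) <= len (X t).
Proof.
move=> t0; rewrite -subr_le0; have [C C0 HC] := len_step t0.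
have [D D0 HD] := exp_quad (- 3) t0.
apply: (@dini_quadratic _ (fun t => L 0 * expR (- 3 * t) - L t) (C + D) t).
- exact: addr_ge0.
- by move=> x; apply: cvgB; [exact: exp_continuous|exact: flow_len_continuous].
- by rewrite mulr0 expR0 mulr1 subrr.
- move=> s r r0 rs st _ pos; have [_ h1] := HC s r r0 rs st.
  have rt : 0 <= r <= t by rewrite r0 (le_trans _ st) // ltW.
  have s01 : 0 <= s <= t by rewrite st (le_trans r0) // ltW.
  have := HD s r s01 rt; rewrite ler_norml => /andP[_ h2].
  have sr : 0 <= s - r by rewrite subr_ge0 ltW.
  by rewrite mulrDl; apply: (lower_algebra h1 h2); exact: mulr_ge0 sr (ltW pos).
- by rewrite t0 lexx.
Qed.

(** The velocity field moves each point towards a weighted mean of the curve,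
    so an Euler step of length at most [1] stays in its convex hull. *)
Lemma flow_Linfty_norm t : 0 <= t -> Linfty_norm (X t) <= Linfty_norm (X 0).
Proof.
move=> t0; rewrite -subr_le0; have [C C0 HC] := X_quad t0.
have dist (gamma v gamma' v' : R -> 'rV[R]_2) : represents gamma v -> represents gamma' v' ->
    `|Linfty_norm gamma - Linfty_norm gamma'| <= W11_norm (fun u => gamma u - gamma' u).
  have half (G V G' V' : R -> 'rV[R]_2) : represents G V -> represents G' V' ->
      Linfty_norm G <= Linfty_norm G' + W11_norm (fun u => G u - G' u).
    move=> hG hG'; apply: Linfty_norm_le => u; rewrite -[G u](subrK (G' u)) addrC.
    apply: le_trans (enormD _ _) _; apply: lerD; first exact: represents_le_Linfty hG'.
    exact: represents_sup_le (representsB hG hG').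
  move=> hg hg'; have := half _ _ _ _ hg hg'; have := half _ _ _ _ hg' hg.
  rewrite (represents_W11_norm_distC hg' hg) ler_norml => h1 h2; apply/andP; split; lra.
apply: (@dini_quadratic _ (fun t => Linfty_norm (X t) - Linfty_norm (X 0)) C t) => //.
- move=> x; apply: cvgB; last exact: cvg_cst.
  by move: x; exact: flow_continuous.
- by rewrite subrr.
- move=> s r r0 rs st s1 _; have rt : 0 <= r <= t by rewrite r0 (le_trans _ st) // ltW.
  have s0 : 0 <= s by rewrite (le_trans r0) // ltW.
  have s01 : 0 <= s <= t by rewrite s0.
  rewrite addrAC lerD2r; apply: Linfty_norm_le => u.
  set h := s - r; have h0 : 0 <= h by rewrite subr_ge0 ltW.
  have h1 : 0 <= 1 - h by rewrite /h; lra.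
  have -> : X s u = ((1 - h) *: X r u + h *: (X r u + velocity lambda (w r) u)) +
      (X s u - X r u - h *: velocity lambda (w r) u).
    by apply/rowP => i; rewrite !mxE; move: (smear _ _ _ _) => c; ring.
  apply: le_trans (enormD _ _) _; apply: lerD; last first.
    by apply: le_trans (HC s r s01 rt); exact: represents_sup_le (quad_rep s0 r0).
  apply: le_trans (enormD _ _) _; rewrite !enormZ !ger0_norm //.
  have b1 := represents_le_Linfty u (X_rep r0).
  have b2 := average_bound lambda0 u (X_rep r0) (w_density r0)
    (fun v => represents_le_Linfty v (X_rep r0)).
  by have := ler_wpM2l h1 b1; have := ler_wpM2l h0 b2; lra.
- by rewrite t0 lexx.
Qed.

(** The velocity of the base point is bounded by a multiple of the length, which
    decays exponentially, and the length controls the distance to the base point. *)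
Lemma flow_limit : exists2 x : 'rV[R]_2, enorm x <= Linfty_norm (X 0) &
  exists M, forall t, 0 <= t -> W11_norm (fun u => X t u - x) <= M * expR (- kappa * t).
Proof.
have qp i : quad_deriv (fun t (_ : unit) => X t 0 0 i) (fun t _ => velocity lambda (w t) 0 0 i).
  move=> T T0; have [C C0 HC] := X_quad T0; exists C => // s t _ sT tT.
  have [s0 _] := andP sT; have [t0 _] := andP tT.
  apply: le_trans (HC s t sT tT); apply: le_trans (represents_sup_le 0 (quad_rep s0 t0)).
  have := enorm_coord (X s 0 - X t 0 - (s - t) *: velocity lambda (w t) 0) i.
  by rewrite 2!entryB (entryZ (s - t)).
set A := len (X 0) / kappa.
have bp i t : 0 <= t -> `|velocity lambda (w t) 0 0 i| <= A * kappa * expR (- kappa * t).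
  move=> t0; rewrite divfK ?gt_eqF //; apply: le_trans (flow_len_decay t0).
  by rewrite -/(L t) LE //; apply: velocity_at0_bound => //; exact: w_density.
have lim i := decaying_derivative_limit kappa_gt0 (qp i) (bp i).
have [x0 H0] := lim ord0; have [x1 H1] := lim ord_max.
pose x : 'rV[R]_2 := \row_i (if i == ord0 then x0 else x1).
have Hx i t : 0 <= t -> `|(X t 0 - x) 0 i| <= A * expR (- kappa * t).
  by move=> t0; rewrite entryB mxE; move: i; apply: ord2P; [exact: H0|exact: H1].
have E0 t : 0 < expR (- kappa * t) by exact: expR_gt0.
have A0 : 0 <= A by rewrite divr_ge0 ?(ltW kappa_gt0) // L_ge0.
exists x.
  apply/ler_addgt0Pr => e e0.
  have [t t0 ht] : exists2 t, 0 <= t & 2 * (A * expR (- kappa * t)) <= e.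
    exists (2 * A / e / kappa).
      apply: divr_ge0; last exact: ltW.
      by apply: divr_ge0; [exact: mulr_ge0|exact: ltW].
    have -> : - kappa * (2 * A / e / kappa) = - (2 * A / e) by field; rewrite !gt_eqF.
    have hy : 2 * A / e <= expR (2 * A / e) by apply: le_trans (expR_ge1Dx _); rewrite lerDr.
    rewrite expRN mulrA ler_pdivrMr ?expR_gt0 //.
    by move: hy; rewrite ler_pdivrMr // [_ * e]mulrC.
  have h1 : enorm (X t 0) <= Linfty_norm (X 0).
    by apply: le_trans (flow_Linfty_norm t0); exact: represents_le_Linfty (X_rep t0).
  have -> : x = X t 0 - (X t 0 - x) by rewrite opprB addrC subrK.
  apply: le_trans (enormB _ _) _; apply: lerD h1 _; apply: le_trans ht.
  by apply: enorm_le => i; exact: Hx.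
exists (2 * A + 2 * len (X 0)) => t t0.
have hr := representsB (X_rep t0) (represents_cst x).
have start : enorm (X t 0 - x) <= 2 * (A * expR (- kappa * t)).
  by apply: enorm_le => i; exact: Hx.
have := represents_W11_norm_le hr start; move=> /le_trans; apply.
rewrite [leRHS]mulrDl -2!mulrA lerD2l ler_pM2l //; apply: le_trans (flow_len_decay t0).
rewrite (represents_len (X_rep t0)) le_eqVlt; apply/orP; left; apply/eqP.
by apply: eq_integral_on => u _; rewrite subr0.
Qed.

End flow_properties.

(** * Uniqueness *)

Section power_function.
Context {R : realType}.

(** Through the logarithm, which maps [[l, Lam]] with [0 < l] to a bounded set. *)
Lemma powR_lipschitz (b l Lam : R) : 0 < l -> exists2 K, 0 <= K &
  forall x y, l <= x <= Lam -> l <= y <= Lam ->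
    `|x `^ b - y `^ b| <= K * `|x - y| /\ x `^ b <= K.
Proof.
move=> l0; set B := `|b| * (`|ln l| + `|ln Lam|).
have B0 : 0 <= B by rewrite mulr_ge0 // addr_ge0.
have lnB x : l <= x <= Lam -> - B <= b * ln x <= B.
  move=> /andP[lx xL]; rewrite -ler_norml normrM /B; apply: ler_wpM2l => //.
  have x0 : 0 < x := lt_le_trans l0 lx; have L0 : 0 < Lam := lt_le_trans x0 xL.
  have h1 : ln l <= ln x by rewrite ler_ln.
  have h2 : ln x <= ln Lam by rewrite ler_ln.
  have := ler_norm (ln Lam); have := ler_norm (- ln l); rewrite normrN.
  have := normr_ge0 (ln Lam); have := normr_ge0 (ln l).
  by rewrite ler_norml => ? ? ? ?; apply/andP; split; lra.
have lnl x y : l <= x <= Lam -> l <= y <= Lam -> ln x - ln y <= `|x - y| / l.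
  move=> /andP[lx xL] /andP[ly yL].
  have x0 : 0 < x := lt_le_trans l0 lx; have y0 : 0 < y := lt_le_trans l0 ly.
  rewrite -ln_div ?posrE //; have -> : x / y = 1 + (x / y - 1) by ring.
  apply: le_trans (le_ln1Dx _) _; first by rewrite ltrBrDl subrr divr_gt0.
  have -> : x / y - 1 = (x - y) / y by field; rewrite gt_eqF.
  apply: (@le_trans _ _ (`|x - y| / y)).
    by apply: ler_wpM2r; [rewrite invr_ge0 ltW|exact: ler_norm].
  by apply: ler_wpM2l => //; rewrite lef_pV2.
exists (expR B * `|b| / l + expR B).
  by rewrite addr_ge0 ?expR_ge0 // divr_ge0 ?(ltW l0) // mulr_ge0 // expR_ge0.
move=> x y xl yl; have /andP[lx _] := xl; have /andP[ly _] := yl.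
have pE z : l <= z -> z `^ b = expR (b * ln z).
  by move=> lz; rewrite /powR gt_eqF // (lt_le_trans l0).
have c0 : 0 <= expR B * `|b| / l.
  by rewrite divr_ge0 ?(ltW l0) // mulr_ge0 // expR_ge0.
rewrite !pE //; split; last first.
  apply: (@le_trans _ _ (expR B)); last by rewrite lerDr.
  by rewrite ler_expR; case/andP : (lnB x xl).
apply: (@le_trans _ _ (expR B * `|b * ln x - b * ln y|)).
  have H := @derive_lipschitz _ (fun z : R => expR (1 * z)) (fun z => 1 * expR (1 * z)) (- B) B (expR B).
  have := H (is_derive_expR_scaled 1) _ _ _ (lnB x xl) (lnB y yl); rewrite !mul1r; apply.
  by move=> z /andP[_ zB]; rewrite !mul1r ger0_norm ?expR_ge0 // ler_expR.
rewrite mulrDl; apply: (@le_trans _ _ (expR B * `|b| / l * `|x - y|)); last first.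
  by rewrite lerDl mulr_ge0 // expR_ge0.
rewrite -mulrBr normrM -!mulrA; apply: ler_wpM2l; first exact: expR_ge0.
apply: ler_wpM2l => //; rewrite mulrC ler_norml.
have h1 := lnl x y xl yl; have := lnl y x yl xl; rewrite distrC => h2.
by apply/andP; split; lra.
Qed.

End power_function.

Section filters.
Context {R : realType}.

Lemma punctured_cvg0P (f : R -> R) (I : set R) (t : R) :
  (f s @[s --> within I t^'] --> (0 : R)) <->
  (forall e, 0 < e -> exists2 d, 0 < d &
    forall s, I s -> s != t -> `|s - t| < d -> `|f s| <= e).
Proof.
split=> [/cvgrPdist_le H e /H [d /= d0 Hd]|H].
  exists d => // s Is st sd; rewrite -normrN -[- f s]sub0r.
  by apply: Hd => //; rewrite /ball /= distrC.
apply/cvgrPdist_le => e /H[d d0 Hd]; exists d => //= s; rewrite /ball /= => sd st Is.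
by rewrite sub0r normrN; apply: Hd => //; rewrite distrC.
Qed.

Lemma within_cvg0 (f : R -> R) (I : set R) (t : R) :
  (forall e, 0 < e -> exists2 d, 0 < d & forall s, I s -> `|s - t| < d -> `|f s| <= e) ->
  f s @[s --> within I (nbhs t)] --> (0 : R).
Proof.
move=> H; apply/cvgrPdist_le => e /H[d d0 Hd]; exists d => //= s; rewrite /ball /= => sd Is.
by rewrite sub0r normrN; apply: Hd => //; rewrite distrC.
Qed.

End filters.

Section flow_field_lipschitz.
Context {R : realType} (lambda a : R) (lambda0 : 0 < lambda).
Implicit Types (gamma w : R -> 'rV[R]_2).

Lemma represents_velocity gamma w : represents gamma w -> 0 < len gamma ->
  represents (velocity lambda w) (velocity_deriv lambda w).
Proof.
move=> hg L0; apply: velocity_represents => //; first exact: represents_density hg L0.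
by case: hg.
Qed.

Lemma represents_F gamma w : represents gamma w -> 0 < len gamma ->
  represents (F lambda a gamma)
    (fun u => (len gamma `^ (a - 2) / lambda ^+ 2) *: velocity_deriv lambda w u).
Proof.
move=> hg L0; rewrite (F_velocity lambda0 a hg L0).
exact: representsZ (represents_velocity hg L0).
Qed.

(** The exponent of the length may be negative and the velocity divides by the
    length, so that the bounds on the length are used twice. *)
Lemma F_lipschitz (l Lam : R) : 0 < l -> exists2 K, 0 <= K &
  forall gamma w gamma' w', represents gamma w -> represents gamma' w' ->
    l <= len gamma <= Lam -> l <= len gamma' <= Lam ->
    W11_norm (fun u => F lambda a gamma u - F lambda a gamma' u) <=
      K * W11_norm (fun u => gamma u - gamma' u).
Proof.
move=> l0; have [P P0 HP] := powR_lipschitz (a - 2) Lam l0.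
have [V V0 HV] := velocity_lipschitz lambda0 Lam l0.
have s0 : 0 < lambda ^+ 2 by rewrite exprn_gt0.
set Q := P / lambda ^+ 2; have Q0 : 0 <= Q by rewrite divr_ge0 // ltW.
exists (Q * (4 * V) + Q * (8 * `|Lam|)).
  by rewrite addr_ge0 // mulr_ge0 // mulr_ge0.
move=> gamma w gamma' w' hg hg' hl hl'.
have [ll lL] := andP hl; have [ll' lL'] := andP hl'.
have L0 := lt_le_trans l0 ll; have L0' := lt_le_trans l0 ll'.
have dw := represents_density hg L0; have dw' := represents_density hg' L0'.
have [_ m0 _] := hg; have [_ m0' _] := hg'.
have rv := represents_velocity hg L0; have rv' := represents_velocity hg' L0'.
rewrite (F_velocity lambda0 a hg L0) (F_velocity lambda0 a hg' L0').
have [hP1 hP2] := HP _ _ hl hl'.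
pose D := W11_norm (fun u => gamma u - gamma' u).
pose d := \I_(0, 1) (fun u => enorm (w u - w' u)).
have [d1 d2] : `|len gamma - len gamma'| <= d /\ d <= D := represents_len_dist hg hg'.
have D0 : 0 <= D := represents_W11_norm_ge0 (representsB hg hg').
suff main (c c' : R) : `|c| <= Q -> `|c - c'| <= Q * `|len gamma - len gamma'| ->
    W11_norm (fun u => c *: velocity lambda w u - c' *: velocity lambda w' u) <=
      (Q * (4 * V) + Q * (8 * `|Lam|)) * D.
  have i0 : 0 <= (lambda ^+ 2)^-1 by rewrite invr_ge0 ltW.
  apply: main.
    by rewrite normrM !ger0_norm ?powR_ge0 // ler_wpM2r.
  rewrite -mulrBl normrM (ger0_norm i0).
  by rewrite /Q mulrAC; exact: ler_wpM2r.
move=> cQ ccQ.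
have -> : (fun u => c *: velocity lambda w u - c' *: velocity lambda w' u) =
    (fun u => c *: (velocity lambda w u - velocity lambda w' u) +
      (c - c') *: velocity lambda w' u).
  by apply/funext => u; rewrite scalerBr scalerBl addrA subrK.
apply: le_trans (represents_W11_norm_lin c (representsB rv rv') (representsZ (c - c') rv')) _.
rewrite (represents_W11_normZ (c - c') rv') [leRHS]mulrDl.
have [hv1 hv2] : (forall i, `|velocity lambda w 0 0 i - velocity lambda w' 0 0 i| <= V * d) /\
    \I_(0, 1) (fun u => enorm (velocity_deriv lambda w u - velocity_deriv lambda w' u)) <= V * d.
  have eL : len gamma = total (speed w) := represents_len hg.
  have eL' : len gamma' = total (speed w') := represents_len hg'.
  by apply: HV => //; rewrite -?eL -?eL'.
have b1 : W11_norm (fun u => velocity lambda w u - velocity lambda w' u) <= 4 * V * D.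
  have start : enorm (velocity lambda w 0 - velocity lambda w' 0) <= 2 * (V * d).
    by apply: enorm_le => i; rewrite entryB.
  apply: le_trans (represents_W11_norm_le (representsB rv rv') start) _.
  apply: le_trans (lerD (lexx _) (ler_wpM2l (ler0n R 2) hv2)) _.
  have -> : 4 * V * D = 2 * (V * D) + 2 * (V * D) by ring.
  have h2V := ler_wpM2l (ler0n R 2) (ler_wpM2l V0 d2); exact: (lerD h2V h2V).
have b2 : W11_norm (velocity lambda w') <= 8 * `|Lam|.
  apply: le_trans (velocity_W11_norm lambda0 dw' m0') _.
  have eL' : len gamma' = total (speed w') := represents_len hg'.
  by rewrite ler_pM2l // -eL'; exact: le_trans lL' (ler_norm _).
have b3 : `|c - c'| <= Q * D.
  by apply: le_trans ccQ _; apply: ler_wpM2l => //; exact: le_trans d1 d2.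
have W1 := represents_W11_norm_ge0 (representsB rv rv').
have W2 := represents_W11_norm_ge0 rv'.
have := lerD (ler_pM (normr_ge0 c) W1 cQ b1) (ler_pM (normr_ge0 (c - c')) W2 b3 b2).
by rewrite mulrA [Q * D * _]mulrAC.
Qed.

End flow_field_lipschitz.

Section uniqueness.
Context {R : realType} (lambda a : R) (lambda0 : 0 < lambda).
Implicit Types (X Y Z dX dY : R -> R -> 'rV[R]_2) (T : \bar R).

Let time_interval_sub T (t s : R) : time_interval T t -> 0 <= s <= t -> time_interval T s.
Proof. by move=> [_ tT] /andP[s0 st]; split=> //; apply: le_lt_trans tT; rewrite lee_fin. Qed.

(** Clearing the denominator of the difference quotient includes the case
    [s = t] and composes with the triangle inequality. *)
Lemma C1_linearization T Y dY t : is_C1_derivative (time_interval T) Y dY ->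
  time_interval T t -> forall e, 0 < e -> exists2 d, 0 < d &
  forall s, time_interval T s -> `|s - t| < d ->
    W11_norm (fun u => Y s u - Y t u - (s - t) *: dY t u) <= e * `|s - t|.
Proof.
move=> [wY wdY qY _] It e e0; have /punctured_cvg0P /(_ e e0)[d d0 Hd] := qY t It.
exists d => // s Is sd; have rs := W11_represents (wY s Is); have rt := W11_represents (wY t It).
have rd := W11_represents (wdY t It).
have rr := representsB (representsB rs rt) (representsZ (s - t) rd).
have [->|st] := eqVneq s t.
  have -> : (fun u => Y t u - Y t u - (t - t) *: dY t u) = fun=> 0.
    by apply/funext => u; rewrite !subrr scale0r subr0.
  rewrite (represents_W11_norm (represents_cst 0)) enorm0 !integral_cst' // mul0r addr0.
  by rewrite mulr_ge0 // ltW.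
have st0 : s - t != 0 by rewrite subr_eq0.
have := Hd s Is st sd; rewrite ger0_norm; last first.
  by apply: (represents_W11_norm_ge0 (representsB (representsZ (s - t)^-1 (representsB rs rt)) rd)).
move=> h; have -> : (fun u => Y s u - Y t u - (s - t) *: dY t u) =
    (fun u => (s - t) *: ((s - t)^-1 *: (Y s u - Y t u) - dY t u)).
  by apply/funext => u; rewrite scalerBr scalerA divff // scale1r.
rewrite (represents_W11_normZ (s - t) (representsB (representsZ (s - t)^-1 (representsB rs rt)) rd)).
by rewrite mulrC; exact: ler_wpM2r.
Qed.

Lemma C1_locally_lipschitz T Y dY t : is_C1_derivative (time_interval T) Y dY ->
  time_interval T t -> exists M, exists2 d, 0 < d &
  forall s, time_interval T s -> `|s - t| < d ->
    W11_norm (fun u => Y s u - Y t u) <= M * `|s - t|.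
Proof.
move=> hY It; have [d d0 Hd] := C1_linearization hY It ltr01.
exists (W11_norm (dY t) + 1), d => // s Is sd; have [wY wdY _ _] := hY.
have rs := W11_represents (wY s Is); have rt := W11_represents (wY t It).
have rd := W11_represents (wdY t It).
have -> : (fun u => Y s u - Y t u) = (fun u => (s - t) *: dY t u +
    (Y s u - Y t u - (s - t) *: dY t u)) by apply/funext => u; rewrite [RHS]addrC subrK.
apply: le_trans (represents_W11_norm_lin (s - t) rd
  (representsB (representsB rs rt) (representsZ (s - t) rd))) _.
by rewrite [leRHS]mulrDl mulrC; apply: lerD => //; exact: Hd.
Qed.

Lemma C1_continuous T Y dY t1 (f : (R -> 'rV[R]_2) -> R) :
  is_C1_derivative (time_interval T) Y dY -> time_interval T t1 ->
  (forall gamma v gamma' v', represents gamma v -> represents gamma' v' ->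
    `|f gamma - f gamma'| <= W11_norm (fun u => gamma u - gamma' u)) ->
  {within `[0, t1], continuous (fun t => f (Y t))}.
Proof.
move=> hY I1 Hf; have [wY _ _ _] := hY; apply: pointwise_lipschitz_continuous => t tT.
have It := time_interval_sub I1 tT; have [M [d d0 Hd]] := C1_locally_lipschitz hY It.
exists M, d => // s sT sd; have Is := time_interval_sub I1 sT.
exact: le_trans (Hf _ _ _ _ (W11_represents (wY s Is)) (W11_represents (wY t It))) (Hd s Is sd).
Qed.

Let len_lipschitz (gamma v gamma' v' : R -> 'rV[R]_2) : represents gamma v -> represents gamma' v' ->
  `|len gamma - len gamma'| <= W11_norm (fun u => gamma u - gamma' u).
Proof. by move=> hg hg'; have [h1 h2] := represents_len_dist hg hg'; exact: le_trans h1 h2. Qed.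

Let len_bounds T Y dY t1 : is_C1_derivative (time_interval T) Y dY -> time_interval T t1 ->
  positive_length (time_interval T) Y -> exists l Lam : R, 0 < l /\
    forall t, 0 <= t <= t1 -> l <= len (Y t) <= Lam.
Proof.
move=> hY I1 pY; have [t10 _] := I1; have cl := C1_continuous hY I1 len_lipschitz.
have [c ct Hc] := EVT_max t10 cl; have [d dt Hd] := EVT_min t10 cl.
move: ct dt; rewrite !in_itv /= => ct dt.
exists (len (Y d)), (len (Y c)); split; first by apply: pY; exact: time_interval_sub dt.
by move=> t tt; apply/andP; split; [apply: Hd|apply: Hc]; rewrite in_itv.
Qed.

(** Two solutions have a distance satisfying a Gronwall inequality, because the
    flow field is Lipschitz where the length stays in a compact subset of the
    half-line, and lengths do so on a compact time interval. *)
Theorem solution_unique T Y Z :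
  solution lambda a (time_interval T) Y -> positive_length (time_interval T) Y ->
  solution lambda a (time_interval T) Z -> positive_length (time_interval T) Z ->
  Y 0 = Z 0 -> forall t, time_interval T t -> Y t = Z t.
Proof.
move=> [dY hY eY] pY [dZ hZ eZ] pZ YZ0 t1 I1; have [t10 _] := I1.
have sub := time_interval_sub I1.
have [wY wdY _ _] := hY; have [wZ wdZ _ _] := hZ.
have [l [Lam [l0 Hl]]] := len_bounds hY I1 pY; have [l' [Lam' [l'0 Hl']]] := len_bounds hZ I1 pZ.
have m0 : 0 < Num.min l l' by rewrite lt_min l0.
have [K K0 HK] := F_lipschitz a lambda0 (Num.max Lam Lam') m0.
pose phi t := W11_norm (fun u => Y t u - Z t u).
have ry t (tt : 0 <= t <= t1) := W11_represents (wY t (sub t tt)).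
have rz t (tt : 0 <= t <= t1) := W11_represents (wZ t (sub t tt)).
have rdy t (tt : 0 <= t <= t1) := W11_represents (wdY t (sub t tt)).
have rdz t (tt : 0 <= t <= t1) := W11_represents (wdZ t (sub t tt)).
have dF t : 0 <= t <= t1 -> W11_norm (fun u => dY t u - dZ t u) <= K * phi t.
  move=> tt; rewrite (eY t (sub t tt)) (eZ t (sub t tt)).
  have /andP[h1 h2] := Hl t tt; have /andP[h3 h4] := Hl' t tt.
  have hb1 : Num.min l l' <= len (Y t) <= Num.max Lam Lam'.
    by rewrite ge_min h1 le_max h2.
  have hb2 : Num.min l l' <= len (Z t) <= Num.max Lam Lam'.
    by rewrite ge_min h3 orbT le_max h4 orbT.
  exact: (HK _ _ _ _ (ry t tt) (rz t tt) hb1 hb2).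
have cphi : {within `[0, t1], continuous phi}.
  apply: pointwise_lipschitz_continuous => t tt; have It := sub t tt.
  have [M [d d0 Hd]] := C1_locally_lipschitz hY It.
  have [M' [d' d'0 Hd']] := C1_locally_lipschitz hZ It.
  exists (M + M'), (Num.min d d'); first by rewrite lt_min d0.
  move=> s ss; rewrite lt_min => /andP[sd sd']; have Is := sub s ss.
  rewrite mulrDl; have := Hd s Is sd; have := Hd' s Is sd'.
  move=> dz dy; apply: le_trans (lerD dy dz).
  exact: (represents_dist_lipschitz (ry s ss) (ry t tt) (rz s ss) (rz t tt)).
have phi0 : phi 0 <= 0.
  rewrite /phi YZ0 (_ : (fun u => _) = fun=> 0); last by apply/funext => u; rewrite subrr.
  by rewrite (represents_W11_norm (represents_cst 0)) enorm0 !integral_cst' // mul0r addr0.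
have phi1 : phi t1 <= 0.
  apply: (dini_gronwall K0 cphi phi0); last by rewrite t10 lexx.
  move=> t /andP[t0 tt1] _ e e0; have tt : 0 <= t <= t1 by rewrite t0 ltW.
  have It := sub t tt; have e2 : 0 < e / 2 by rewrite divr_gt0.
  have [d d0 Hd] := C1_linearization hY It e2; have [d' d'0 Hd'] := C1_linearization hZ It e2.
  exists (Num.min d d'); first by rewrite lt_min d0.
  move=> s /andP[ts]; rewrite -ltrBlDl lt_min => /andP[sd sd'] st1.
  have ss : 0 <= s <= t1 by rewrite st1 (le_trans t0) // ltW.
  have h0 : 0 < s - t by rewrite subr_gt0.
  have := Hd s (sub s ss); rewrite (gtr0_norm h0) => /(_ sd) h1.
  have := Hd' s (sub s ss); rewrite (gtr0_norm h0) => /(_ sd') h2.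
  rewrite /phi; have -> : (fun u => Y s u - Z s u) = (fun u => (Y t u - Z t u) +
      ((s - t) *: (dY t u - dZ t u) + ((Y s u - Y t u - (s - t) *: dY t u) -
        (Z s u - Z t u - (s - t) *: dZ t u)))).
    by apply/funext => u; apply/rowP => i; rewrite !mxE; ring.
  have r1 := representsB (ry t tt) (rz t tt); have r2 := representsB (rdy t tt) (rdz t tt).
  have r3 := representsB (representsB (ry s ss) (ry t tt)) (representsZ (s - t) (rdy t tt)).
  have r4 := representsB (representsB (rz s ss) (rz t tt)) (representsZ (s - t) (rdz t tt)).
  apply: le_trans (represents_W11_normD r1 (representsD (representsZ (s - t) r2) (representsB r3 r4))) _.
  rewrite lerD2l.
  apply: le_trans (represents_W11_norm_lin (s - t) r2 (representsB r3 r4)) _.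
  rewrite (gtr0_norm h0) [leRHS]mulrDr; apply: lerD; first by rewrite ler_pM2l //; exact: dF.
  have -> : (s - t) * e = e / 2 * (s - t) + e / 2 * (s - t) by field.
  apply: le_trans (lerD h1 h2).
  exact: (represents_W11_normB r3 r4).
have t11 : 0 <= t1 <= t1 by rewrite t10 lexx.
apply/funext => u; apply/eqP; rewrite -subr_eq0; apply/eqP/enorm_eq0/eqP.
rewrite eq_le enorm_ge0 andbT; apply: le_trans phi1.
exact: (represents_sup_le u (representsB (ry t1 t11) (rz t1 t11))).
Qed.

End uniqueness.

(** * Change of time *)

Section order_and_limits.
Context {R : realType}.

Lemma lerV2 (x y : R) : 0 < x -> x <= y -> y^-1 <= x^-1.
Proof. by move=> x0 xy; rewrite lef_pV2 // posrE // (lt_le_trans x0). Qed.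

Lemma cvg0_up_to (T : \bar R) (f : R -> R) : (0 < T)%E ->
  (forall e, 0 < e -> exists r, time_interval T r /\
     forall t, time_interval T t -> r <= t -> `|f t| <= e) ->
  f t @[t --> up_to T] --> (0 : R).
Proof.
case: T => [T| |] T0 H //=; apply/cvgrPdist_le => e /H[r [[r0 rT] Hr]]; near=> t;
  rewrite sub0r normrN; apply: Hr.
- have rt : r <= t by near: t; apply: nbhs_left_ge; rewrite -lte_fin.
  split; first exact: le_trans rt.
  by rewrite lte_fin; near: t; exact: nbhs_left_lt.
- by near: t; apply: nbhs_left_ge; rewrite -lte_fin.
- have rt : r <= t by near: t; exact: nbhs_pinfty_ge (num_real r).
  by split; [exact: le_trans rt|exact: ltry].
- by near: t; exact: nbhs_pinfty_ge (num_real r).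
Unshelve. all: by end_near.
Qed.

End order_and_limits.

Section time_change.
Context {R : realType} (lambda a : R) (lambda0 : 0 < lambda).
Variables X w : R -> R -> 'rV[R]_2.
Hypothesis X_rep : forall t, 0 <= t -> represents (X t) (w t).
Hypothesis w_density : forall t, 0 <= t -> is_density (w t).
Hypothesis X_quad : forall T, 0 <= T -> exists2 C, 0 <= C &
  forall s t, 0 <= s <= T -> 0 <= t <= T ->
    W11_norm (fun u => X s u - X t u - (s - t) *: velocity lambda (w t) u) <= C * (s - t) ^+ 2.

Let L t := len (X t).

Let L_gt0 t : 0 <= t -> 0 < L t.
Proof. by move=> t0; rewrite /L (represents_len (X_rep t0)); case: (w_density t0). Qed.

Let L_le t : 0 <= t -> L t <= L 0.
Proof.
move=> t0; apply: le_trans (flow_len_decay lambda0 X_rep w_density X_quad t0) _.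
have l4 : 0 <= 4 * lambda ^+ 2 by rewrite mulr_ge0 // sqr_ge0.
apply: ler_piMr; first exact/ltW/L_gt0.
rewrite -[leRHS]expR0 ler_expR mulNr oppr_le0 mulr_ge0 // divr_ge0 //.
exact: addr_ge0.
Qed.

(** The rate of the new time [clock] with respect to the time of the rescaled
    flow, so that the inverse of [clock] turns its velocity into [F]. *)
Definition clock_rate t : R := lambda ^+ 2 * len (X t) `^ (2 - a).
Definition clock t : R := \I_(0, t) clock_rate.
Definition lifespan : \bar R := ereal_sup [set (clock t)%:E | t in [set t | 0 <= t]].
Definition clock_inv t : R := xget 0 [set s | 0 <= s /\ clock s = t].

Local Notation I := (time_interval lifespan).

Let s0 : 0 < lambda ^+ 2. Proof. by rewrite exprn_gt0. Qed.

Let clock_bounds S : 0 <= S -> exists m C, [/\ 0 < m, 0 <= C,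
  forall t, 0 <= t <= S -> m <= clock_rate t &
  forall s t, 0 <= s <= S -> 0 <= t <= S -> `|clock_rate s - clock_rate t| <= C * `|s - t|].
Proof.
move=> S0; set l := L 0 * expR (- 3 * S).
have L00 := L_gt0 (lexx 0).
have l0 : 0 < l by rewrite mulr_gt0 // expR_gt0.
have bL t : 0 <= t <= S -> l <= L t <= L 0.
  move=> /andP[t0 tS]; rewrite L_le // andbT.
  apply: le_trans (flow_len_lower lambda0 X_rep w_density X_quad t0).
  by apply: ler_wpM2l; [exact: ltW|rewrite ler_expR ler_wnM2l // lerN10].
have [P P0 HP] := powR_lipschitz (2 - a) (L 0) l0.
have [N N0 HN] := powR_lipschitz (- (2 - a)) (L 0) l0.
have [D D0 HD] := flow_step lambda0 X_rep w_density X_quad S0.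
have b0 : 0 <= (0 : R) <= S by rewrite lexx.
have Npos : 0 < N.
  by have [_] := HN _ _ (bL 0 b0) (bL 0 b0); apply: lt_le_trans; rewrite powR_gt0.
exists (lambda ^+ 2 / N), (lambda ^+ 2 * (P * (8 * L 0 + D))); split.
- exact: divr_gt0.
- apply: mulr_ge0; first exact: ltW.
  by apply: mulr_ge0 => //; apply: addr_ge0 => //; apply: mulr_ge0 => //; exact: ltW.
- move=> t tS; apply: ler_wpM2l; first exact: ltW.
  have [_ h] := HN _ _ (bL t tS) (bL t tS); have [t0 _] := andP tS.
  move: h; rewrite powRN -/(L t) => h.
  by rewrite -[leRHS]invrK; apply: lerV2 h; rewrite invr_gt0; exact/powR_gt0/L_gt0.
move=> s t sS tS; have [s_0 _] := andP sS; have [t0 _] := andP tS.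
rewrite /clock_rate -mulrBr normrM (gtr0_norm s0) -[leRHS]mulrA; apply: ler_wpM2l; first exact: ltW.
have [h _] := HP _ _ (bL s sS) (bL t tS); apply: le_trans h _.
rewrite -mulrA; apply: ler_wpM2l => //.
have [d1 d2] := represents_len_dist (X_rep s_0) (X_rep t0).
have e3 := lerD (ler_wpM2l (ler0n R 8) (L_le t0)) (lexx D).
exact: le_trans (le_trans d1 d2) (le_trans (HD s t sS tS) (ler_wpM2r (normr_ge0 _) e3)).
Qed.

Let clock_summable S : 0 <= S -> summable_on 0 S clock_rate.
Proof.
move=> /clock_bounds[m [C [_ _ _ lip]]].
exact/continuous_summable/(lipschitz_within_continuous lip).
Qed.

Let clock_increment S m s t : (forall t, 0 <= t <= S -> m <= clock_rate t) ->
  0 <= t -> t <= s -> s <= S -> m * (s - t) <= clock s - clock t.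
Proof.
move=> hm t0 ts sS; have S0 : 0 <= S := le_trans t0 (le_trans ts sS).
have ss : summable_on 0 s clock_rate by exact: clock_summable (le_trans t0 ts).
rewrite /clock (integral_addition t0 ts ss) [X in _ <= X]addrC addrA addNr add0r.
rewrite -integral_cst' //; apply: integral_le.
- exact: summable_cst.
- exact: summable_sub ss.
- by move=> r /andP[tr rs]; apply: hm; rewrite (le_trans t0) //= (le_trans rs).
Qed.

Let clock_lt s t : 0 <= t -> t < s -> clock t < clock s.
Proof.
move=> t0 ts; have s_0 : 0 <= s by rewrite (le_trans t0) // ltW.
have [m [C [m0 _ hm _]]] := clock_bounds s_0.
rewrite -subr_gt0; apply: lt_le_trans (clock_increment hm t0 (ltW ts) (lexx s)).
by rewrite mulr_gt0 // subr_gt0.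
Qed.

Let clock_le_inv s t : 0 <= s -> 0 <= t -> clock s <= clock t -> s <= t.
Proof.
by move=> s_0 t0; apply: contraTT; rewrite -!ltNge => ts; exact: clock_lt.
Qed.

Let clock0 : clock 0 = 0. Proof. exact: integral_point. Qed.

Let clock_interval s : 0 <= s -> I (clock s).
Proof.
move=> s_0; have s1 : s < s + 1 by rewrite ltrDl.
split.
  move: s_0; rewrite le_eqVlt => /predU1P[<-|sp]; first by rewrite clock0.
  by rewrite -clock0; apply/ltW/clock_lt.
apply: (@lt_le_trans _ _ (clock (s + 1))%:E); first by rewrite lte_fin; exact: clock_lt.
by apply: ereal_sup_ubound; exists (s + 1) => //=; rewrite addr_ge0.
Qed.

Let clock_invP t : I t -> 0 <= clock_inv t /\ clock (clock_inv t) = t.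
Proof.
move=> [t0 tT]; rewrite /clock_inv; case: xgetP => [s -> [] //|no].
have [_ [r r0 <-] tr] := ereal_sup_gt tT; move: tr; rewrite lte_fin => tr.
have cc : {within `[0, r], continuous clock} := continuous_primitive r0 (clock_summable r0).
have [|c cr ct] := IVT r0 cc (v := t).
  have c0r : clock 0 <= clock r by rewrite clock0 (le_trans t0) // ltW.
  by rewrite (min_idPl c0r) (max_idPr c0r) clock0 t0 ltW.
by case: (no c); split=> //; move: cr; rewrite in_itv => /andP[].
Qed.

Let clock_invK s : 0 <= s -> clock_inv (clock s) = s.
Proof.
move=> s_0; have [i0 ie] := clock_invP (clock_interval s_0).
apply/eqP; rewrite eq_le; apply/andP; split; apply: clock_le_inv => //; by rewrite ie.
Qed.

Let clock_inv_le s t : I s -> I t -> s <= t -> clock_inv s <= clock_inv t.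
Proof.
move=> Is It st; have [s_0 se] := clock_invP Is; have [t0 te] := clock_invP It.
by apply: clock_le_inv => //; rewrite se te.
Qed.

(** The inverse function theorem for the clock, with a quadratic remainder. *)
Let clock_inv_quad t : I t -> exists2 S, clock_inv t < S & exists2 C, 0 <= C &
  forall s, I s -> s <= clock S -> [/\ clock_inv s <= S,
    `|clock_inv s - clock_inv t| <= C * `|s - t| &
    `|clock_inv s - clock_inv t - (s - t) / clock_rate (clock_inv t)| <= C * (s - t) ^+ 2].
Proof.
move=> It; have [i0 ie] := clock_invP It; set r := clock_inv t in i0 ie *.
have rS : r < r + 1 by rewrite ltrDl.
have S0 : 0 <= r + 1 by rewrite addr_ge0.
exists (r + 1) => //; have [m [C [m0 C0 hm lip]]] := clock_bounds S0.
exists (m^-1 + m^-1 * (C * (m^-1) ^+ 2)).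
  by rewrite addr_ge0 ?invr_ge0 ?(ltW m0) // mulr_ge0 ?invr_ge0 ?(ltW m0) // mulr_ge0 // sqr_ge0.
move=> s Is sS; have [j0 je] := clock_invP Is; set v := clock_inv s in j0 je *.
have vS : v <= r + 1.
  by rewrite -(clock_invK S0); apply: clock_inv_le => //; exact: clock_interval.
have rr : 0 <= r <= r + 1 by rewrite i0 ltW.
have vv : 0 <= v <= r + 1 by rewrite j0.
have first : `|v - r| <= m^-1 * `|s - t|.
  rewrite mulrC ler_pdivlMr // -ie -je mulrC; have [vr|/ltW vr] := leP v r.
    rewrite distrC (distrC (clock v)) ger0_norm ?subr_ge0 //.
    by apply: le_trans (ler_norm _); apply: clock_increment hm _ _ _ => //; rewrite ltW.
  rewrite ger0_norm ?subr_ge0 //; apply: le_trans (ler_norm _).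
  exact: clock_increment hm _ _ _.
have m10 : 0 <= m^-1 by rewrite invr_ge0 ltW.
have e0 : 0 <= m^-1 * (C * (m^-1) ^+ 2) by rewrite mulr_ge0 // mulr_ge0 // sqr_ge0.
split=> //.
  by apply: le_trans first _; apply: ler_wpM2r => //; rewrite lerDl.
have qm := hm r rr; have q0 : 0 < clock_rate r := lt_le_trans m0 qm.
have := primitive_increment lip vv rr; rewrite -/(clock v) -/(clock r) je ie => h.
have -> : v - r - (s - t) / clock_rate r = - (clock_rate r)^-1 * (s - t - (v - r) * clock_rate r).
  by field; rewrite gt_eqF.
rewrite normrM normrN normfV (gtr0_norm q0).
apply: (@le_trans _ _ (m^-1 * (C * (m^-1) ^+ 2) * (s - t) ^+ 2)); last first.
  by apply: ler_wpM2r; [exact: sqr_ge0|rewrite lerDr].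
rewrite -mulrA; apply: ler_pM => //; first by rewrite invr_ge0 ltW.
  by rewrite lef_pV2.
apply: le_trans h _; rewrite -mulrA; apply: ler_wpM2l => //.
by rewrite -exprMn -[leLHS]ger0_norm ?sqr_ge0 // -[leRHS]ger0_norm ?sqr_ge0 // !normrX
  ler_sqr ?nnegrE // normrM (ger0_norm m10).
Qed.

Definition flow t : R -> 'rV[R]_2 := X (clock_inv t).

Let flow_rep t : I t -> represents (flow t) (w (clock_inv t)).
Proof. by move=> /clock_invP[t0 _]; exact: X_rep. Qed.

Let flow_len t : I t -> 0 < len (flow t).
Proof. by move=> /clock_invP[t0 _]; exact: L_gt0. Qed.

Let F_flow t : I t -> F lambda a (flow t) =
  fun u => (clock_rate (clock_inv t))^-1 *: velocity lambda (w (clock_inv t)) u.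
Proof.
move=> It; rewrite (F_velocity lambda0 a (flow_rep It) (flow_len It)); apply/funext => u.
congr (_ *: _); rewrite /clock_rate -/(flow t) (invfM (lambda ^+ 2)) [RHS]mulrC.
by rewrite -powRN opprB.
Qed.

Let flow_quad t : I t -> exists2 S, clock_inv t < S & exists2 C, 0 <= C &
  forall s, I s -> s <= clock S -> clock_inv s <= S /\
    W11_norm (fun u => flow s u - flow t u - (s - t) *: F lambda a (flow t) u) <= C * (s - t) ^+ 2.
Proof.
move=> It; have [i0 ie] := clock_invP It; have [S rS [C C0 HC]] := clock_inv_quad It.
have S0 : 0 <= S by rewrite (le_trans i0) // ltW.
have [D D0 HD] := X_quad S0; exists S => //.
have rt := flow_rep It; have rv := represents_velocity lambda0 rt (flow_len It).
pose W := W11_norm (velocity lambda (w (clock_inv t))).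
have W0 : 0 <= W := represents_W11_norm_ge0 rv.
exists (C * W + D * C ^+ 2); first by rewrite addr_ge0 // mulr_ge0 // sqr_ge0.
move=> s Is sS; have [j0 je] := clock_invP Is; have [vS h1 h2] := HC s Is sS; split=> //.
have vv : 0 <= clock_inv s <= S by rewrite j0.
have rr : 0 <= clock_inv t <= S by rewrite i0 ltW.
set d := clock_inv s - clock_inv t in h1 h2.
have -> : (fun u => flow s u - flow t u - (s - t) *: F lambda a (flow t) u) =
    (fun u => (d - (s - t) / clock_rate (clock_inv t)) *: velocity lambda (w (clock_inv t)) u +
      (X (clock_inv s) u - X (clock_inv t) u - d *: velocity lambda (w (clock_inv t)) u)).
  apply/funext => u; rewrite F_flow // scalerA [in RHS]scalerBl.
  by rewrite [RHS]addrC addrA subrK.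
have rq := representsB (representsB (X_rep j0) (X_rep i0)) (representsZ d rv).
apply: le_trans (represents_W11_norm_lin (d - (s - t) / clock_rate (clock_inv t)) rv rq) _.
rewrite [leRHS]mulrDl [C * W * _]mulrAC; apply: lerD; first exact: ler_wpM2r.
apply: le_trans (HD _ _ vv rr) _; rewrite -/d -mulrA; apply: ler_wpM2l => //.
by rewrite -exprMn -[leLHS]ger0_norm ?sqr_ge0 // -[leRHS]ger0_norm ?sqr_ge0 // !normrX
  ler_sqr ?nnegrE // normrM (ger0_norm C0).
Qed.

(** The quadratic estimate gives the derivative, and the Lipschitz estimate for
    [F] the continuity of the derivative. *)
Theorem flow_solution : solution lambda a I flow.
Proof.
have rF t (It : I t) := represents_F a lambda0 (flow_rep It) (flow_len It).
have lt_clock t S : I t -> clock_inv t < S -> t < clock S.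
  by move=> It tS; have [i0 <-] := clock_invP It; exact: clock_lt.
exists (fun t => F lambda a (flow t)) => //; split.
- by move=> t It; exact: represents_W11 (flow_rep It).
- by move=> t It; exact: represents_W11 (rF t It).
- move=> t It; apply/punctured_cvg0P => e e0.
  have [S tS [C C0 HC]] := flow_quad It; have C1 : 0 < C + 1 by rewrite ltr_wpDl.
  have tc := lt_clock t S It tS.
  exists (Num.min (clock S - t) (e / (C + 1))); first by rewrite lt_min subr_gt0 tc divr_gt0.
  move=> s Is st; rewrite lt_min => /andP[sd se].
  have st0 : 0 < `|s - t| by rewrite normr_gt0 subr_eq0.
  have [|_ h] := HC s Is; first by have := ler_norm (s - t); lra.
  have rq := representsB (representsB (flow_rep Is) (flow_rep It)) (representsZ (s - t) (rF t It)).
  have -> : (s - t)^-1 *: (flow s - flow t) - F lambda a (flow t) = (fun u => (s - t)^-1 *: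
      (flow s u - flow t u - (s - t) *: F lambda a (flow t) u)).
    apply/funext => u; rewrite [RHS]scalerBr scalerA mulVf ?subr_eq0 // scale1r //.
  rewrite (represents_W11_normZ (s - t)^-1 rq) ger0_norm; last first.
    by rewrite mulr_ge0 // (represents_W11_norm_ge0 rq).
  rewrite normfV mulrC ler_pdivrMr //; apply: le_trans h _.
  have -> : (s - t) ^+ 2 = `|s - t| * `|s - t| by rewrite -normrM -expr2 ger0_norm ?sqr_ge0.
  rewrite mulrA; apply: ler_wpM2r => //; apply: (@le_trans _ _ ((C + 1) * `|s - t|)).
    by apply: ler_wpM2r => //; rewrite lerDl.
  by rewrite mulrC -ler_pdivlMr // ltW.
- move=> t It; apply: within_cvg0 => e e0; have [i0 ie] := clock_invP It.
  have [S tS [C C0 HC]] := flow_quad It; have tc := lt_clock t S It tS.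
  have S0 : 0 <= S by rewrite (le_trans i0) // ltW.
  have l0 : 0 < L 0 * expR (- 3 * S) by rewrite mulr_gt0 ?L_gt0 ?expR_gt0.
  have [K K0 HK] := F_lipschitz a lambda0 (L 0) l0.
  have bL s : I s -> clock_inv s <= S -> L 0 * expR (- 3 * S) <= len (flow s) <= L 0.
    move=> Is sS; have [j0 _] := clock_invP Is; rewrite -/(L (clock_inv s)) L_le // andbT.
    apply: le_trans (flow_len_lower lambda0 X_rep w_density X_quad j0).
    by apply: ler_wpM2l; [exact/ltW/L_gt0|rewrite ler_expR ler_wnM2l // lerN10].
  set W := W11_norm (F lambda a (flow t)).
  have W0 : 0 <= W := represents_W11_norm_ge0 (rF t It).
  have Q0 : 0 <= K * (W + C) by rewrite mulr_ge0 // addr_ge0.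
  have Q1 : 0 < K * (W + C) + 1 by rewrite ltr_wpDl.
  exists (Num.min 1 (Num.min (clock S - t) (e / (K * (W + C) + 1)))).
    by rewrite !lt_min ltr01 subr_gt0 tc divr_gt0.
  move=> s Is; rewrite !lt_min => /and3P[s1 sd se].
  have [|sS h] := HC s Is; first by have := ler_norm (s - t); lra.
  have rq := representsB (representsB (flow_rep Is) (flow_rep It)) (representsZ (s - t) (rF t It)).
  have rd := representsB (rF s Is) (rF t It).
  rewrite ger0_norm; last exact: (represents_W11_norm_ge0 rd).
  have h1 : W11_norm (fun u => F lambda a (flow s) u - F lambda a (flow t) u) <=
      K * W11_norm (fun u => flow s u - flow t u).
    by apply: HK (flow_rep Is) (flow_rep It) _ _; apply: bL => //; exact: ltW.
  have h2 : W11_norm (fun u => flow s u - flow t u) <= (W + C) * `|s - t|.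
    have -> : (fun u => flow s u - flow t u) = (fun u => (s - t) *: F lambda a (flow t) u +
        (flow s u - flow t u - (s - t) *: F lambda a (flow t) u)).
      by apply/funext => u; rewrite [RHS]addrC subrK.
    apply: le_trans (represents_W11_norm_lin (s - t) (rF t It) rq) _.
    rewrite [leRHS]mulrDl [W * _]mulrC lerD2l; apply: le_trans h _; apply: ler_wpM2l => //.
    have -> : (s - t) ^+ 2 = `|s - t| * `|s - t| by rewrite -normrM -expr2 ger0_norm ?sqr_ge0.
    by rewrite ler_piMr // ltW.
  apply: le_trans h1 _; apply: le_trans (ler_wpM2l K0 h2) _; rewrite mulrA.
  apply: (@le_trans _ _ ((K * (W + C) + 1) * `|s - t|)).
    by apply: ler_wpM2r => //; rewrite lerDl.
  by rewrite mulrC -ler_pdivlMr // ltW.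
Qed.

Lemma flow_positive_length : positive_length I flow.
Proof. by move=> t; exact: flow_len. Qed.

Lemma flow0 : flow 0 = X 0.
Proof. by rewrite /flow -[in LHS]clock0 clock_invK. Qed.

Lemma lifespan_gt0 : (0 < lifespan)%E.
Proof. by have [] := clock_interval (lexx 0); rewrite clock0. Qed.

(** The length decreases, so for [2 <= a] the clock runs at least at its initial
    rate. *)
Lemma lifespan_infinite : 2 <= a -> lifespan = +oo%E.
Proof.
move=> a2; pose c := clock_rate 0.
have c0 : 0 < c by rewrite mulr_gt0 // powR_gt0 //; exact: L_gt0.
have rate t : 0 <= t -> c <= clock_rate t.
  move=> t0; apply: ler_wpM2l; first exact: ltW.
  have e x : x `^ (2 - a) = (x `^ (a - 2))^-1 by rewrite -powRN opprB.
  have p x : 0 <= x -> 0 < L x `^ (a - 2) by move=> x0; exact/powR_gt0/L_gt0.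
  rewrite [leLHS]e [leRHS]e; apply: lerV2; first exact: p.
  have am : 0 <= a - 2 by rewrite subr_ge0.
  have n x : 0 <= x -> L x \in Num.nneg by move=> x0; rewrite nnegrE; exact/ltW/L_gt0.
  exact: (ge0_ler_powR am (n t t0) (n 0 (lexx 0)) (L_le t0)).
apply/eqyP => r r0.
apply: (@le_trans _ _ (clock (`|r| / c))%:E); last first.
  by apply: ereal_sup_ubound; exists (`|r| / c) => //=; rewrite divr_ge0 // ltW.
have t0 : 0 <= `|r| / c by rewrite divr_ge0 // ltW.
rewrite lee_fin; apply: le_trans (ler_norm r) _.
have := clock_increment (fun t tt => rate t (proj1 (andP tt))) (lexx 0) t0 (lexx _).
by rewrite clock0 !subr0 mulrC divfK // gt_eqF.
Qed.

(** For [a < 2] the exponential decay of the length makes the total of the clock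
    finite; integrating the exponential gives the bound with [4] in place
    of [8]. *)
Lemma lifespan_le : a < 2 ->
  (lifespan <= ((1 + 8 * lambda ^+ 2) / (4 * (2 - a)) * len (X 0) `^ (2 - a))%:E)%E.
Proof.
move=> a2; have b0 : 0 < 2 - a by rewrite subr_gt0.
have l4 : 0 < 4 * lambda ^+ 2 by rewrite mulr_gt0.
have k1 : 0 < 1 + 4 * lambda ^+ 2 by rewrite addr_gt0.
set k := 4 * lambda ^+ 2 / (1 + 4 * lambda ^+ 2); have k0 : 0 < k by exact: divr_gt0.
set P := L 0 `^ (2 - a); have P0 : 0 <= P by exact: powR_ge0.
pose c := - (k * (2 - a)); pose A := lambda ^+ 2 * P / (k * (2 - a)).
have kb : 0 < k * (2 - a) by exact: mulr_gt0.
have A0 : 0 <= A by rewrite divr_ge0 ?(ltW kb) // mulr_ge0 // ltW.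
apply: ge_ereal_sup => _ [t /= t0 <-]; rewrite lee_fin.
have qc : quad_deriv (fun t (_ : unit) => clock t) (fun t _ => clock_rate t).
  apply: quad_deriv_primitive => S /clock_bounds[m [C [_ C0 _ lip]]].
  by exists C => // s r _; exact: lip.
have qe := quad_derivZ (- A) (quad_deriv_expR c).
have rate s : 0 <= s -> clock_rate s <= - A * (c * expR (c * s)).
  move=> s_0; have -> : - A * (c * expR (c * s)) = lambda ^+ 2 * (P * expR (c * s)).
    by rewrite /A /c; field; rewrite !gt_eqF.
  apply: ler_wpM2l; first exact: ltW.
  have -> : expR (c * s) = expR (- k * s) `^ (2 - a).
    by rewrite /powR gt_eqF ?expR_gt0 // expRK; congr expR; rewrite /c; ring.
  rewrite /P -powRM ?expR_ge0 //; last exact/ltW/L_gt0.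
  apply: ge0_ler_powR; rewrite ?(ltW b0) ?nnegrE //; first exact/ltW/L_gt0.
    by rewrite mulr_ge0 ?expR_ge0 //; exact/ltW/L_gt0.
  exact: (flow_len_decay lambda0 X_rep w_density X_quad s_0).
have := quad_deriv_le qc qe rate (lexx 0) t0; rewrite clock0 subr0 mulr0 expR0 => h.
apply: le_trans h _; apply: (@le_trans _ _ A).
  rewrite mulr1 opprK -[leRHS]add0r lerD2r mulNr oppr_le0.
  exact: mulr_ge0 A0 (expR_ge0 _).
have -> : A = (1 + 4 * lambda ^+ 2) / (4 * (2 - a)) * P.
  by rewrite /A /k; field; rewrite !gt_eqF.
apply: ler_wpM2r => //; apply: ler_wpM2r; first by rewrite invr_ge0 mulr_ge0 // ltW.
by rewrite lerD2l ler_wpM2r ?ler_nat // ltW.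
Qed.

(** The limits of the rescaled flow and of the flow are the same, since the
    clock maps the half-line onto the whole time interval. *)
Lemma flow_converges : exists x : 'rV[R]_2, enorm x <= Linfty_norm (X 0) /\
  W11_norm (flow t - (fun=> x)) @[t --> up_to lifespan] --> (0 : R).
Proof.
have [x hx [M HM]] := flow_limit lambda0 X_rep w_density X_quad.
exists x; split=> //; set k := 4 * lambda ^+ 2 / (1 + 4 * lambda ^+ 2) in HM.
have k0 : 0 < k.
  by rewrite /k divr_gt0 ?mulr_gt0 // addr_gt0 // mulr_gt0.
have late e : 0 < e -> exists2 r, 0 <= r & forall t, I t -> clock r <= t ->
    `|W11_norm (flow t - (fun=> x))| <= e.
  move=> e0; have M0 : 0 <= `|M| by [].
  have r0 : 0 <= `|M| / e / k by rewrite divr_ge0 ?(ltW k0) // divr_ge0 // ltW.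
  exists (`|M| / e / k) => // t It rt; have [i0 ie] := clock_invP It.
  have ri : `|M| / e / k <= clock_inv t by apply: clock_le_inv => //; rewrite ie.
  have rep := representsB (flow_rep It) (represents_cst x).
  rewrite ger0_norm; last exact: (represents_W11_norm_ge0 rep).
  have hy : `|M| / e <= expR (`|M| / e) by apply: le_trans (expR_ge1Dx _); rewrite lerDr.
  apply: le_trans (HM _ i0) _; apply: (@le_trans _ _ (`|M| * expR (- (`|M| / e)))).
    apply: (@le_trans _ _ (`|M| * expR (- k * clock_inv t))).
      by apply: ler_wpM2r; [exact: expR_ge0|exact: ler_norm].
    by apply: ler_wpM2l => //; rewrite ler_expR mulNr lerN2 [k * _]mulrC -ler_pdivrMr.
  by rewrite expRN ler_pdivrMr ?expR_gt0 // mulrC -ler_pdivrMr.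
apply: cvg0_up_to => [|e e0]; first exact: lifespan_gt0.
have [r r0 Hr] := late e e0; exists (clock r); split; first exact: clock_interval.
exact: Hr.
Qed.

End time_change.

(** * Existence, uniqueness and convergence *)

Unset Implicit Arguments.

Theorem theorem1p1 (R : realType) (X0 : R -> 'rV[R]_2) (lambda a : R)
    (hX0 : W11 X0) (hlen : 0 < len X0) (hlambda : 0 < lambda) :
  exists (T : \bar R) (X : R -> R -> 'rV[R]_2),
    [/\ [/\ solution lambda a (time_interval T) X,
            positive_length (time_interval T) X &
            X 0 = X0],
        forall Y : R -> R -> 'rV[R]_2,
          solution lambda a (time_interval T) Y ->
          positive_length (time_interval T) Y ->
          Y 0 = X0 ->
          forall t, time_interval T t -> Y t = X t,
        2 <= a -> T = +oo%E,
        a < 2 ->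
          (0 < T)%E /\
          (T <= ((1 + 8 * lambda ^+ 2) / (4 * (2 - a)) *
                 len X0 `^ (2 - a))%:E)%E &
        exists x : 'rV[R]_2,
          enorm x <= Linfty_norm X0 /\
          W11_norm (X t - (fun=> x)) @[t --> up_to T] --> (0 : R)].
Proof.
have r0 := W11_represents hX0; have d0 := represents_density r0 hlen.
have [X [w [XE Xr wd Xq]]] := rescaled_flow hlambda r0 d0.
have sX : solution lambda a (time_interval (lifespan lambda a X)) (flow lambda a X).
  exact: (flow_solution a hlambda Xr wd Xq).
have pX : positive_length (time_interval (lifespan lambda a X)) (flow lambda a X).
  exact: (flow_positive_length hlambda Xr wd Xq).
have X00 : flow lambda a X 0 = X0 by rewrite (flow0 a hlambda Xr wd Xq) XE.
exists (lifespan lambda a X), (flow lambda a X); split.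
- by [].
- move=> Y sY pY Y0 t It.
  by apply: (solution_unique hlambda sY pY sX pX) It; rewrite X00.
- by move=> a2; exact: (lifespan_infinite hlambda Xr wd Xq a2).
- move=> a2; split; first exact: (lifespan_gt0 a hlambda Xr wd Xq).
  by rewrite -XE; exact: (lifespan_le hlambda Xr wd Xq a2).
- by rewrite -XE; exact: (flow_converges a hlambda Xr wd Xq).
Qed.
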